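(* The space $(G^s, \langle \cdot, \cdot \rangle)$ is isometric to a subset of the unit sphere in $L^2(S^1; \mathbb{C})$. More precisely, for any $s > 5/2$, the map $\Phi: G^s \to \mathcal{U}^{s-1} \subset S^\infty$ defined by $$\Phi(\varphi, \alpha) = \sqrt{\varphi_x}\, e^{i\alpha/2}$$ is a diffeomorphism and an isometry.
   Context: $S^1=\mathbb{R}/\mathbb{Z}$ is the circle of length one and $S^1_{4\pi} = \mathbb{R}/4\pi\mathbb{Z}$ the circle of length $4\pi$ (so $e^{i\alpha/2}$ is well defined for $\alpha\in S^1_{4\pi}$). Subscript $x$ denotes the derivative in $x\in S^1$. The manifold $G^s$ ($s>5/2$). $H_0^s(S^1;\mathbb{R}) = \{u\in H^s(S^1;\mathbb{R}) : u(0)=0\}$. $\mathrm{Diff}_0^s(S^1)$ is the space of orientation-preserving diffeomorphisms $\varphi$ of $S^1$ of Sobolev class $H^s$ with $\varphi(0)=0$; it is identified with the open subset $\{\mathrm{id}+h : h\in H^s(S^1;\mathbb{R}),\ h_x>-1,\ h(0)=0\}$ of the affine space $\mathrm{id}+H_0^s(S^1;\mathbb{R})$, which gives a global chart. $H^{s-1}(S^1;S^1_{4\pi})$ is the Banach manifold, modeled on $H^{s-1}(S^1;\mathbb{R})$, of maps $S^1\to S^1_{4\pi}$ of class $H^{s-1}$. $G^s$ is the semidirect product of $\mathrm{Diff}_0^s(S^1)$ and $H^{s-1}(S^1;S^1_{4\pi})$: it is the product Banach manifold with multiplication $(\varphi,\alpha)(\psi,\beta) = (\varphi\circ\psi, \beta+\alpha\circ\psi)$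 and neutral element $(\mathrm{id},0)$. Tangent spaces are identified: $T_{(\varphi,\alpha)}G^s\simeq H_0^s(S^1;\mathbb{R})\times H^{s-1}(S^1;\mathbb{R})$. The (weak, right-invariant) Riemannian metric on $G^s$ is $$\langle U,V\rangle_{(\varphi,\alpha)} = \frac14\int_{S^1}\left(\frac{U_{1x}V_{1x}}{\varphi_x}+U_2V_2\varphi_x\right)dx,\qquad U=(U_1,U_2),\ V=(V_1,V_2)\in T_{(\varphi,\alpha)}G^s.$$ The sphere. $S^\infty$ is the unit sphere in $L^2(S^1;\mathbb{C})$, and for a Sobolev index $r$, $S^{\infty,r}=\{f\in H^r(S^1;\mathbb{C}) : \int_{S^1}|f|^2dx=1\}$, a Banach manifold with the charts given by stereographic projection from the constant functions $\pm1$ onto $\{h\in H^r(S^1;\mathbb{C}): \mathrm{Re}\int_{S^1}h\,dx=0\}$. $\mathcal{U}^{r}=\{f\in S^{\infty,r} : |f(x)|>0 \text{ for all } x\in S^1\}$ is an open subset, with the inherited manifold structure and the weak Riemannian metric inherited from $L^2$: $\langle X,Y\rangle_{L^2}=\mathrm{Re}\int_{S^1}X\overline{Y}\,dx$ for $X,Y\in T_f\mathcal{U}^{r}$. *)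

(* Defs.v *)
From Stdlib Require Import Reals Lra Lia ZArith List.
From Stdlib Require Import FunctionalExtensionality ProofIrrelevance.
From Coquelicot Require Import Coquelicot.

Open Scope R_scope.

Section FunModule.
Variable V : ModuleSpace R_Ring.

Definition fun_AbelianMonoid_mixin : AbelianMonoid.mixin_of (R -> V).
Proof.
apply (AbelianMonoid.Mixin (R -> V) (fun f g x => plus (f x) (g x)) (fun _ => zero));
  intros; extensionality t.
- apply plus_comm.
- apply plus_assoc.
- apply plus_zero_r.
Defined.

Definition fun_AbelianGroup_mixin :
  AbelianGroup.mixin_of (AbelianMonoid.Pack (R -> V) fun_AbelianMonoid_mixin (R -> V)).
Proof.
apply (AbelianGroup.Mixin (AbelianMonoid.Pack (R -> V) fun_AbelianMonoid_mixin (R -> V))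
         (fun f x => opp (f x))).
intros f; extensionality t; exact (plus_opp_r (f t)).
Defined.

Definition fun_AbelianGroup : AbelianGroup :=
  AbelianGroup.Pack (R -> V) (AbelianGroup.Class _ _ fun_AbelianGroup_mixin) (R -> V).

Definition fun_ModuleSpace_mixin : ModuleSpace.mixin_of R_Ring fun_AbelianGroup.
Proof.
apply (ModuleSpace.Mixin R_Ring fun_AbelianGroup (fun a f x => scal a (f x)));
  intros; extensionality t.
- exact (scal_assoc x y (u t)).
- exact (scal_one (u t)).
- exact (scal_distr_l x (u t) (v t)).
- exact (scal_distr_r x y (u t)).
Defined.

Definition fun_ModuleSpace : ModuleSpace R_Ring :=
  ModuleSpace.Pack R_Ring (R -> V)
    (ModuleSpace.Class R_Ring (R -> V) (AbelianGroup.class fun_AbelianGroup)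
       fun_ModuleSpace_mixin) (R -> V).

End FunModule.

(** A linear subspace of a real vector space, with a norm that only needs to make
    sense on that subspace. *)
Record normed_subspace (V : ModuleSpace R_Ring) := NormedSubspace {
  ns_mem : V -> Prop;
  ns_norm : V -> R;
  ns_mem_zero : ns_mem zero;
  ns_mem_plus : forall u v, ns_mem u -> ns_mem v -> ns_mem (plus u v);
  ns_mem_scal : forall (a : R) u, ns_mem u -> ns_mem (scal a u);
  ns_triangle : forall u v, ns_mem u -> ns_mem v ->
    ns_norm (plus u v) <= ns_norm u + ns_norm v;
  ns_homog : forall (a : R) u, ns_mem u -> ns_norm (scal a u) <= Rabs a * ns_norm u;
  ns_definite : forall u, ns_mem u -> ns_norm u = 0 -> u = zero
}.

Arguments ns_mem {V}.
Arguments ns_norm {V}.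

Section SubNormed.
Variables (V : ModuleSpace R_Ring) (S : normed_subspace V).

Definition ns_type : Type := {v : V | ns_mem S v}.

Lemma ns_ext (u v : ns_type) : proj1_sig u = proj1_sig v -> u = v.
Proof.
destruct u as [u hu], v as [v hv]; simpl; intros e; subst v.
f_equal; apply proof_irrelevance.
Qed.

Lemma ns_mem_opp u : ns_mem S u -> ns_mem S (opp u).
Proof. intros h; rewrite <- scal_opp_one; now apply ns_mem_scal. Qed.

Definition ns_zero : ns_type := exist _ zero (ns_mem_zero V S).
Definition ns_plus (u v : ns_type) : ns_type :=
  exist _ (plus (proj1_sig u) (proj1_sig v))
    (ns_mem_plus V S _ _ (proj2_sig u) (proj2_sig v)).
Definition ns_opp (u : ns_type) : ns_type :=
  exist _ (opp (proj1_sig u)) (ns_mem_opp _ (proj2_sig u)).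
Definition ns_scal (a : R) (u : ns_type) : ns_type :=
  exist _ (scal a (proj1_sig u)) (ns_mem_scal V S a _ (proj2_sig u)).

Definition ns_AbelianMonoid_mixin : AbelianMonoid.mixin_of ns_type.
Proof.
apply (AbelianMonoid.Mixin ns_type ns_plus ns_zero);
  intros; apply ns_ext; simpl.
- apply plus_comm.
- apply plus_assoc.
- apply plus_zero_r.
Defined.

Definition ns_AbelianGroup_mixin :
  AbelianGroup.mixin_of (AbelianMonoid.Pack ns_type ns_AbelianMonoid_mixin ns_type).
Proof.
apply (AbelianGroup.Mixin (AbelianMonoid.Pack ns_type ns_AbelianMonoid_mixin ns_type)
         ns_opp).
intros u; apply ns_ext; exact (plus_opp_r (proj1_sig u)).
Defined.

Definition ns_AbelianGroup : AbelianGroup :=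
  AbelianGroup.Pack ns_type (AbelianGroup.Class _ _ ns_AbelianGroup_mixin) ns_type.

Definition ns_ModuleSpace_mixin : ModuleSpace.mixin_of R_Ring ns_AbelianGroup.
Proof.
apply (ModuleSpace.Mixin R_Ring ns_AbelianGroup ns_scal);
  intros; apply ns_ext.
- exact (scal_assoc x y (proj1_sig u)).
- exact (scal_one (proj1_sig u)).
- exact (scal_distr_l x (proj1_sig u) (proj1_sig v)).
- exact (scal_distr_r x y (proj1_sig u)).
Defined.

Definition ns_ModuleSpace : ModuleSpace R_Ring :=
  ModuleSpace.Pack R_Ring ns_type
    (ModuleSpace.Class R_Ring ns_type (AbelianGroup.class ns_AbelianGroup)
       ns_ModuleSpace_mixin) ns_type.

Definition ns_nrm (u : ns_ModuleSpace) : R := ns_norm S (proj1_sig u).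

Lemma ns_nrm_triangle (u v : ns_ModuleSpace) :
  ns_nrm (plus u v) <= ns_nrm u + ns_nrm v.
Proof. apply (ns_triangle V S); apply proj2_sig. Qed.

Lemma ns_nrm_homog (a : R) (u : ns_ModuleSpace) :
  ns_nrm (scal a u) <= Rabs a * ns_nrm u.
Proof. apply (ns_homog V S); apply proj2_sig. Qed.

Lemma ns_nrm_opp (u : ns_ModuleSpace) : ns_nrm (opp u) <= ns_nrm u.
Proof.
rewrite <- scal_opp_one.
apply Rle_trans with (1 := ns_nrm_homog (opp one) u).
change (Rabs (Ropp 1) * ns_nrm u <= ns_nrm u).
rewrite Rabs_Ropp, Rabs_R1; lra.
Qed.

Lemma ns_nrm_zero : ns_nrm zero <= 0.
Proof.
rewrite <- (scal_zero_l zero).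
apply Rle_trans with (1 := ns_nrm_homog zero zero).
change (Rabs 0 * ns_nrm zero <= 0); rewrite Rabs_R0; lra.
Qed.

Definition ns_ball (u : ns_ModuleSpace) (e : R) (v : ns_ModuleSpace) : Prop :=
  ns_nrm (minus v u) < e.

Definition ns_UniformSpace_mixin : UniformSpace.mixin_of ns_ModuleSpace.
Proof.
apply (UniformSpace.Mixin ns_ModuleSpace zero ns_ball); unfold ns_ball.
- intros u e; rewrite minus_eq_zero.
  apply Rle_lt_trans with (1 := ns_nrm_zero); apply cond_pos.
- intros u v e h; rewrite <- opp_minus.
  apply Rle_lt_trans with (1 := ns_nrm_opp _); exact h.
- intros u v w e1 e2 h1 h2.
  rewrite (minus_trans v).
  apply Rle_lt_trans with (1 := ns_nrm_triangle _ _); lra.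
Defined.

Definition ns_NormedModuleAux : NormedModuleAux R_AbsRing :=
  NormedModuleAux.Pack R_AbsRing ns_type
    (NormedModuleAux.Class R_AbsRing ns_type (ModuleSpace.class R_Ring ns_ModuleSpace)
       ns_UniformSpace_mixin) ns_type.

Definition ns_NormedModule_mixin :
  NormedModule.mixin_of R_AbsRing ns_NormedModuleAux.
Proof.
apply (NormedModule.Mixin R_AbsRing ns_NormedModuleAux ns_nrm 1).
- exact ns_nrm_triangle.
- exact ns_nrm_homog.
- intros x y e h; exact h.
- intros x y e h; rewrite Rmult_1_l; exact h.
- intros x h; apply ns_ext, (ns_definite V S); [apply proj2_sig | exact h].
Defined.

Definition ns_NormedModule : NormedModule R_AbsRing :=
  NormedModule.Pack R_AbsRing ns_type
    (NormedModule.Class R_AbsRing ns_type (NormedModuleAux.class R_AbsRing ns_NormedModuleAux)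
       ns_NormedModule_mixin) ns_type.

End SubNormed.

Notation CC := C_R_CompleteNormedModule.

Definition cis (t : R) : C := (cos t, sin t).

Definition fourier (f : R -> C) (n : Z) : C :=
  RInt (V := CC) (fun x => Cmult (f x) (cis (- (2 * PI * IZR n * x)))) 0 1.

Definition sqnorm_L2 (f : R -> C) : R := RInt (fun x => Cmod (f x) ^ 2) 0 1.

Definition sobolev_term (r : R) (f : R -> C) (n : nat) : R :=
  Rpower (INR (S n)) (2 * r) *
  (Cmod (fourier f (Z.of_nat (S n))) ^ 2 + Cmod (fourier f (- Z.of_nat (S n))) ^ 2).

(** Functions on the circle [R/Z] are 1-periodic functions on [R].  For [r > 1/2] every
    class in [H^r] has a unique continuous representative, and membership means
    [sum_n |n|^(2r) |f^(n)|^2 < oo]; only such [r] are used. *)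
Definition is_sobolev (r : R) (f : R -> C) : Prop :=
  (forall x, continuous (f : R -> CC) x) /\
  (forall x, f (x + 1) = f x) /\
  ex_series (sobolev_term r f).

(** By Parseval, this is the square root of [sum_n c_n |f^(n)|^2] with [c_0 = 1] and
    [c_n = 1 + |n|^(2r)] otherwise. *)
Definition sobolev_norm (r : R) (f : R -> C) : R :=
  sqrt (sqnorm_L2 f + Series (sobolev_term r f)).

Lemma continuous_C_pair (u v : R -> R) x :
  continuous u x -> continuous v x -> continuous ((fun t => (u t, v t)) : R -> CC) x.
Proof.
intros hu hv; unfold continuous.
apply filterlim_locally; intros eps.
generalize (proj1 (filterlim_locally _ _) hu eps) (proj1 (filterlim_locally _ _) hv eps).
intros h1 h2; generalize (filter_and _ _ h1 h2); apply filter_imp.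
intros t [a b]; split; assumption.
Qed.

Lemma continuous_Re (f : R -> C) x : continuous (f : R -> CC) x -> continuous (fun t => Re (f t)) x.
Proof.
intros h; apply (continuous_comp (V := CC) f Re); [exact h|].
unfold Re; rewrite (surjective_pairing (f x)); apply continuous_fst.
Qed.

Lemma continuous_Im (f : R -> C) x : continuous (f : R -> CC) x -> continuous (fun t => Im (f t)) x.
Proof.
intros h; apply (continuous_comp (V := CC) f Im); [exact h|].
unfold Im; rewrite (surjective_pairing (f x)); apply continuous_snd.
Qed.

Lemma continuous_cis (c x : R) : continuous ((fun t => cis (- (c * t))) : R -> CC) x.
Proof.
assert (h : continuous (fun t => - (c * t)) x).
{ apply (ex_derive_continuous (fun t => - (c * t))); auto_derive; trivial. }
apply continuous_C_pair; [apply continuous_cos_comp | apply continuous_sin_comp]; exact h.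
Qed.

Lemma continuous_Cmult (f g : R -> C) x :
  continuous (f : R -> CC) x -> continuous (g : R -> CC) x ->
  continuous ((fun t => Cmult (f t) (g t)) : R -> CC) x.
Proof.
intros hf hg.
apply continuous_C_pair.
- apply (continuous_minus (fun t => Re (f t) * Re (g t)) (fun t => Im (f t) * Im (g t)));
    apply (continuous_mult (K := R_AbsRing));
    auto using continuous_Re, continuous_Im.
- apply (continuous_plus (fun t => Re (f t) * Im (g t)) (fun t => Im (f t) * Re (g t)));
    apply (continuous_mult (K := R_AbsRing));
    auto using continuous_Re, continuous_Im.
Qed.

Lemma continuous_Cmod2 (f : R -> C) x :
  continuous (f : R -> CC) x -> continuous (fun t => Cmod (f t) ^ 2) x.
Proof.
intros h.
apply continuous_ext with (fun t => Re (f t) * Re (f t) + Im (f t) * Im (f t)).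
{ intros t; assert (e := Cmod2_alt (f t)); simpl in e |- *; rewrite e.
  change (Re (f t) * Re (f t) + Im (f t) * Im (f t) =
          Re (f t) * (Re (f t) * 1) + Im (f t) * (Im (f t) * 1)); ring. }
apply (continuous_plus (fun t => Re (f t) * Re (f t)) (fun t => Im (f t) * Im (f t)));
  apply (continuous_mult (K := R_AbsRing)); auto using continuous_Re, continuous_Im.
Qed.

Lemma continuous_ex_RInt (V : CompleteNormedModule R_AbsRing) (f : R -> V) a b :
  (forall x, continuous f x) -> ex_RInt f a b.
Proof. intros h; apply ex_RInt_continuous; auto. Qed.

Lemma fourier_plus (f g : R -> C) n :
  (forall x, continuous (f : R -> CC) x) -> (forall x, continuous (g : R -> CC) x) ->
  fourier (fun x => Cplus (f x) (g x)) n = Cplus (fourier f n) (fourier g n).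
Proof.
intros hf hg; unfold fourier.
rewrite <- (RInt_plus (V := CC)).
- apply (RInt_ext (V := CC)); intros x _; exact (Cmult_plus_distr_r _ _ _).
- apply continuous_ex_RInt; intros x; apply continuous_Cmult; auto.
  apply (continuous_cis (2 * PI * IZR n)).
- apply continuous_ex_RInt; intros x; apply continuous_Cmult; auto.
  apply (continuous_cis (2 * PI * IZR n)).
Qed.

Lemma fourier_scal (a : R) (f : R -> C) n :
  (forall x, continuous (f : R -> CC) x) ->
  fourier (fun x => Cmult (RtoC a) (f x)) n = Cmult (RtoC a) (fourier f n).
Proof.
intros hf; unfold fourier.
rewrite <- (scal_R_Cmult a).
rewrite <- (RInt_scal (V := CC)).
- apply (RInt_ext (V := CC)); intros x _.
  rewrite (scal_R_Cmult a).
  exact (eq_sym (Cmult_assoc _ _ _)).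
- apply continuous_ex_RInt; intros x; apply continuous_Cmult; auto.
  apply (continuous_cis (2 * PI * IZR n)).
Qed.

Lemma young_sq (t p q : R) : 0 < t -> (p + q) ^ 2 <= (1 + t) * p ^ 2 + (1 + / t) * q ^ 2.
Proof.
intros ht.
apply Rminus_le_0.
replace ((1 + t) * p ^ 2 + (1 + / t) * q ^ 2 - (p + q) ^ 2) with ((t * p - q) ^ 2 * / t)
  by (field; lra).
apply Rmult_le_pos; [apply pow2_ge_0 | left; now apply Rinv_0_lt_compat].
Qed.

Lemma Cmod_young (t : R) (a b : C) : 0 < t ->
  Cmod (a + b) ^ 2 <= (1 + t) * Cmod a ^ 2 + (1 + / t) * Cmod b ^ 2.
Proof.
intros ht; apply Rle_trans with ((Cmod a + Cmod b) ^ 2).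
- apply pow_incr; split; [apply Cmod_ge_0 | apply Cmod_triangle].
- now apply young_sq.
Qed.

Lemma sobolev_term_ge0 r f n : 0 <= sobolev_term r f n.
Proof.
apply Rmult_le_pos; [left; apply exp_pos|].
generalize (pow2_ge_0 (Cmod (fourier f (Z.of_nat (S n)))))
           (pow2_ge_0 (Cmod (fourier f (- Z.of_nat (S n))))); lra.
Qed.

Lemma sobolev_term_plus r (f g : R -> C) t n : 0 < t ->
  (forall x, continuous (f : R -> CC) x) -> (forall x, continuous (g : R -> CC) x) ->
  sobolev_term r (fun x => Cplus (f x) (g x)) n <=
    (1 + t) * sobolev_term r f n + (1 + / t) * sobolev_term r g n.
Proof.
intros ht hf hg; unfold sobolev_term; rewrite !fourier_plus; trivial.
generalize (Cmod_young t (fourier f (Z.of_nat (S n))) (fourier g (Z.of_nat (S n))) ht)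
  (Cmod_young t (fourier f (- Z.of_nat (S n))) (fourier g (- Z.of_nat (S n))) ht).
generalize (exp_pos (2 * r * ln (INR (S n)))); unfold Rpower.
set (w := exp _); intros hw h1 h2.
eapply Rle_trans.
{ apply Rmult_le_compat_l; [lra|]; apply Rplus_le_compat; eassumption. }
right; ring.
Qed.

Lemma sobolev_term_scal r (f : R -> C) (a : R) n :
  (forall x, continuous (f : R -> CC) x) ->
  sobolev_term r (fun x => Cmult (RtoC a) (f x)) n = a ^ 2 * sobolev_term r f n.
Proof.
intros hf; unfold sobolev_term; rewrite !fourier_scal; trivial.
rewrite !Cmod_mult, !Cmod_R, !Rpow_mult_distr, pow2_abs; ring.
Qed.

Lemma is_sobolev_zero r : is_sobolev r (fun _ => RtoC 0).
Proof.
repeat split.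
- intros x; apply continuous_const.
- apply (ex_series_ext (fun _ => 0)); [|exists 0; apply is_series_Reals; intros e he; exists O;
    intros n _; rewrite sum_eq_R0 by trivial; now rewrite R_dist_eq].
  intros n.
  replace (fun _ : R => RtoC 0) with (fun _ : R => Cmult (RtoC 0) (RtoC 0))
    by (extensionality x; apply Cmult_0_l).
  rewrite (sobolev_term_scal r (fun _ => RtoC 0)) by (intros x; apply continuous_const).
  rewrite pow_i, Rmult_0_l by lia; reflexivity.
Qed.

Lemma is_sobolev_plus r f g : is_sobolev r f -> is_sobolev r g ->
  is_sobolev r (fun x => Cplus (f x) (g x)).
Proof.
intros [cf [pf sf]] [cg [pg sg]]; repeat split.
- intros x; apply (continuous_plus (V := CC) f g); auto.
- intros x; now rewrite pf, pg.
- apply (ex_series_le (V := R_CompleteNormedModule) _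
    (fun n => (1 + 1) * sobolev_term r f n + (1 + / 1) * sobolev_term r g n)).
  + intros n; change (norm ?x) with (Rabs x).
    rewrite Rabs_pos_eq by apply sobolev_term_ge0.
    apply sobolev_term_plus; auto; lra.
  + apply (ex_series_plus (V := R_NormedModule));
      apply (ex_series_scal (V := R_NormedModule)); assumption.
Qed.

Lemma is_sobolev_scal r (a : R) f : is_sobolev r f ->
  is_sobolev r (fun x => Cmult (RtoC a) (f x)).
Proof.
intros [cf [pf sf]]; repeat split.
- intros x; apply continuous_Cmult; [apply continuous_const | auto].
- intros x; now rewrite pf.
- apply (ex_series_ext (fun n => a ^ 2 * sobolev_term r f n)).
  + intros n; now rewrite sobolev_term_scal.
  + now apply (ex_series_scal (V := R_NormedModule)).
Qed.

Lemma sqnorm_L2_ge0 (f : R -> C) : (forall x, continuous (f : R -> CC) x) -> 0 <= sqnorm_L2 f.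
Proof.
intros cf; apply RInt_ge_0; [lra| |intros; apply pow2_ge_0].
apply continuous_ex_RInt; intros; now apply continuous_Cmod2.
Qed.

Lemma sqnorm_L2_plus (f g : R -> C) t : 0 < t ->
  (forall x, continuous (f : R -> CC) x) -> (forall x, continuous (g : R -> CC) x) ->
  sqnorm_L2 (fun x => Cplus (f x) (g x)) <= (1 + t) * sqnorm_L2 f + (1 + / t) * sqnorm_L2 g.
Proof.
intros ht hf hg; unfold sqnorm_L2.
assert (ef : forall c, ex_RInt (fun x => scal c (Cmod (f x) ^ 2)) 0 1).
{ intros c; apply (ex_RInt_scal (V := R_NormedModule)), continuous_ex_RInt;
    intros; now apply continuous_Cmod2. }
assert (eg : forall c, ex_RInt (fun x => scal c (Cmod (g x) ^ 2)) 0 1).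
{ intros c; apply (ex_RInt_scal (V := R_NormedModule)), continuous_ex_RInt;
    intros; now apply continuous_Cmod2. }
apply Rle_trans with (RInt (fun x => plus (scal (1 + t) (Cmod (f x) ^ 2))
                                     (scal (1 + / t) (Cmod (g x) ^ 2))) 0 1).
- apply RInt_le; [lra | | |].
  + apply continuous_ex_RInt; intros; apply continuous_Cmod2.
    apply (continuous_plus (V := CC) f g); auto.
  + apply (ex_RInt_plus (V := R_NormedModule)); auto.
  + intros x _; now apply Cmod_young.
- right.
  rewrite (RInt_plus (V := R_CompleteNormedModule)) by auto.
  rewrite !(RInt_scal (V := R_CompleteNormedModule)); [reflexivity | |];
    apply continuous_ex_RInt; intros; now apply continuous_Cmod2.
Qed.

Lemma sqnorm_L2_scal (f : R -> C) (a : R) : (forall x, continuous (f : R -> CC) x) ->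
  sqnorm_L2 (fun x => Cmult (RtoC a) (f x)) = a ^ 2 * sqnorm_L2 f.
Proof.
intros hf; unfold sqnorm_L2.
transitivity (RInt (fun x => scal (a ^ 2) (Cmod (f x) ^ 2)) 0 1).
- apply RInt_ext; intros x _.
  rewrite Cmod_mult, Cmod_R, Rpow_mult_distr, pow2_abs; reflexivity.
- rewrite (RInt_scal (V := R_CompleteNormedModule)); [reflexivity|].
  apply continuous_ex_RInt; intros; now apply continuous_Cmod2.
Qed.

Lemma sqnorm_L2_eq0 (f : R -> C) : (forall x, continuous (f : R -> CC) x) ->
  (forall x, f (x + 1) = f x) -> sqnorm_L2 f = 0 -> f = (fun _ => RtoC 0).
Proof.
intros cf pf h0.
assert (in01 : forall x, 0 < x < 1 -> f x = RtoC 0).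
{ intros x hx.
  destruct (Req_dec (Cmod (f x)) 0) as [e|ne]; [now apply Cmod_eq_0|exfalso].
  assert (ha : 0 < Cmod (f x) ^ 2) by (apply pow_lt; generalize (Cmod_ge_0 (f x)); lra).
  pose proof (proj1 (filterlim_locally _ _) (continuous_Cmod2 f x (cf x))
    (mkposreal _ ha)) as [d hd]; simpl in hd.
  set (e := Rmin (d / 2) (Rmin (x / 2) ((1 - x) / 2))).
  assert (he : 0 < e /\ e < d /\ e < x /\ e < 1 - x).
  { unfold e; destruct d as [d dpos]; simpl.
    generalize (Rmin_l (d/2) (Rmin (x / 2) ((1 - x) / 2)))
      (Rmin_r (d/2) (Rmin (x / 2) ((1 - x) / 2)))
      (Rmin_l (x/2) ((1 - x) / 2)) (Rmin_r (x/2) ((1 - x) / 2)); intros.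
    repeat split; try lra; repeat apply Rmin_glb_lt; lra. }
  assert (ex : forall a b, ex_RInt (fun x => Cmod (f x) ^ 2) a b)
    by (intros; apply continuous_ex_RInt; intros; now apply continuous_Cmod2).
  assert (p1 : 0 <= RInt (fun x => Cmod (f x) ^ 2) 0 (x - e))
    by (apply RInt_ge_0; auto; [lra | intros; apply pow2_ge_0]).
  assert (p2 : 0 < RInt (fun x => Cmod (f x) ^ 2) (x - e) (x + e)).
  { apply RInt_gt_0; [lra| |intros; now apply continuous_Cmod2].
    intros y hy.
    assert (hb : ball x d y) by (apply (norm_compat1 (V := R_NormedModule));
      change (Rabs (y - x) < d); apply Rabs_def1; lra).
    specialize (hd y hb).
    change (Rabs (Cmod (f y) * (Cmod (f y) * 1) - Cmod (f x) * (Cmod (f x) * 1))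
             < Cmod (f x) * (Cmod (f x) * 1)) in hd.
    apply Rabs_def2 in hd; simpl; lra. }
  assert (p3 : 0 <= RInt (fun x => Cmod (f x) ^ 2) (x + e) 1)
    by (apply RInt_ge_0; auto; [lra | intros; apply pow2_ge_0]).
  unfold sqnorm_L2 in h0.
  rewrite <- (RInt_Chasles (V := R_CompleteNormedModule) _ 0 (x - e) 1) in h0 by auto.
  rewrite <- (RInt_Chasles (V := R_CompleteNormedModule) _ (x - e) (x + e) 1) in h0 by auto.
  change (RInt (fun x => Cmod (f x) ^ 2) 0 (x - e) +
    (RInt (fun x => Cmod (f x) ^ 2) (x - e) (x + e) +
     RInt (fun x => Cmod (f x) ^ 2) (x + e) 1) = 0) in h0.
  lra. }
assert (at0 : f 0 = RtoC 0).
{ destruct (Req_dec (Cmod (f 0)) 0) as [e|ne]; [now apply Cmod_eq_0|exfalso].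
  assert (ha : 0 < Cmod (f 0) ^ 2) by (apply pow_lt; generalize (Cmod_ge_0 (f 0)); lra).
  pose proof (proj1 (filterlim_locally _ _) (continuous_Cmod2 f 0 (cf 0))
    (mkposreal _ ha)) as [d hd]; simpl in hd.
  set (y := Rmin (d / 2) (1 / 2)).
  assert (hy : 0 < y < 1 /\ y < d).
  { unfold y; destruct d as [d dpos]; simpl.
    generalize (Rmin_l (d/2) (1/2)) (Rmin_r (d/2) (1/2)); intros.
    repeat split; try lra; apply Rmin_glb_lt; lra. }
  assert (hb : ball 0 d y) by (apply (norm_compat1 (V := R_NormedModule));
    change (Rabs (y - 0) < d); apply Rabs_def1; lra).
  specialize (hd y hb).
  rewrite (in01 y), Cmod_0 in hd by lra.
  change (Rabs (0 * (0 * 1) - Cmod (f 0) * (Cmod (f 0) * 1))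
             < Cmod (f 0) * (Cmod (f 0) * 1)) in hd.
  apply Rabs_def2 in hd; simpl in ha; lra. }
assert (pn : forall (n : nat) x, f (x + INR n) = f x).
{ induction n as [|n IH]; intros x; [now rewrite Rplus_0_r|].
  rewrite S_INR, <- Rplus_assoc, pf; apply IH. }
assert (pz : forall (k : Z) x, f (x + IZR k) = f x).
{ intros k x; destruct (Z_le_gt_dec 0 k).
  - rewrite <- (Z2Nat.id k), <- INR_IZR_INZ by lia; apply pn.
  - rewrite <- (pn (Z.to_nat (- k)) (x + IZR k)), INR_IZR_INZ, Z2Nat.id, opp_IZR by lia.
    f_equal; ring. }
extensionality x.
rewrite <- (pz (- Int_part x)%Z x), opp_IZR.
change (x + - IZR (Int_part x)) with (frac_part x).
destruct (base_fp x) as [h1 h2].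
destruct (Req_dec (frac_part x) 0) as [e|ne]; [now rewrite e|].
apply in01; lra.
Qed.

Definition sobolev_sq (r : R) (f : R -> C) : R := sqnorm_L2 f + Series (sobolev_term r f).

Lemma Series_sobolev_ge0 r f : ex_series (sobolev_term r f) -> 0 <= Series (sobolev_term r f).
Proof.
intros h.
rewrite <- (Rmult_0_l (Series (sobolev_term r f))), <- Series_scal_l.
apply Series_le; trivial.
intros n; generalize (sobolev_term_ge0 r f n); lra.
Qed.

Lemma sobolev_sq_ge0 r f : is_sobolev r f -> 0 <= sobolev_sq r f.
Proof.
intros [cf [_ sf]]; unfold sobolev_sq.
generalize (sqnorm_L2_ge0 f cf) (Series_sobolev_ge0 r f sf); lra.
Qed.

Lemma sobolev_sq_plus r f g t : 0 < t -> is_sobolev r f -> is_sobolev r g ->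
  sobolev_sq r (fun x => Cplus (f x) (g x)) <=
    (1 + t) * sobolev_sq r f + (1 + / t) * sobolev_sq r g.
Proof.
intros ht [cf [_ sf]] [cg [_ sg]]; unfold sobolev_sq.
generalize (sqnorm_L2_plus f g t ht cf cg).
assert (h : Series (sobolev_term r (fun x => Cplus (f x) (g x))) <=
  (1 + t) * Series (sobolev_term r f) + (1 + / t) * Series (sobolev_term r g)).
{ assert (s1 : ex_series (fun n => (1 + t) * sobolev_term r f n))
    by now apply (ex_series_scal (V := R_NormedModule)).
  assert (s2 : ex_series (fun n => (1 + / t) * sobolev_term r g n))
    by now apply (ex_series_scal (V := R_NormedModule)).
  rewrite <- !Series_scal_l, <- Series_plus by assumption.
  apply Series_le.
  - intros n; split; [apply sobolev_term_ge0 | now apply sobolev_term_plus].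
  - now apply (ex_series_plus (V := R_NormedModule)). }
lra.
Qed.

Lemma sobolev_norm_eq0 r f : is_sobolev r f -> sobolev_norm r f = 0 -> f = (fun _ => RtoC 0).
Proof.
intros hf h; pose proof (sobolev_sq_ge0 r f hf) as hp.
apply sqrt_eq_0 in h; [|exact hp].
destruct hf as [cf [pf sf]].
apply sqnorm_L2_eq0; trivial.
generalize (sqnorm_L2_ge0 f cf) (Series_sobolev_ge0 r f sf); lra.
Qed.

Lemma sobolev_norm_plus r f g : is_sobolev r f -> is_sobolev r g ->
  sobolev_norm r (fun x => Cplus (f x) (g x)) <= sobolev_norm r f + sobolev_norm r g.
Proof.
intros hf hg.
pose proof (sobolev_sq_ge0 r f hf) as qf; pose proof (sobolev_sq_ge0 r g hg) as qg.
destruct (Req_dec (sobolev_norm r f) 0) as [ef|nf].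
{ pose proof (sobolev_norm_eq0 r f hf ef) as e0.
  rewrite ef, e0; right; rewrite Rplus_0_l; f_equal; extensionality x; apply Cplus_0_l. }
destruct (Req_dec (sobolev_norm r g) 0) as [eg|ng].
{ pose proof (sobolev_norm_eq0 r g hg eg) as e0.
  rewrite eg, e0; right; rewrite Rplus_0_r; f_equal; extensionality x; apply Cplus_0_r. }
assert (pf : 0 < sobolev_norm r f) by (generalize (sqrt_pos (sobolev_sq r f)); unfold sobolev_sq;
  fold (sobolev_norm r f); lra).
assert (pg : 0 < sobolev_norm r g) by (generalize (sqrt_pos (sobolev_sq r g)); unfold sobolev_sq;
  fold (sobolev_norm r g); lra).
assert (sf : sobolev_sq r f = sobolev_norm r f ^ 2) by (unfold sobolev_norm; now rewrite pow2_sqrt).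
assert (sg : sobolev_sq r g = sobolev_norm r g ^ 2) by (unfold sobolev_norm; now rewrite pow2_sqrt).
assert (ht : 0 < sobolev_norm r g / sobolev_norm r f) by now apply Rdiv_lt_0_compat.
pose proof (sobolev_sq_plus r f g _ ht hf hg) as h.
rewrite sf, sg in h.
rewrite <- (sqrt_pow2 (sobolev_norm r f + sobolev_norm r g)) by lra.
apply sqrt_le_1_alt; fold (sobolev_sq r (fun x => Cplus (f x) (g x))).
apply Rle_trans with (1 := h); right; field; lra.
Qed.

Lemma sobolev_norm_scal r f (a : R) : is_sobolev r f ->
  sobolev_norm r (fun x => Cmult (RtoC a) (f x)) = Rabs a * sobolev_norm r f.
Proof.
intros hf; unfold sobolev_norm.
rewrite <- sqrt_Rsqr_abs, <- sqrt_mult_alt by apply Rle_0_sqr.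
f_equal; destruct hf as [cf [_ sf]].
rewrite sqnorm_L2_scal by trivial.
rewrite (Series_ext _ (fun n => a ^ 2 * sobolev_term r f n))
  by (intros; now apply sobolev_term_scal).
rewrite Series_scal_l; unfold Rsqr; ring.
Qed.

Lemma scal_fun_C (a : R) (f : fun_ModuleSpace C_R_ModuleSpace) :
  scal a f = (fun x => Cmult (RtoC a) (f x)).
Proof. extensionality x; exact (scal_R_Cmult a (f x)). Qed.

Definition sobolev_C (r : R) : normed_subspace (fun_ModuleSpace C_R_ModuleSpace).
Proof.
apply (NormedSubspace (fun_ModuleSpace C_R_ModuleSpace) (is_sobolev r) (sobolev_norm r)).
- apply is_sobolev_zero.
- intros u v; apply is_sobolev_plus.
- intros a u hu; rewrite scal_fun_C; now apply is_sobolev_scal.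
- intros u v; apply sobolev_norm_plus.
- intros a u hu; rewrite scal_fun_C; right; now apply sobolev_norm_scal.
- intros u; apply sobolev_norm_eq0.
Defined.

Definition toC (u : R -> R) : R -> C := fun x => RtoC (u x).

Lemma toC_plus (u v : fun_ModuleSpace R_ModuleSpace) :
  toC (plus u v) = (fun x => Cplus (toC u x) (toC v x)).
Proof. extensionality x; exact (RtoC_plus (u x) (v x)). Qed.

Lemma toC_scal (a : R) (u : fun_ModuleSpace R_ModuleSpace) :
  toC (scal a u) = (fun x => Cmult (RtoC a) (toC u x)).
Proof. extensionality x; exact (RtoC_mult a (u x)). Qed.

Lemma toC_eq0 (u : fun_ModuleSpace R_ModuleSpace) : toC u = (fun _ => RtoC 0) -> u = zero.
Proof. intros h; extensionality x; exact (RtoC_inj _ _ (f_equal (fun f => f x) h)). Qed.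

Definition sobolev_R (r : R) : normed_subspace (fun_ModuleSpace R_ModuleSpace).
Proof.
apply (NormedSubspace (fun_ModuleSpace R_ModuleSpace)
        (fun u => is_sobolev r (toC u)) (fun u => sobolev_norm r (toC u))).
- apply is_sobolev_zero.
- intros u v; rewrite toC_plus; apply is_sobolev_plus.
- intros a u; rewrite toC_scal; apply is_sobolev_scal.
- intros u v; rewrite toC_plus; apply sobolev_norm_plus.
- intros a u hu; rewrite toC_scal; right; now apply sobolev_norm_scal.
- intros u hu h; now apply toC_eq0, (sobolev_norm_eq0 r).
Defined.

Definition sobolev_R0 (s : R) : normed_subspace (fun_ModuleSpace R_ModuleSpace).
Proof.
apply (NormedSubspace (fun_ModuleSpace R_ModuleSpace)
        (fun u => is_sobolev s (toC u) /\ u 0 = 0) (fun u => sobolev_norm s (toC u))).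
- split; [apply is_sobolev_zero | reflexivity].
- intros u v [hu u0] [hv v0]; split; [rewrite toC_plus; now apply is_sobolev_plus|].
  change (u 0 + v 0 = 0); rewrite u0, v0; ring.
- intros a u [hu u0]; split; [rewrite toC_scal; now apply is_sobolev_scal|].
  change (a * u 0 = 0); rewrite u0; ring.
- intros u v [hu _] [hv _]; rewrite toC_plus; now apply sobolev_norm_plus.
- intros a u [hu _]; rewrite toC_scal; right; now apply sobolev_norm_scal.
- intros u [hu _] h; now apply toC_eq0, (sobolev_norm_eq0 s).
Defined.

Definition sobolev_hyperplane (r : R) : normed_subspace (fun_ModuleSpace C_R_ModuleSpace).
Proof.
apply (NormedSubspace (fun_ModuleSpace C_R_ModuleSpace)
        (fun f => is_sobolev r f /\ Re (RInt (V := CC) f 0 1) = 0) (sobolev_norm r)).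
- split; [apply is_sobolev_zero|].
  change (Re (RInt (V := CC) (fun _ => zero) 0 1) = 0); rewrite RInt_const.
  exact (Rmult_0_r (1 - 0)).
- intros u v [hu u0] [hv v0]; split; [now apply is_sobolev_plus|].
  replace (RInt (V := CC) (plus u v) 0 1)
    with (Cplus (RInt (V := CC) u 0 1) (RInt (V := CC) v 0 1)).
  + rewrite re_plus, u0, v0; ring.
  + symmetry; apply (RInt_plus (V := CC));
      apply continuous_ex_RInt; [apply hu | apply hv].
- intros a u [hu u0]; split; [rewrite scal_fun_C; now apply is_sobolev_scal|].
  replace (RInt (V := CC) (scal a u) 0 1)
    with (Cmult (RtoC a) (RInt (V := CC) u 0 1)).
  + rewrite re_scal_l, u0; ring.
  + rewrite <- (scal_R_Cmult a); symmetry; apply (RInt_scal (V := CC));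
      apply continuous_ex_RInt; apply hu.
- intros u v [hu _] [hv _]; now apply sobolev_norm_plus.
- intros a u [hu _]; rewrite scal_fun_C; right; now apply sobolev_norm_scal.
- intros u [hu _]; now apply sobolev_norm_eq0.
Defined.

(** [H^r(S^1; C)], [H^r(S^1; R)], [{u in H^s(S^1; R) | u 0 = 0}] and
    [{h in H^r(S^1; C) | Re (int h) = 0}], as real normed spaces. *)
Definition HC (r : R) : NormedModule R_AbsRing := ns_NormedModule _ (sobolev_C r).
Definition HR (r : R) : NormedModule R_AbsRing := ns_NormedModule _ (sobolev_R r).
Definition HR0 (s : R) : NormedModule R_AbsRing := ns_NormedModule _ (sobolev_R0 s).
Definition Hperp (r : R) : NormedModule R_AbsRing :=
  ns_NormedModule _ (sobolev_hyperplane r).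

Definition fn {W : ModuleSpace R_Ring} {S : normed_subspace (fun_ModuleSpace W)}
  (v : ns_NormedModule _ S) : R -> W := proj1_sig v.

(** A class of [R / 4 PI Z] is stored as its representative in [[0, 4 PI)]. *)
Record circle4pi := Circle4pi {
  representative : R;
  representative_bounds : 0 <= representative < 4 * PI
}.

Lemma circle4pi_eq (a b : circle4pi) : representative a = representative b -> a = b.
Proof.
destruct a as [a ha], b as [b hb]; simpl; intros e; subst b.
f_equal; apply proof_irrelevance.
Qed.

Lemma angle_bounds (a : R) : 0 <= 4 * PI * frac_part (a / (4 * PI)) < 4 * PI.
Proof.
generalize PI_RGT_0; intros hpi.
destruct (base_fp (a / (4 * PI))) as [h1 h2]; split.
- apply Rmult_le_pos; lra.
- rewrite <- (Rmult_1_r (4 * PI)) at 3; apply Rmult_lt_compat_l; lra.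
Qed.

Definition angle (a : R) : circle4pi := Circle4pi _ (angle_bounds a).

Lemma representative_angle (a : R) :
  representative (angle a) = a - 4 * PI * IZR (Int_part (a / (4 * PI))).
Proof. generalize PI_RGT_0; intros; simpl; unfold frac_part; field; lra. Qed.

Lemma angle_eq (a b : R) : angle a = angle b <-> exists k : Z, a = b + 4 * PI * IZR k.
Proof.
generalize PI_RGT_0; intros hpi; split.
- intros h; apply (f_equal representative) in h; rewrite !representative_angle in h.
  exists (Int_part (a / (4 * PI)) - Int_part (b / (4 * PI)))%Z; rewrite minus_IZR; lra.
- intros [k e]; apply circle4pi_eq; simpl; f_equal.
  destruct (base_fp (b / (4 * PI))) as [h1 h2].
  symmetry; apply (Int_part_frac_part_spec (a / (4 * PI)) (Int_part (b / (4 * PI)) + k)); [lra|].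
  rewrite plus_IZR; unfold frac_part; rewrite e; field; lra.
Qed.

Definition circle_shift (a : circle4pi) (t : R) : circle4pi := angle (representative a + t).

(** [exp (i a / 2)], well defined on [R / 4 PI Z]. *)
Definition half_exp (a : circle4pi) : C := cis (representative a / 2).

Lemma half_exp_angle (a : R) : half_exp (angle a) = cis (a / 2).
Proof.
unfold half_exp; rewrite representative_angle; unfold cis.
set (k := Int_part _).
replace ((a - 4 * PI * IZR k) / 2) with (a / 2 + 2 * IZR (- k) * PI)
  by (rewrite opp_IZR; field).
generalize (- k)%Z; intros n.
destruct (Z_le_gt_dec 0 n) as [hn|hn].
- rewrite <- (Z2Nat.id n), <- INR_IZR_INZ, cos_period, sin_period by lia; reflexivity.
- rewrite <- (cos_period (a / 2 + 2 * IZR n * PI) (Z.to_nat (- n))),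
    <- (sin_period (a / 2 + 2 * IZR n * PI) (Z.to_nat (- n))).
  rewrite INR_IZR_INZ, Z2Nat.id, opp_IZR by lia; do 2 f_equal; ring.
Qed.

(** A continuous map [R/Z -> R/4 PI Z] has a continuous lift [R -> R] that increases by
    [4 PI k] over a period, [k] being its degree; the map is of class [H^r] when the periodic
    part of the lift is. *)
Definition is_sobolev_circle (r : R) (alpha : R -> circle4pi) : Prop :=
  exists (k : Z) (u : R -> R), is_sobolev r (toC u) /\
    forall x, alpha x = angle (4 * PI * IZR k * x + u x).

Definition prod_norm {E : NormedModule R_AbsRing} (vs : list E) : R :=
  fold_right (fun v p => norm v * p) 1 vs.

Definition bounded_multilinear {E F : NormedModule R_AbsRing} (k : nat) (L : list E -> F) :
  Prop :=
  (forall l1 l2 v w, (length l1 + S (length l2) = k)%nat ->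
     L (l1 ++ plus v w :: l2) = plus (L (l1 ++ v :: l2)) (L (l1 ++ w :: l2))) /\
  (forall l1 l2 (a : R) v, (length l1 + S (length l2) = k)%nat ->
     L (l1 ++ scal a v :: l2) = scal a (L (l1 ++ v :: l2))) /\
  (exists M : R, forall l, length l = k -> norm (L l) <= M * prod_norm l).

(** [f] is of class C-infinity, in the sense of Frechet, on the open set [W]: [D [v1;..;vk] x]
    is the [k]-th differential of [f] at [x], and the differentials are differentiated for the
    operator norm of [k]-linear maps. *)
Definition smooth_on {E F : NormedModule R_AbsRing} (W : E -> Prop) (f : E -> F) : Prop :=
  open W /\
  exists D : list E -> E -> F,
    (forall x, W x -> D nil x = f x) /\
    (forall k x, W x -> bounded_multilinear k (fun l => D l x)) /\
    (forall k x, W x -> forall eps : posreal, locally x (fun y =>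
       forall l, length l = k ->
         norm (minus (minus (D l y) (D l x)) (D (minus y x :: l) x))
           <= eps * norm (minus y x) * prod_norm l)).

(** A manifold is given by the set of its points inside an ambient type, and by an atlas;
    a chart [c] is a partial injection, [c p x] meaning that [x] is the coordinate of [p]. *)
Record manifold := Manifold {
  ambient : Type;
  point : ambient -> Prop;
  model : NormedModule R_AbsRing;
  atlas : (ambient -> model -> Prop) -> Prop
}.

(** Every pair of charts is tested, and the domain of each local expression [g] is required to be
    open, so that smooth maps are continuous for the topologies defined by the atlases. *)
Definition smooth_map (M N : manifold) (f : ambient M -> ambient N) : Prop :=
  forall c d, atlas M c -> atlas N d ->
    exists g : model M -> model N,
      (forall p x y, c p x -> d (f p) y -> g x = y) /\
      smooth_on (fun x => exists p y, c p x /\ d (f p) y) g.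

Definition diffeomorphism (M N : manifold) (f : ambient M -> ambient N) : Prop :=
  (forall p, point M p -> point N (f p)) /\
  exists f' : ambient N -> ambient M,
    (forall q, point N q -> point M (f' q)) /\
    (forall p, point M p -> f' (f p) = p) /\
    (forall q, point N q -> f (f' q) = q) /\
    smooth_map M N f /\ smooth_map N M f'.

(** A diffeomorphism of the circle fixing [0] is represented by its lift to [R] fixing [0]. *)
Definition is_diffeo0 (s : R) (phi : R -> R) : Prop :=
  is_sobolev s (toC (fun x => phi x - x)) /\ phi 0 = 0 /\ forall x, 0 < Derive phi x.

Definition G_ambient : Type := ((R -> R) * (R -> circle4pi))%type.

Definition G_point (s : R) (p : G_ambient) : Prop :=
  is_diffeo0 s (fst p) /\ is_sobolev_circle (s - 1) (snd p).

Definition TG (s : R) : NormedModule R_AbsRing := prod_NormedModule _ (HR0 s) (HR (s - 1)).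

Definition G_shift {s : R} (p : G_ambient) (V : TG s) : G_ambient :=
  (fun x => fst p x + fn (fst V) x, fun x => circle_shift (snd p x) (fn (snd V) x)).

(** The chart [(id + h, alpha0 + u) |-> (h, u)]; the bound on [u] makes the lift unique. *)
Definition G_chart (s : R) (alpha0 : R -> circle4pi) (p : G_ambient) (V : TG s) : Prop :=
  G_point s p /\ (forall x, Rabs (fn (snd V) x) < 2 * PI) /\
  p = G_shift (fun x => x, alpha0) V.

Definition G_manifold (s : R) : manifold :=
  Manifold G_ambient (G_point s) (TG s)
    (fun c => exists alpha0, is_sobolev_circle (s - 1) alpha0 /\ c = G_chart s alpha0).

Definition G_metric {s : R} (p : G_ambient) (U V : TG s) : R :=
  1 / 4 * RInt (fun x =>
    Derive (fn (fst U)) x * Derive (fn (fst V)) x / Derive (fst p) x +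
    fn (snd U) x * fn (snd V) x * Derive (fst p) x) 0 1.

Definition inner_L2 (f g : R -> C) : R :=
  Re (RInt (V := CC) (fun x => Cmult (f x) (Cconj (g x))) 0 1).

Definition U_point (r : R) (f : R -> C) : Prop :=
  is_sobolev r f /\ sqnorm_L2 f = 1 /\ forall x, 0 < Cmod (f x).

(** For a pole [e = 1] or [e = -1], the values lie in the orthogonal complement of [e], which is
    [{h | Re (int h) = 0}]. *)
Definition stereographic (e : C) (f : R -> C) : R -> C :=
  let c := inner_L2 f (fun _ => e) in
  fun x => Cdiv (Cminus (f x) (Cmult (RtoC c) e)) (RtoC (1 - c)).

Definition U_chart (r : R) (e : C) (f : R -> C) (h : Hperp r) : Prop :=
  U_point r f /\ f <> (fun _ => e) /\ fn h = stereographic e f.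

Definition U_manifold (r : R) : manifold :=
  Manifold (R -> C) (U_point r) (Hperp r)
    (fun c => exists e : C, (e = RtoC 1 \/ e = RtoC (-1)) /\ c = U_chart r e).

(** [L] is the differential at [p] of [f], for the norm of [H^r]; [F] is [f] read in
    the coordinates [V |-> p + V] around [p]. *)
Definition is_differential (s r : R) (f : G_ambient -> R -> C) (p : G_ambient)
  (L : TG s -> HC r) : Prop :=
  exists F : TG s -> HC r,
    locally (zero : TG s) (fun V => fn (F V) = f (G_shift p V)) /\
    filterdiff F (locally (zero : TG s)) L.

Definition is_isometry (s r : R) (f : G_ambient -> R -> C) : Prop :=
  forall p, G_point s p ->
    exists L : TG s -> HC r, is_differential s r f p L /\
      (forall V, inner_L2 (fn (L V)) (f p) = 0) /\
      (forall V W, inner_L2 (fn (L V)) (fn (L W)) = G_metric p V W).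

Definition Phi (p : G_ambient) : R -> C :=
  fun x => Cmult (RtoC (sqrt (Derive (fst p) x))) (half_exp (snd p x)).

(* Main.v *)
(** The analysis rests on one device: for [r > 3/2], a function belongs to [H^r] as soon as its
    derivative belongs to [H^(r-1)], which is a Banach algebra.  Applied repeatedly to
    [(F o f)' = (F' o f) f'], starting from the supremum norm, it bounds [F o f], its increments and
    its first-order Taylor remainders in [H^r], for real exponents [r].  Hence [f |-> F o f] is
    infinitely differentiable on [H^r], and [Phi] and its inverse, read in charts, are built from
    such operators ([sqrt], [1/x], [cos], [sin], [atan]), products and continuous linear maps.
    The inverse sends [f] to [(int_0^x |f|^2, 2 arg f)]; a lift of [arg f] is the primitive of
    [Im (f' / f)].  The isometry is the pointwise identity
    [|d Phi (U)|^2 = U_1x^2 / (4 phi_x) + U_2^2 phi_x / 4]. *)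

Require Import Defs.
From Stdlib Require Import Reals Lra Lia ZArith List Psatz FinFun.
From Stdlib Require Import FunctionalExtensionality ClassicalEpsilon.
From Coquelicot Require Import Coquelicot.
Import ListNotations.

Open Scope R_scope.


(** * Finite sums *)

(** As [s] is an arbitrary real number, the norm of [H^r] is seen only through Fourier coefficients,
    whereas charts, superposition and metric are pointwise. The bridge is the uniqueness of the
    coefficients of a continuous function: an absolutely convergent Fourier series then represents
    its function, and this gives the supremum bound, the algebra property and the existence of the
    derivative. Smoothness asks for differentials of every order. No closed formula for them is
    required: superposition by [F j] has as differential the multiplication by the superposition by
    [F (S j)], so all orders reduce to products. The argument is multivalued. A chart of [G^s]
    centred at [alpha0] allows [|u| < 2 PI], hence half-angles in [(- PI, PI)]; after rotation by
    [exp (- i alpha0 / 2)] the values avoid the negative half-line, where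
    [arg w = 2 atan (Im w / (|w| + Re w))] involves only functions that can be superposed. The
    domains of the local expressions are given by strict pointwise inequalities, which are open
    conditions because convergence in [H^r] is uniform. *)

Definition lsum {A : Type} (f : A -> R) (l : list A) : R :=
  fold_right (fun a s => f a + s) 0 l.

Lemma lsum_cons {A} (f : A -> R) a l : lsum f (a :: l) = f a + lsum f l.
Proof. reflexivity. Qed.

Lemma lsum_le {A} (f g : A -> R) l :
  (forall a, In a l -> f a <= g a) -> lsum f l <= lsum g l.
Proof.
induction l as [|a l IH]; simpl; intros h; [lra|].
apply Rplus_le_compat; [apply h; now left | apply IH; intros; apply h; now right].
Qed.

Lemma lsum_ext {A} (f g : A -> R) l :
  (forall a, In a l -> f a = g a) -> lsum f l = lsum g l.
Proof. intros h; apply Rle_antisym; apply lsum_le; intros a ha; rewrite (h a ha); lra. Qed.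

Lemma lsum_zero {A} (l : list A) : lsum (fun _ => 0) l = 0.
Proof. induction l; simpl; lra. Qed.

Lemma lsum_ge0 {A} (f : A -> R) l : (forall a, 0 <= f a) -> 0 <= lsum f l.
Proof. intros h; rewrite <- (lsum_zero l); now apply lsum_le. Qed.

Lemma lsum_plus {A} (f g : A -> R) l : lsum (fun a => f a + g a) l = lsum f l + lsum g l.
Proof. induction l; simpl; lra. Qed.

Lemma lsum_scal {A} (c : R) (f : A -> R) l : lsum (fun a => c * f a) l = c * lsum f l.
Proof. induction l; simpl; lra. Qed.

Lemma lsum_swap {A B} (f : A -> B -> R) l m :
  lsum (fun a => lsum (f a) m) l = lsum (fun b => lsum (fun a => f a b) l) m.
Proof.
induction l as [|a l IH]; simpl; [now rewrite lsum_zero|].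
now rewrite IH, <- lsum_plus.
Qed.

Lemma lsum_app {A} (f : A -> R) l m : lsum f (l ++ m) = lsum f l + lsum f m.
Proof. induction l; simpl; lra. Qed.

Lemma lsum_map {A B} (f : B -> R) (g : A -> B) l :
  lsum f (map g l) = lsum (fun a => f (g a)) l.
Proof. induction l as [|a l IH]; simpl; [|rewrite IH]; reflexivity. Qed.

(** Each element of [l] is taken out of [m] once; what remains of [m], repetitions included, only
    adds nonnegative terms. Sums over arbitrary finite sets of frequencies are compared in this way
    with sums over intervals. *)
Lemma lsum_incl {A} (f : A -> R) l m :
  (forall a, 0 <= f a) -> NoDup l -> incl l m -> lsum f l <= lsum f m.
Proof.
intros h0 nd; revert m; induction nd as [|a l na nd IH]; intros m hi; simpl.
{ now apply lsum_ge0. }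
destruct (in_split a m) as [m1 [m2 e]]; [apply hi; now left|].
subst m; rewrite lsum_app; simpl.
assert (h : lsum f l <= lsum f (m1 ++ m2)).
{ apply IH; intros b hb.
  assert (hb' := hi b (or_intror hb)).
  apply in_app_or in hb'; apply in_or_app; destruct hb' as [|[e|]]; auto.
  subst b; contradiction. }
rewrite lsum_app in h; lra.
Qed.

(** Induction on [l]: the cross term is bounded by combining the inductive [Z^2 <= X Y] with
    [4 X Y (f g)^2 <= (X g^2 + Y f^2)^2]. The weight [w] will be the inverse of a Sobolev weight, or
    the kernel of a convolution. *)
Lemma lsum_cauchy_schwarz {A} (w f g : A -> R) l : (forall a, 0 <= w a) ->
  lsum (fun a => w a * (f a * g a)) l ^ 2 <=
    lsum (fun a => w a * f a ^ 2) l * lsum (fun a => w a * g a ^ 2) l.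
Proof.
intros hw; induction l as [|a l IH]; [simpl; lra|]; rewrite !lsum_cons.
assert (ha := hw a).
assert (p1 : 0 <= lsum (fun a => w a * f a ^ 2) l)
  by (apply lsum_ge0; intros; apply Rmult_le_pos; [apply hw | apply pow2_ge_0]).
assert (p2 : 0 <= lsum (fun a => w a * g a ^ 2) l)
  by (apply lsum_ge0; intros; apply Rmult_le_pos; [apply hw | apply pow2_ge_0]).
set (X := lsum (fun a => w a * f a ^ 2) l) in *.
set (Y := lsum (fun a => w a * g a ^ 2) l) in *.
set (Z := lsum (fun a => w a * (f a * g a)) l) in *.
assert (h : 2 * Z * (f a * g a) <= X * g a ^ 2 + Y * f a ^ 2).
{ apply Rle_trans with (Rabs (2 * Z * (f a * g a))); [apply Rle_abs|].
  rewrite <- (Rabs_pos_eq (X * g a ^ 2 + Y * f a ^ 2))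
    by (generalize (pow2_ge_0 (f a)) (pow2_ge_0 (g a)); nra).
  apply Rsqr_le_abs_0; unfold Rsqr.
  assert (q := Rmult_le_compat_r ((f a * g a) ^ 2) _ _ (pow2_ge_0 _) IH).
  generalize (pow2_ge_0 (X * g a ^ 2 - Y * f a ^ 2)); nra. }
assert (h' := Rmult_le_compat_l _ _ _ ha h).
apply Rminus_le_0.
replace (_ - _) with ((X * Y - Z ^ 2) +
  (w a * (X * g a ^ 2 + Y * f a ^ 2) - w a * (2 * Z * (f a * g a)))) by ring.
lra.
Qed.

(** Sums over the integers are understood through their finite partial sums. Symmetric intervals are
    cofinal among the finite sets of frequencies, and they pair [n] with [- n], as [sobolev_term]
    does. *)
Definition window (N : nat) : list Z :=
  map (fun i => (Z.of_nat i - Z.of_nat N)%Z) (seq 0 (2 * N + 1)).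

Lemma in_window N z : In z (window N) <-> (Z.abs z <= Z.of_nat N)%Z.
Proof.
unfold window; rewrite in_map_iff; split.
- intros [i [e hi]]; apply in_seq in hi; lia.
- intros h; exists (Z.to_nat (z + Z.of_nat N)); split; [|apply in_seq]; lia.
Qed.

Lemma NoDup_window N : NoDup (window N).
Proof.
apply Injective_map_NoDup; [intros i j; lia | apply seq_NoDup].
Qed.

Lemma incl_window (l : list Z) : exists N, incl l (window N).
Proof.
induction l as [|z l [N hN]]; [exists O; intros a []|].
exists (N + Z.to_nat (Z.abs z))%nat; intros a [e|h]; apply in_window; [lia|].
apply hN, in_window in h; lia.
Qed.

Lemma window_incl N M : (N <= M)%nat -> incl (window N) (window M).
Proof. intros h z; rewrite !in_window; lia. Qed.

Lemma window_S N :
  window (S N) = (- Z.of_nat (S N))%Z :: window N ++ [Z.of_nat (S N)].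
Proof.
unfold window; replace (2 * S N + 1)%nat with (S (2 * N + 1 + 1)) by lia.
rewrite <- cons_seq, seq_app, map_cons, map_app; f_equal; f_equal.
- rewrite <- seq_shift, map_map; apply map_ext; intros; lia.
- apply (f_equal (fun z => [z])); lia.
Qed.

Lemma lsum_window_S (f : Z -> R) N :
  lsum f (window (S N)) =
    lsum f (window N) + (f (Z.of_nat (S N)) + f (- Z.of_nat (S N))%Z).
Proof.
rewrite window_S, lsum_cons, lsum_app, lsum_cons; change (lsum f []) with 0; ring.
Qed.

Lemma lsum_window_sum (f : Z -> R) N :
  lsum f (window N) =
    f 0%Z + lsum (fun n => f (Z.of_nat (S n)) + f (- Z.of_nat (S n))%Z) (seq 0 N).
Proof.
induction N as [|N IH]; [simpl; ring|].
rewrite lsum_window_S, IH, seq_S, lsum_app, lsum_cons.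
change (lsum ?g []) with 0; rewrite Nat.add_0_l; ring.
Qed.

Lemma lsum_seq_sum_n (f : nat -> R) N : lsum f (seq 0 (S N)) = sum_n f N.
Proof.
induction N as [|N IH]; [rewrite sum_O; simpl; ring|].
rewrite seq_S, lsum_app, IH, sum_Sn, lsum_cons.
change (lsum ?g []) with 0; rewrite Nat.add_0_l; change plus with Rplus; ring.
Qed.

Definition csum {A : Type} (f : A -> C) (l : list A) : C :=
  fold_right (fun a s => Cplus (f a) s) (RtoC 0) l.

Lemma Cmod_csum {A} (f : A -> C) l : Cmod (csum f l) <= lsum (fun a => Cmod (f a)) l.
Proof.
induction l as [|a l IH]; simpl; [rewrite Cmod_0; lra|].
eapply Rle_trans; [apply Cmod_triangle | lra].
Qed.

Lemma csum_app {A} (f : A -> C) l m : csum f (l ++ m) = Cplus (csum f l) (csum f m).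
Proof.
induction l as [|a l IH]; simpl; [now rewrite Cplus_0_l|].
now rewrite IH, Cplus_assoc.
Qed.

(** * Fourier coefficients *)

Definition expi (n : Z) (x : R) : C := cis (2 * PI * IZR n * x).

Ltac cring := match goal with |- @eq _ ?a ?b => change (@eq C a b) end; unfold Cminus, Cdiv; ring.

Ltac rring := match goal with |- @eq _ ?a ?b => change (@eq R a b) end; ring.

Ltac rfield := match goal with |- @eq _ ?a ?b => change (@eq R a b) end; field.

Lemma cis_plus a b : cis (a + b) = Cmult (cis a) (cis b).
Proof. unfold cis, Cmult; simpl; rewrite cos_plus, sin_plus; f_equal; ring. Qed.

Lemma Cmod_cis t : Cmod (cis t) = 1.
Proof.
unfold Cmod, cis; simpl; transitivity (sqrt 1); [f_equal | apply sqrt_1].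
generalize (sin2_cos2 t); unfold Rsqr; lra.
Qed.

Lemma cis_0 : cis 0 = RtoC 1.
Proof. unfold cis; now rewrite cos_0, sin_0. Qed.

Lemma cis_2PI (n : Z) : cis (2 * PI * IZR n) = RtoC 1.
Proof.
rewrite <- cis_0; unfold cis; f_equal.
- destruct (Z_le_gt_dec 0 n) as [h|h].
  + rewrite <- (cos_period 0 (Z.to_nat n)); f_equal.
    rewrite INR_IZR_INZ, Z2Nat.id by lia; ring.
  + rewrite <- (cos_period _ (Z.to_nat (- n))); f_equal.
    rewrite INR_IZR_INZ, Z2Nat.id, opp_IZR by lia; ring.
- destruct (Z_le_gt_dec 0 n) as [h|h].
  + rewrite <- (sin_period 0 (Z.to_nat n)); f_equal.
    rewrite INR_IZR_INZ, Z2Nat.id by lia; ring.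
  + rewrite <- (sin_period _ (Z.to_nat (- n))); f_equal.
    rewrite INR_IZR_INZ, Z2Nat.id, opp_IZR by lia; ring.
Qed.

Lemma expi_plus m n x : expi (m + n) x = Cmult (expi m x) (expi n x).
Proof. unfold expi; rewrite <- cis_plus, plus_IZR; f_equal; ring. Qed.

Lemma expi_periodic n x : expi n (x + 1) = expi n x.
Proof.
unfold expi; rewrite Rmult_plus_distr_l, Rmult_1_r, cis_plus, cis_2PI; apply Cmult_1_r.
Qed.

Lemma Cmod_expi n x : Cmod (expi n x) = 1.
Proof. apply Cmod_cis. Qed.

Lemma fourierE f n :
  fourier f n = RInt (V := CC) (fun x => Cmult (f x) (expi (- n) x)) 0 1.
Proof.
apply (RInt_ext (V := CC)); intros x _; unfold expi; rewrite opp_IZR.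
do 2 f_equal; ring.
Qed.

Lemma continuous_expi n x : continuous (expi n : R -> CC) x.
Proof.
apply continuous_ext with (fun t => cis (- (- (2 * PI * IZR n) * t))).
- intros t; unfold expi; f_equal; ring.
- apply continuous_cis.
Qed.

Lemma continuous_Rplus (f g : R -> R) x :
  continuous f x -> continuous g x -> continuous (fun t => f t + g t) x.
Proof. apply (continuous_plus (V := R_NormedModule)). Qed.

Lemma continuous_Rminus (f g : R -> R) x :
  continuous f x -> continuous g x -> continuous (fun t => f t - g t) x.
Proof. apply (continuous_minus (V := R_NormedModule)). Qed.

Lemma continuous_Rmult (f g : R -> R) x :
  continuous f x -> continuous g x -> continuous (fun t => f t * g t) x.
Proof. apply (continuous_mult (K := R_AbsRing)). Qed.

Lemma continuous_Cplus (f g : R -> C) x :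
  continuous (f : R -> CC) x -> continuous (g : R -> CC) x ->
  continuous ((fun t => Cplus (f t) (g t)) : R -> CC) x.
Proof. apply (continuous_plus (V := CC)). Qed.

Lemma continuous_Cminus (f g : R -> C) x :
  continuous (f : R -> CC) x -> continuous (g : R -> CC) x ->
  continuous ((fun t => Cminus (f t) (g t)) : R -> CC) x.
Proof. apply (continuous_minus (V := CC)). Qed.

Lemma continuous_Cconst (c : C) x : continuous ((fun _ => c) : R -> CC) x.
Proof. apply continuous_const. Qed.

Lemma continuous_toC (u : R -> R) x :
  continuous u x -> continuous (toC u : R -> CC) x.
Proof. intros h; apply continuous_C_pair; [exact h | apply continuous_const]. Qed.

Lemma continuous_toC_inv (u : R -> R) x :
  continuous (toC u : R -> CC) x -> continuous u x.
Proof. exact (continuous_Re (toC u) x). Qed.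

Ltac cont_step :=
  match goal with
  | |- continuous (fun _ => Cmult _ _) _ => apply continuous_Cmult
  | |- continuous (fun _ => Cplus _ _) _ => apply continuous_Cplus
  | |- continuous (fun _ => Cminus _ _) _ => apply continuous_Cminus
  | |- continuous (fun _ => Rplus _ _) _ => apply continuous_Rplus
  | |- continuous (fun _ => Rminus _ _) _ => apply continuous_Rminus
  | |- continuous (fun _ => Rmult _ _) _ => apply continuous_Rmult
  | |- continuous (fun _ => Cmod _ ^ 2) _ => apply continuous_Cmod2
  | |- continuous (fun _ => Re _) _ => apply continuous_Re
  | |- continuous (fun _ => Im _) _ => apply continuous_Im
  | |- continuous (expi _) _ => apply continuous_expi
  | |- continuous (fun _ => expi _ _) _ => apply continuous_expi
  | |- continuous (toC _) _ => apply continuous_toC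
  | |- continuous (fun _ => ?c) _ => apply continuous_const
  | |- continuous (fun x => x) _ => apply continuous_id
  end.

Ltac cont := repeat (cont_step; try assumption); auto.

Lemma RInt_C (f : R -> C) a b : (forall x, continuous (f : R -> CC) x) ->
  RInt (V := CC) f a b = (RInt (fun x => Re (f x)) a b, RInt (fun x => Im (f x)) a b).
Proof.
intros h; apply (is_RInt_unique (V := CC)).
apply (is_RInt_fct_extend_pair (U := R_NormedModule) (V := R_NormedModule)).
- apply (RInt_correct (fun x => Re (f x))), continuous_ex_RInt; intros; cont.
- apply (RInt_correct (fun x => Im (f x))), continuous_ex_RInt; intros; cont.
Qed.

Lemma RInt_Cmult_l (c : C) (f : R -> C) a b : (forall x, continuous (f : R -> CC) x) ->
  RInt (V := CC) (fun x => Cmult c (f x)) a b = Cmult c (RInt (V := CC) f a b).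
Proof.
intros h; rewrite (RInt_C f), (RInt_C (fun x => Cmult c (f x))) by (intros; cont).
assert (eR : ex_RInt (fun x => Re (f x)) a b) by (apply continuous_ex_RInt; intros; cont).
assert (eI : ex_RInt (fun x => Im (f x)) a b) by (apply continuous_ex_RInt; intros; cont).
unfold Cmult; simpl; f_equal.
- rewrite <- !(RInt_scal (V := R_CompleteNormedModule)) by assumption.
  rewrite <- (RInt_minus (V := R_CompleteNormedModule)); [reflexivity| |];
    now apply (ex_RInt_scal (V := R_NormedModule)).
- rewrite <- !(RInt_scal (V := R_CompleteNormedModule)) by assumption.
  rewrite <- (RInt_plus (V := R_CompleteNormedModule)); [reflexivity| |];
    now apply (ex_RInt_scal (V := R_NormedModule)).
Qed.

Lemma RInt_Cminus (f g : R -> C) a b :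
  (forall x, continuous (f : R -> CC) x) -> (forall x, continuous (g : R -> CC) x) ->
  RInt (V := CC) (fun x => Cminus (f x) (g x)) a b =
    Cminus (RInt (V := CC) f a b) (RInt (V := CC) g a b).
Proof.
intros hf hg; apply (RInt_minus (V := CC)); now apply continuous_ex_RInt.
Qed.

Lemma Cmod_RInt_le (f : R -> C) M : (forall x, continuous (f : R -> CC) x) ->
  (forall x, 0 <= x <= 1 -> Cmod (f x) <= M) -> Cmod (RInt (V := CC) f 0 1) <= M.
Proof.
intros h hM.
replace M with (RInt (fun _ => M) 0 1)
  by (rewrite RInt_const; change (scal ?a ?b) with (a * b); rring).
rewrite Cmod_norm.
apply (norm_RInt_le (V := C_R_NormedModule) f (fun _ => M) 0 1); [lra| | |].
- intros x hx; rewrite <- Cmod_norm; auto.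
- apply (RInt_correct (V := CC)), continuous_ex_RInt, h.
- apply (RInt_correct (V := R_CompleteNormedModule)), ex_RInt_const.
Qed.

Lemma Cmod_fourier_le (f : R -> C) M n : (forall x, continuous (f : R -> CC) x) ->
  (forall x, 0 <= x <= 1 -> Cmod (f x) <= M) -> Cmod (fourier f n) <= M.
Proof.
intros h hM; rewrite fourierE; apply Cmod_RInt_le; [intros; cont|].
intros x hx; rewrite Cmod_mult, Cmod_expi, Rmult_1_r; auto.
Qed.

Lemma fourier_minus (f g : R -> C) n :
  (forall x, continuous (f : R -> CC) x) -> (forall x, continuous (g : R -> CC) x) ->
  fourier (fun x => Cminus (f x) (g x)) n = Cminus (fourier f n) (fourier g n).
Proof.
intros hf hg; rewrite !fourierE, <- RInt_Cminus by (intros; cont).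
apply (RInt_ext (V := CC)); intros x _; unfold Cminus.
cring.
Qed.

Lemma fourier_Cmult (c : C) (f : R -> C) n :
  (forall x, continuous (f : R -> CC) x) ->
  fourier (fun x => Cmult c (f x)) n = Cmult c (fourier f n).
Proof.
intros hf; rewrite !fourierE, <- RInt_Cmult_l by (intros; cont).
apply (RInt_ext (V := CC)); intros x _; symmetry; apply Cmult_assoc.
Qed.

Lemma fourier_expi_mult (f : R -> C) k n :
  fourier (fun x => Cmult (expi k x) (f x)) n = fourier f (n - k).
Proof.
rewrite !fourierE; apply (RInt_ext (V := CC)); intros x _.
replace (- (n - k))%Z with (k + - n)%Z by ring; rewrite expi_plus.
cring.
Qed.

Lemma minus_self (a : R) : minus a a = 0.
Proof. exact (Rplus_opp_r a). Qed.

Lemma RInt_cos_sin (n : Z) : n <> 0%Z ->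
  RInt (fun x => cos (2 * PI * IZR n * x)) 0 1 = 0 /\
  RInt (fun x => sin (2 * PI * IZR n * x)) 0 1 = 0.
Proof.
intros hn; set (c := 2 * PI * IZR n).
assert (hc : c <> 0).
{ generalize PI_RGT_0 (not_0_IZR n hn); intros hpi hz.
  unfold c; apply Rmult_integral_contrapositive_currified; [|exact hz].
  apply Rgt_not_eq; lra. }
assert (e := cis_2PI n); fold c in e; injection e; intros e2 e1.
split; apply is_RInt_unique.
- replace 0 with (minus (sin (c * 1) / c) (sin (c * 0) / c)) at 2
    by (rewrite Rmult_1_r, Rmult_0_r, sin_0, e2; apply minus_self).
  apply (is_RInt_derive (V := R_CompleteNormedModule) (fun x => sin (c * x) / c)
    (fun x => cos (c * x))); intros x _.
  + auto_derive; trivial; field; trivial.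
  + apply (ex_derive_continuous (fun x => cos (c * x))); auto_derive; trivial.
- replace 0 with (minus (- cos (c * 1) / c) (- cos (c * 0) / c)) at 2
    by (rewrite Rmult_1_r, Rmult_0_r, cos_0, e1; apply minus_self).
  apply (is_RInt_derive (V := R_CompleteNormedModule) (fun x => - cos (c * x) / c)
    (fun x => sin (c * x))); intros x _.
  + auto_derive; trivial; field; trivial.
  + apply (ex_derive_continuous (fun x => sin (c * x))); auto_derive; trivial.
Qed.

Lemma RInt_expi n : n <> 0%Z -> RInt (V := CC) (expi n) 0 1 = RtoC 0.
Proof.
intros hn; rewrite RInt_C by (intros; cont).
destruct (RInt_cos_sin n hn) as [h1 h2].
unfold expi, cis; simpl; rewrite h1, h2; reflexivity.
Qed.

Lemma expi_0 x : expi 0 x = RtoC 1.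
Proof. unfold expi; rewrite Rmult_0_r, Rmult_0_l; apply cis_0. Qed.

Lemma fourier_const (c : C) n :
  fourier (fun _ => c) n = if Z.eq_dec n 0 then c else RtoC 0.
Proof.
rewrite fourierE, RInt_Cmult_l by (intros; cont).
destruct (Z.eq_dec n 0) as [->|hn].
- rewrite (RInt_ext (V := CC) _ (fun _ => RtoC 1)) by (intros; apply expi_0).
  rewrite RInt_const; change (Cmult c (scal (1 - 0) (RtoC 1)) = c).
  rewrite (scal_R_Cmult (1 - 0)), Rminus_0_r; cring.
- rewrite RInt_expi by lia; apply Cmult_0_r.
Qed.

Lemma fourier_expi k n : fourier (expi k) n = if Z.eq_dec n k then RtoC 1 else RtoC 0.
Proof.
transitivity (fourier (fun x => Cmult (expi k x) (RtoC 1)) n).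
{ f_equal; extensionality x; symmetry; apply Cmult_1_r. }
rewrite (fourier_expi_mult (fun _ => RtoC 1)), fourier_const.
destruct (Z.eq_dec (n - k) 0), (Z.eq_dec n k); trivial; lia.
Qed.

(** Pythagoras: [f] minus its projection on [expi n] is orthogonal to [expi n]. *)
Lemma sqnorm_L2_remove (f : R -> C) n : (forall x, continuous (f : R -> CC) x) ->
  sqnorm_L2 (fun x => Cminus (f x) (Cmult (fourier f n) (expi n x))) =
    sqnorm_L2 f - Cmod (fourier f n) ^ 2.
Proof.
intros hf; set (c := fourier f n).
assert (e : forall x, Cmod (Cminus (f x) (Cmult c (expi n x))) ^ 2 =
  Cmod (f x) ^ 2 - 2 * Re (Cmult (Cconj c) (Cmult (f x) (expi (- n) x))) + Cmod c ^ 2).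
{ intros x; unfold expi; rewrite opp_IZR.
  replace (2 * PI * - IZR n * x) with (- (2 * PI * IZR n * x)) by ring.
  set (t := 2 * PI * IZR n * x); unfold cis; rewrite cos_neg, sin_neg.
  generalize (sin2_cos2 t); unfold Rsqr; intros h.
  destruct (f x) as [a b], c as [p q]; rewrite !Cmod2_alt; simpl.
  apply Rminus_diag_uniq.
  transitivity ((p ^ 2 + q ^ 2) * (sin t * sin t + cos t * cos t - 1)); [ring | rewrite h; ring]. }
unfold sqnorm_L2.
rewrite (RInt_ext _ _ 0 1 (fun x _ => e x)).
set (p := fun x => Re (Cmult (Cconj c) (Cmult (f x) (expi (- n) x)))).
(* The integral of [f * expi (- n)] is [c] itself, so that [p] integrates to the real part of
   [Cconj c * c]. *)
assert (hp : RInt p 0 1 = Cmod c ^ 2).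
{ assert (h := RInt_Cmult_l (Cconj c) (fun x => Cmult (f x) (expi (- n) x)) 0 1).
  rewrite <- fourierE in h; fold c in h.
  rewrite RInt_C in h by (intros; cont).
  apply (f_equal Re) in h; [|intros; cont]; simpl in h; unfold p; simpl.
  rewrite h; generalize (Cmod2_alt c); simpl; intros e'; rewrite e'.
  unfold Re, Im; ring. }
assert (cp : forall x, continuous p x) by (intros; unfold p; cont).
assert (cf : forall x, continuous (fun x => Cmod (f x) ^ 2) x) by (intros; cont).
transitivity (RInt (fun x => plus (minus (Cmod (f x) ^ 2) (scal 2 (p x))) (Cmod c ^ 2)) 0 1).
{ reflexivity. }
assert (ep : ex_RInt p 0 1) by now apply continuous_ex_RInt.
assert (ef : ex_RInt (fun x => Cmod (f x) ^ 2) 0 1) by now apply continuous_ex_RInt.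
assert (es := ex_RInt_scal (V := R_NormedModule) p 0 1 2 ep).
assert (ed := ex_RInt_minus (V := R_NormedModule) _ _ 0 1 ef es).
rewrite (RInt_plus (V := R_CompleteNormedModule)), (RInt_minus (V := R_CompleteNormedModule)),
  (RInt_scal (V := R_CompleteNormedModule)), RInt_const, hp;
  try assumption; [|apply ex_RInt_const].
change (sqnorm_L2 f - 2 * Cmod c ^ 2 + (1 - 0) * Cmod c ^ 2 = sqnorm_L2 f - Cmod c ^ 2); ring.
Qed.

(** Frequencies are removed one at a time: subtracting the component at [n] lowers the square norm
    by [|f^(n)|^2] and leaves the coefficients at the other frequencies unchanged. *)
Lemma bessel (f : R -> C) l : (forall x, continuous (f : R -> CC) x) -> NoDup l ->
  lsum (fun n => Cmod (fourier f n) ^ 2) l <= sqnorm_L2 f.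
Proof.
intros hf nd; revert f hf; induction nd as [|n l hn nd IH]; intros f hf.
{ now apply sqnorm_L2_ge0. }
rewrite lsum_cons.
set (g := fun x => Cminus (f x) (Cmult (fourier f n) (expi n x))).
assert (cg : forall x, continuous (g : R -> CC) x) by (intros; unfold g; cont).
assert (h := IH g cg); unfold g in h at 2; rewrite sqnorm_L2_remove in h by trivial.
rewrite (lsum_ext _ (fun n => Cmod (fourier g n) ^ 2) l); [lra|].
intros m hm; do 2 f_equal; unfold g.
rewrite fourier_minus, fourier_Cmult, fourier_expi by (intros; cont).
destruct (Z.eq_dec m n); [subst; contradiction|].
cring.
Qed.

Lemma fourier_toC (u : R -> R) n : (forall x, continuous u x) ->
  fourier (toC u) n =
    (RInt (fun x => u x * cos (2 * PI * IZR n * x)) 0 1,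
     - RInt (fun x => u x * sin (2 * PI * IZR n * x)) 0 1).
Proof.
intros hu; rewrite fourierE, RInt_C by (intros; cont).
f_equal.
- apply RInt_ext; intros x _; unfold expi, cis, toC; simpl; rewrite opp_IZR.
  replace (2 * PI * - IZR n * x) with (- (2 * PI * IZR n * x)) by ring.
  rewrite cos_neg; rring.
- rewrite <- (RInt_opp (V := R_CompleteNormedModule)).
  + apply RInt_ext; intros x _; unfold expi, cis, toC; simpl; rewrite opp_IZR.
    replace (2 * PI * - IZR n * x) with (- (2 * PI * IZR n * x)) by ring.
    rewrite sin_neg; change opp with Ropp; rring.
  + apply continuous_ex_RInt; intros x; cont.
    apply (ex_derive_continuous (fun x => sin (2 * PI * IZR n * x))); auto_derive; trivial.
Qed.

Lemma is_derive_continuous (u : R -> R) x d : is_derive u x d -> continuous u x.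
Proof. intros h; apply (ex_derive_continuous (V := R_NormedModule)); now exists d. Qed.

Lemma is_derive_eq (f : R -> R) x d d' : is_derive f x d -> d = d' -> is_derive f x d'.
Proof. now intros h <-. Qed.

Lemma is_derive_Rmult (f g : R -> R) x f' g' : is_derive f x f' -> is_derive g x g' ->
  is_derive (fun x => f x * g x) x (f' * g x + f x * g').
Proof. intros hf hg; apply (is_derive_mult f g x f' g' hf hg); apply Rmult_comm. Qed.

Lemma is_derive_Rplus (f g : R -> R) x f' g' : is_derive f x f' -> is_derive g x g' ->
  is_derive (fun x => f x + g x) x (f' + g').
Proof. apply (is_derive_plus (V := R_NormedModule)). Qed.

Lemma is_derive_Rminus (f g : R -> R) x f' g' : is_derive f x f' -> is_derive g x g' ->
  is_derive (fun x => f x - g x) x (f' - g').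
Proof. apply (is_derive_minus (V := R_NormedModule)). Qed.

Lemma is_derive_Rcomp (f g : R -> R) x f' g' : is_derive f (g x) f' -> is_derive g x g' ->
  is_derive (fun x => f (g x)) x (f' * g').
Proof.
intros hf hg; apply (is_derive_eq _ _ (scal g' f')); [|apply Rmult_comm].
now apply (is_derive_comp (V := R_NormedModule)).
Qed.

Lemma is_derive_translate (f : R -> R) x a d : is_derive f (x + a) d ->
  is_derive (fun x => f (x + a)) x d.
Proof.
intros h; apply (is_derive_eq _ _ (d * 1)); [|rring].
apply (is_derive_Rcomp f (fun x => x + a)); [exact h|].
auto_derive; trivial.
Qed.

(** Integration by parts: the derivatives of [u cos] and [u sin] are integrated over a period, and
    their boundary terms cancel because [u] is periodic. *)
Lemma fourier_derive (u u' : R -> R) n :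
  (forall x, is_derive u x (u' x)) -> (forall x, continuous u' x) ->
  (forall x, u (x + 1) = u x) ->
  fourier (toC u') n = Cmult (0, 2 * PI * IZR n) (fourier (toC u) n).
Proof.
intros hd hc hp.
assert (cu : forall x, continuous u x) by (intros x; exact (is_derive_continuous _ _ _ (hd x))).
rewrite !fourier_toC by trivial; set (c := 2 * PI * IZR n).
assert (ccos : forall x, continuous (fun x => cos (c * x)) x)
  by (intros x; apply (ex_derive_continuous (fun x => cos (c * x))); auto_derive; trivial).
assert (csin : forall x, continuous (fun x => sin (c * x)) x)
  by (intros x; apply (ex_derive_continuous (fun x => sin (c * x))); auto_derive; trivial).
assert (e := cis_2PI n); fold c in e; injection e; intros e2 e1.
assert (u1 : u 1 = u 0) by (rewrite <- (hp 0); f_equal; ring).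
assert (hcos : RInt (fun x => u' x * cos (c * x) - c * (u x * sin (c * x))) 0 1 = 0).
{ apply is_RInt_unique.
  replace 0 with (minus (u 1 * cos (c * 1)) (u 0 * cos (c * 0))) at 2
    by (rewrite Rmult_1_r, Rmult_0_r, cos_0, e1, u1; apply minus_self).
  apply (is_RInt_derive (V := R_CompleteNormedModule) (fun x => u x * cos (c * x))
    (fun x => u' x * cos (c * x) - c * (u x * sin (c * x)))); intros x _; [|cont].
  apply (is_derive_eq _ _ (u' x * cos (c * x) + u x * (- sin (c * x) * c))); [|rring].
  apply (is_derive_Rmult u (fun x => cos (c * x))); [apply hd | auto_derive; [trivial|rring]]. }
assert (hsin : RInt (fun x => u' x * sin (c * x) + c * (u x * cos (c * x))) 0 1 = 0).
{ apply is_RInt_unique.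
  replace 0 with (minus (u 1 * sin (c * 1)) (u 0 * sin (c * 0))) at 2
    by (rewrite Rmult_1_r, Rmult_0_r, sin_0, e2, u1; apply minus_self).
  apply (is_RInt_derive (V := R_CompleteNormedModule) (fun x => u x * sin (c * x))
    (fun x => u' x * sin (c * x) + c * (u x * cos (c * x)))); intros x _; [|cont].
  apply (is_derive_eq _ _ (u' x * sin (c * x) + u x * (cos (c * x) * c))); [|rring].
  apply (is_derive_Rmult u (fun x => sin (c * x))); [apply hd | auto_derive; [trivial|rring]]. }
assert (i1 : RInt (fun x => u' x * cos (c * x) - c * (u x * sin (c * x))) 0 1 =
  RInt (fun x => u' x * cos (c * x)) 0 1 - c * RInt (fun x => u x * sin (c * x)) 0 1).
{ rewrite <- (RInt_scal (V := R_CompleteNormedModule)) by (apply continuous_ex_RInt; intros; cont).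
  apply (RInt_minus (V := R_CompleteNormedModule)); apply continuous_ex_RInt; intros; cont.
  apply (continuous_Rmult (fun _ => c)); cont. }
assert (i2 : RInt (fun x => u' x * sin (c * x) + c * (u x * cos (c * x))) 0 1 =
  RInt (fun x => u' x * sin (c * x)) 0 1 + c * RInt (fun x => u x * cos (c * x)) 0 1).
{ rewrite <- (RInt_scal (V := R_CompleteNormedModule)) by (apply continuous_ex_RInt; intros; cont).
  apply (RInt_plus (V := R_CompleteNormedModule)); apply continuous_ex_RInt; intros; cont.
  apply (continuous_Rmult (fun _ => c)); cont. }
unfold Cmult; simpl; f_equal; lra.
Qed.

(** * Uniqueness of the Fourier coefficients of a continuous periodic function *)

Lemma RInt_periodic {V : CompleteNormedModule R_AbsRing} (f : R -> V) a :
  (forall x, continuous f x) -> (forall x, f (x + 1) = f x) ->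
  RInt (fun x => f (x + a)) 0 1 = RInt f 0 1.
Proof.
intros hc hp.
assert (ex : forall a b, ex_RInt f a b) by (intros; now apply continuous_ex_RInt).
assert (tr : forall a b c, RInt (fun x => f (x + c)) a b = RInt f (a + c) (b + c)).
{ intros p q c; assert (h := RInt_comp_lin f 1 c p q); rewrite !Rmult_1_l in h.
  rewrite <- h by auto; apply RInt_ext; intros x _; rewrite Rmult_1_l.
  symmetry; apply (scal_one (f (x + c))). }
rewrite tr, Rplus_0_l.
rewrite <- (RInt_Chasles f a 0 (1 + a)), <- (RInt_Chasles f 0 1 (1 + a)) by auto.
replace (RInt f 1 (1 + a)) with (RInt f 0 a).
- rewrite <- (opp_RInt_swap f 0 a) by auto.
  rewrite (plus_comm (RInt f 0 1)), plus_assoc.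
  transitivity (plus zero (RInt f 0 1)); [f_equal; exact (plus_opp_l (RInt f 0 a)) | exact (plus_zero_l (RInt f 0 1))].
- replace 1 with (0 + 1) at 1 by ring; rewrite (Rplus_comm 1 a), <- tr.
  apply RInt_ext; intros; now rewrite hp.
Qed.

Lemma fourier_translate (f : R -> C) a n :
  (forall x, continuous (f : R -> CC) x) -> (forall x, f (x + 1) = f x) ->
  fourier (fun x => f (x + a)) n = Cmult (expi n a) (fourier f n).
Proof.
intros hc hp; rewrite !fourierE.
rewrite <- (RInt_periodic (V := CC) (fun x => Cmult (f x) (expi (- n) x)) a).
- rewrite <- RInt_Cmult_l.
  + apply (RInt_ext (V := CC)); intros x _.
    replace (expi (- n) x) with (Cmult (expi n a) (expi (- n) (x + a))); [cring|].
    unfold expi; rewrite <- cis_plus, opp_IZR; f_equal; ring.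
  + intros x; apply (continuous_comp (W := CC) (fun x => x + a)
      (fun y => Cmult (f y) (expi (- n) y))); cont.
- intros; cont.
- intros x; now rewrite hp, expi_periodic.
Qed.

(* The constant value lies below every [sqrt (||g||^2 / N)], by Bessel's inequality. *)
Lemma fourier_constant_eq0 (g : R -> C) (a : nat -> Z) (c : C) :
  (forall x, continuous (g : R -> CC) x) -> Injective a ->
  (forall m, fourier g (a m) = c) -> c = RtoC 0.
Proof.
intros hg ha hc.
destruct (Req_dec (Cmod c) 0) as [e|ne]; [now apply Cmod_eq_0|exfalso].
assert (hp : 0 < Cmod c ^ 2) by (apply pow_lt; generalize (Cmod_ge_0 c); lra).
assert (h : forall N, INR N * Cmod c ^ 2 <= sqnorm_L2 g).
{ intros N; eapply Rle_trans;
    [|apply (bessel g (map a (seq 0 N))); [trivial | apply Injective_map_NoDup;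
       [trivial | apply seq_NoDup]]].
  rewrite lsum_map; right; rewrite <- (length_seq N 0) at 1.
  generalize (seq 0 N) as l; induction l as [|m l IH].
  - simpl; ring.
  - rewrite lsum_cons, <- IH, hc; change (length (m :: l)) with (S (length l)).
    rewrite S_INR; ring. }
destruct (INR_unbounded (sqnorm_L2 g / Cmod c ^ 2)) as [N hN].
apply (Rmult_lt_compat_r _ _ _ hp) in hN.
unfold Rdiv in hN; rewrite Rmult_assoc, Rinv_l, Rmult_1_r in hN by lra.
specialize (h N); lra.
Qed.

Lemma slope_continuous (u : R -> R) x0 d : is_derive u x0 d -> u x0 = 0 ->
  forall eps : posreal, locally x0 (fun x => x <> x0 -> Rabs (u x / (x - x0) - d) < eps).
Proof.
intros h h0 eps.
assert (he : 0 < eps / 2) by (generalize (cond_pos eps); lra).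
destruct h as [_ h]; specialize (h x0 (fun P hP => hP) (mkposreal _ he)); revert h.
apply filter_imp; intros x hx hne; simpl in hx.
change (Rabs (u x - u x0 - (x - x0) * d) <= eps / 2 * Rabs (x - x0)) in hx.
rewrite h0, Rminus_0_r in hx.
assert (hd : 0 < Rabs (x - x0)) by (apply Rabs_pos_lt; lra).
replace (u x / (x - x0) - d) with ((u x - (x - x0) * d) / (x - x0)) by (field; lra).
unfold Rdiv; rewrite Rabs_mult, Rabs_inv.
apply Rle_lt_trans with (eps / 2 * Rabs (x - x0) * / Rabs (x - x0)).
- apply Rmult_le_compat_r; [left; now apply Rinv_0_lt_compat | exact hx].
- rewrite Rmult_assoc, Rinv_r by lra; generalize (cond_pos eps); lra.
Qed.

(** Removable singularities: at a zero of [v] the quotient gets the value [u' / v']. Near such a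
    point it is a ratio of two difference quotients, so differentiability at the point yields its
    continuity there. *)
Lemma continuous_quotient (u v u' v' : R -> R) :
  (forall x, is_derive u x (u' x)) -> (forall x, is_derive v x (v' x)) ->
  (forall x, v x = 0 -> u x = 0 /\ v' x <> 0) ->
  exists q : R -> R, (forall x, continuous q x) /\ forall x, v x * q x = u x.
Proof.
intros hu hv h0.
set (q := fun x => if Req_EM_T (v x) 0 then u' x / v' x else u x / v x).
exists q; split; [intros x0|].
- assert (cu := is_derive_continuous _ _ _ (hu x0)).
  assert (cv := is_derive_continuous _ _ _ (hv x0)).
  destruct (Req_dec (v x0) 0) as [e|ne].
  + destruct (h0 x0 e) as [e' hd].
    assert (cq : continuous (fun p : R * R => fst p * / snd p) (u' x0, v' x0)).
    { apply (continuous_mult (K := R_AbsRing) (fun p : R * R => fst p) (fun p => / snd p)).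
      - apply continuous_fst.
      - apply (continuous_comp (fun p : R * R => snd p) Rinv); [apply continuous_snd|].
        now apply continuous_Rinv. }
    unfold continuous; apply filterlim_locally; intros eps.
    destruct (proj1 (filterlim_locally _ _) cq eps) as [d hPQ].
    assert (h1 := slope_continuous u x0 (u' x0) (hu x0) e' d).
    assert (h2 := slope_continuous v x0 (v' x0) (hv x0) e d).
    assert (hz : 0 < Rabs (v' x0)) by now apply Rabs_pos_lt.
    (* Keeps the slope of [v] away from [0], so that [v x <> 0] for [x] close to [x0] and different
       from it. *)
    assert (h3 := slope_continuous v x0 (v' x0) (hv x0) e (mkposreal _ hz)).
    generalize (filter_and _ _ h1 (filter_and _ _ h2 h3)); apply filter_imp.
    intros x [k1 [k2 k3]].
    destruct (Req_dec x x0) as [->|nx]; [apply ball_center|].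
    specialize (k1 nx); specialize (k2 nx); specialize (k3 nx); simpl in k3.
    assert (qx0 : q x0 = u' x0 / v' x0) by (unfold q; destruct (Req_EM_T (v x0) 0); tauto).
    assert (nv : v x <> 0).
    { intros ev; rewrite ev in k3; unfold Rdiv in k3.
      rewrite Rmult_0_l, Rminus_0_l, Rabs_Ropp in k3; lra. }
    rewrite qx0.
    replace (q x) with ((u x / (x - x0)) / (v x / (x - x0))).
    * apply (hPQ (u x / (x - x0), v x / (x - x0))); split; assumption.
    * unfold q; destruct (Req_EM_T (v x) 0); [tauto|].
      field; lra.
  + assert (c1 : continuous (fun x => u x * / v x) x0).
    { apply continuous_Rmult; [exact cu|].
      apply (continuous_comp v Rinv); [exact cv | now apply continuous_Rinv]. }
    eapply continuous_ext_loc; [|exact c1].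
    assert (hz : 0 < Rabs (v x0)) by now apply Rabs_pos_lt.
    generalize (proj1 (filterlim_locally _ _) cv (mkposreal _ hz)); apply filter_imp.
    intros x hx; unfold q; destruct (Req_EM_T (v x) 0) as [ev|]; [|reflexivity].
    change (Rabs (v x - v x0) < Rabs (v x0)) in hx.
    rewrite ev, Rminus_0_l, Rabs_Ropp in hx; lra.
- intros x; unfold q; destruct (Req_EM_T (v x) 0) as [e|ne].
  + destruct (h0 x e) as [-> _]; rewrite e; ring.
  + field; exact ne.
Qed.

Lemma periodic_IZR {T} (f : R -> T) : (forall x, f (x + 1) = f x) ->
  forall (k : Z) x, f (x + IZR k) = f x.
Proof.
intros pf.
assert (pn : forall (n : nat) x, f (x + INR n) = f x).
{ induction n as [|n IH]; intros x; [now rewrite Rplus_0_r|].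
  rewrite S_INR, <- Rplus_assoc, pf; apply IH. }
intros k x; destruct (Z_le_gt_dec 0 k).
- rewrite <- (Z2Nat.id k), <- INR_IZR_INZ by lia; apply pn.
- rewrite <- (pn (Z.to_nat (- k)) (x + IZR k)), INR_IZR_INZ, Z2Nat.id, opp_IZR by lia.
  f_equal; ring.
Qed.

(* Chernoff's argument: [U = (e_1 - 1) g] with [g] continuous, so the coefficients of [U] are
   differences of consecutive coefficients of [g]. *)
Lemma mean_eq_at_zero (u u' : R -> R) :
  (forall x, is_derive u x (u' x)) -> (forall x, u (x + 1) = u x) -> u 0 = 0 ->
  (forall n, n <> 0%Z -> fourier (toC u) n = RtoC 0) -> fourier (toC u) 0 = RtoC 0.
Proof.
intros hd hp u0 hf.
assert (cu : forall x, continuous u x) by (intros x; exact (is_derive_continuous _ _ _ (hd x))).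
destruct (continuous_quotient u (fun x => sin (PI * x)) u' (fun x => PI * cos (PI * x)))
  as [h [ch eh]]; trivial.
{ intros x; auto_derive; [trivial|rring]. }
{ intros x hx; destruct (sin_eq_0_0 _ hx) as [k hk].
  assert (ex : x = 0 + IZR k).
  { apply (Rmult_eq_reg_l PI); [rewrite hk; ring | apply PI_neq0]. }
  split; [now rewrite ex, periodic_IZR|].
  generalize (sin2_cos2 (PI * x)); rewrite hx; unfold Rsqr; intros hs hc.
  apply Rmult_integral in hc; destruct hc as [hc|hc]; [now apply PI_neq0|].
  rewrite hc in hs; lra. }
(* As [e_1 - 1 = 2 i sin (PI x) exp (i PI x)], dividing [u = sin (PI x) h] by it leaves
   [h exp (- i PI x) / (2 i)], whose real and imaginary parts are these. *)
set (g := fun x => (- u x / 2, - (cos (PI * x) * h x) / 2)).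
assert (ccos : forall x, continuous (fun x => cos (PI * x)) x)
  by (intros x; apply (ex_derive_continuous (fun x => cos (PI * x))); auto_derive; trivial).
assert (cg : forall x, continuous (g : R -> CC) x).
{ intros x; apply continuous_C_pair.
  - apply (continuous_ext (fun x => (- / 2) * u x)); [intros; rfield | cont].
  - apply (continuous_ext (fun x => (- / 2) * (cos (PI * x) * h x))); [intros; rfield | cont]. }
assert (eg : toC u = fun x => Cminus (Cmult (expi 1 x) (g x)) (g x)).
{ extensionality x; unfold expi, g, toC, cis, Cminus, Cmult, Cplus, Copp, RtoC; simpl.
  replace (2 * PI * 1 * x) with (2 * (PI * x)) by ring.
  rewrite cos_2a_sin, sin_2a.
  generalize (sin2_cos2 (PI * x)) (eh x); unfold Rsqr.
  set (sn := sin (PI * x)); set (cs := cos (PI * x)); intros h1 h2.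
  rewrite <- h2; f_equal; [|field].
  transitivity (sn * h x * (sn * sn + cs * cs)); [rewrite h1; ring | field]. }
assert (ef : forall n, fourier (toC u) n = Cminus (fourier g (n - 1)) (fourier g n)).
{ intros n; rewrite eg, fourier_minus, fourier_expi_mult by (intros; cont); reflexivity. }
assert (st : forall n, n <> 0%Z -> fourier g (n - 1) = fourier g n).
{ intros n hn; assert (e := ef n); rewrite hf in e by trivial.
  transitivity (Cplus (Cminus (fourier g (n - 1)) (fourier g n)) (fourier g n)); [cring|].
  rewrite <- e; cring. }
rewrite ef.
(* By [st] the coefficients of [g] are constant on [n >= 0] and, separately, on [n <= -1]; both
   constants vanish, hence so does [fourier g (0 - 1) - fourier g 0]. *)
rewrite (fourier_constant_eq0 g Z.of_nat (fourier g 0)); trivial.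
- rewrite (fourier_constant_eq0 g (fun m => (- 1 - Z.of_nat m)%Z) (fourier g (0 - 1)));
    trivial; [cring | intros i j; lia |].
  induction m as [|m IH]; [reflexivity|].
  rewrite <- IH, <- (st (-1 - Z.of_nat m)%Z) by lia; f_equal; lia.
- intros i j; lia.
- induction m as [|m IH]; [reflexivity|].
  rewrite <- IH, <- (st (Z.of_nat (S m))) by lia; f_equal; lia.
Qed.

Lemma is_derive_primitive (u : R -> R) a x : (forall x, continuous u x) ->
  is_derive (fun x => RInt u a x) x (u x).
Proof.
intros hu; apply (is_derive_RInt (V := R_NormedModule) u (fun x => RInt u a x) a x); [|apply hu].
exists (mkposreal _ Rlt_0_1); intros y _.
apply (RInt_correct (V := R_CompleteNormedModule)), continuous_ex_RInt, hu.
Qed.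

Lemma primitive_periodic (u : R -> R) : (forall x, continuous u x) ->
  (forall x, u (x + 1) = u x) -> RInt u 0 1 = 0 ->
  forall x, RInt u 0 (x + 1) = RInt u 0 x.
Proof.
intros cu pu h0 x.
assert (ex : forall a b, ex_RInt u a b) by (intros; now apply continuous_ex_RInt).
rewrite <- (RInt_Chasles (V := R_CompleteNormedModule) u 0 1 (x + 1)) by auto.
rewrite h0; transitivity (RInt u 1 (x + 1)); [apply Rplus_0_l|].
assert (h := RInt_comp_lin (V := R_CompleteNormedModule) u 1 1 0 x (ex _ _)).
rewrite !Rmult_1_l, Rplus_0_l in h; rewrite <- h; apply RInt_ext; intros y _.
transitivity (u (1 * y + 1)); [exact (Rmult_1_l _) | now rewrite Rmult_1_l, pu].
Qed.

Lemma fourier_0_toC (u : R -> R) : (forall x, continuous u x) ->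
  fourier (toC u) 0 = RtoC (RInt u 0 1).
Proof.
intros hu; rewrite fourier_toC by trivial; unfold RtoC; f_equal.
- apply RInt_ext; intros x _; rewrite Rmult_0_r, Rmult_0_l, cos_0; rring.
- rewrite (RInt_ext _ (fun _ => 0)), RInt_const.
  + change (- ((1 - 0) * 0) = 0); ring.
  + intros x _; rewrite Rmult_0_r, Rmult_0_l, sin_0; rring.
Qed.

(** [mean_eq_at_zero] asks for a differentiable function, so it is applied to the primitive [U] of
    [u], which is periodic with vanishing coefficients at all [n <> 0]. Applied to every translate
    [U (x + a) - U a], it shows that [U a] is the mean of [U] for all [a]; hence [U] is constant and
    [u = U' = 0]. *)
Lemma fourier_unique0 (u : R -> R) : (forall x, continuous u x) ->
  (forall x, u (x + 1) = u x) -> (forall n, fourier (toC u) n = RtoC 0) ->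
  forall x, u x = 0.
Proof.
intros cu pu hf.
set (U := fun x => RInt u 0 x).
assert (dU : forall x, is_derive U x (u x)) by (intros; now apply is_derive_primitive).
assert (cU : forall x, continuous U x) by (intros x; exact (is_derive_continuous _ _ _ (dU x))).
assert (pU : forall x, U (x + 1) = U x).
{ apply primitive_periodic; trivial.
  apply RtoC_inj; rewrite <- fourier_0_toC by trivial; apply hf. }
assert (hU : forall n, n <> 0%Z -> fourier (toC U) n = RtoC 0).
{ intros n hn; assert (e := fourier_derive U u n dU cu pU); rewrite hf in e.
  symmetry in e; destruct (Ceq_dec (fourier (toC U) n) (RtoC 0)) as [z|nz]; [trivial|].
  exfalso; revert e; apply Cmult_neq_0; [|exact nz].
  intros e'; injection e'; intros e''; apply hn, eq_IZR.
  generalize PI_RGT_0; intros hpi.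
  apply Rmult_integral in e''; destruct e''; lra. }
assert (key : forall a, U a = RInt U 0 1).
{ intros a.
  set (V := fun x => U (x + a) - U a).
  assert (dV : forall x, is_derive V x (u (x + a))).
  { intros x; unfold V; apply (is_derive_eq _ _ (u (x + a) - 0)); [|rring].
    apply (is_derive_Rminus (fun x => U (x + a)) (fun _ => U a)); [apply is_derive_translate, dU | apply (is_derive_const (V := R_NormedModule))]. }
  assert (cUa : forall x, continuous (fun x => U (x + a)) x).
  { intros x; apply (continuous_comp (fun x => x + a) U); cont. }
  assert (h : fourier (toC V) 0 = RtoC 0).
  { apply (mean_eq_at_zero V (fun x => u (x + a))); trivial.
    - intros x; unfold V; rewrite <- (pU (x + a)); do 2 f_equal; ring.
    - unfold V; rewrite Rplus_0_l; ring.
    - intros n hn.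
      replace (toC V) with (fun x => Cminus (toC U (x + a)) ((fun _ => RtoC (U a)) x))
        by (extensionality x; unfold V, toC; now rewrite RtoC_minus).
      rewrite fourier_minus, fourier_translate, hU, fourier_const; cont.
      + destruct (Z.eq_dec n 0); [tauto|]; cring.
      + intros x; now apply continuous_toC.
      + intros x; unfold toC; now rewrite pU.
      + intros x; apply (continuous_toC (fun x => U (x + a))), cUa.
      + intros; cont. }
  rewrite fourier_0_toC in h.
  - apply RtoC_inj in h; unfold V in h.
    rewrite (RInt_minus (V := R_CompleteNormedModule) (fun x => U (x + a)) (fun _ => U a)) in h
      by (apply continuous_ex_RInt; intros; cont).
    rewrite RInt_const, (RInt_periodic (V := R_CompleteNormedModule) U a) in h by trivial.
    change (RInt U 0 1 - (1 - 0) * U a = 0) in h; lra.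
  - intros x; exact (is_derive_continuous _ _ _ (dV x)). }
intros x; rewrite <- (is_derive_unique U x (u x) (dU x)).
rewrite (Derive_ext _ _ x key); apply Derive_const.
Qed.

(** * The spaces [H^sigma] *)

(** The value at [0] is raised to [1]: real powers take a positive base, and the frequency [0] gets
    weight [1], as in the norm of [H^sigma]. *)
Definition zmod (n : Z) : R := IZR (Z.max 1 (Z.abs n)).

Lemma zmod_ge1 n : 1 <= zmod n.
Proof. apply (IZR_le 1); lia. Qed.

(** The square of the weight of [e_n] in the norm of [H^sigma]. *)
Definition weight (sigma : R) (n : Z) : R := Rpower (zmod n) (2 * sigma).

Lemma weight_pos sigma n : 0 < weight sigma n.
Proof. apply exp_pos. Qed.

Lemma weight_0 sigma : weight sigma 0 = 1.
Proof.
unfold weight, zmod; replace (Z.max 1 (Z.abs 0)) with 1%Z by lia.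
unfold Rpower; rewrite ln_1, Rmult_0_r; apply exp_0.
Qed.

Lemma weight_S sigma n : weight sigma (Z.of_nat (S n)) = Rpower (INR (S n)) (2 * sigma).
Proof. unfold weight, zmod; rewrite INR_IZR_INZ; do 2 f_equal; lia. Qed.

Lemma weight_opp sigma n : weight sigma (- n) = weight sigma n.
Proof. unfold weight, zmod; now rewrite Z.abs_opp. Qed.

Definition sobolev_sum (sigma : R) (f : R -> C) (l : list Z) : R :=
  lsum (fun n => weight sigma n * Cmod (fourier f n) ^ 2) l.

Lemma sobolev_summand_ge0 sigma f n : 0 <= weight sigma n * Cmod (fourier f n) ^ 2.
Proof. apply Rmult_le_pos; [left; apply weight_pos | apply pow2_ge_0]. Qed.

Lemma sobolev_sum_window sigma f N :
  sobolev_sum sigma f (window N) =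
    Cmod (fourier f 0) ^ 2 + lsum (sobolev_term sigma f) (seq 0 N).
Proof.
unfold sobolev_sum; rewrite lsum_window_sum, weight_0, Rmult_1_l; f_equal.
apply lsum_ext; intros n _; rewrite weight_opp, weight_S; unfold sobolev_term; ring.
Qed.

Lemma lsum_seq_le_Series (a : nat -> R) N : (forall n, 0 <= a n) -> ex_series a ->
  lsum a (seq 0 N) <= Series a.
Proof.
intros h0 hs.
apply Rle_trans with (lsum a (seq 0 (S N))).
{ rewrite seq_S, lsum_app, lsum_cons; change (lsum ?g []) with 0.
  generalize (h0 (0 + N)%nat); lra. }
rewrite lsum_seq_sum_n.
apply (is_lim_seq_incr_compare (sum_n a)).
- exact (Series_correct a hs).
- intros n; rewrite sum_Sn; generalize (h0 (S n)); change plus with Rplus; lra.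
Qed.

Lemma ex_series_bounded (a : nat -> R) B : (forall n, 0 <= a n) ->
  (forall N, lsum a (seq 0 N) <= B) -> ex_series a /\ Series a <= B.
Proof.
intros h0 hB.
destruct (ex_finite_lim_seq_incr (sum_n a) B) as [l hl].
- intros n; rewrite sum_Sn; generalize (h0 (S n)); change plus with Rplus; lra.
- intros n; rewrite <- lsum_seq_sum_n; apply hB.
- assert (hs : is_series a l) by exact hl.
  split; [now exists l|]; rewrite (is_series_unique _ _ hs).
  apply (is_lim_seq_le (sum_n a) (fun _ => B) l B); trivial; [|apply is_lim_seq_const].
  intros n; rewrite <- lsum_seq_sum_n; apply hB.
Qed.

Lemma sobolev_norm_sq r f : is_sobolev r f ->
  sobolev_norm r f ^ 2 = sqnorm_L2 f + Series (sobolev_term r f).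
Proof. intros hf; apply pow2_sqrt, (sobolev_sq_ge0 r f hf). Qed.

Lemma sobolev_norm_ge0 r f : 0 <= sobolev_norm r f.
Proof. apply sqrt_pos. Qed.

(** [sobolev_norm] contains the whole [L^2] norm where [sobolev_sum] has only [|f^(0)|^2]; Bessel's
    inequality compares the two. *)
Lemma sobolev_sum_le sigma f l : is_sobolev sigma f -> NoDup l ->
  sobolev_sum sigma f l <= sobolev_norm sigma f ^ 2.
Proof.
intros hf nd; rewrite sobolev_norm_sq by trivial; destruct hf as [cf [pf sf]].
destruct (incl_window l) as [N hN].
apply Rle_trans with (sobolev_sum sigma f (window N)).
{ apply lsum_incl; trivial; intros; apply sobolev_summand_ge0. }
rewrite sobolev_sum_window; apply Rplus_le_compat.
- assert (h := bessel f [0%Z] cf); rewrite lsum_cons in h; simpl in h |- *.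
  rewrite Rplus_0_r in h; apply h; repeat constructor; intros [].
- apply lsum_seq_le_Series; trivial; intros; apply sobolev_term_ge0.
Qed.

Lemma sqnorm_L2_le (f : R -> C) M : (forall x, continuous (f : R -> CC) x) ->
  (forall x, Cmod (f x) <= M) -> sqnorm_L2 f <= M ^ 2.
Proof.
intros cf hM; unfold sqnorm_L2.
replace (M ^ 2) with (RInt (fun _ => M ^ 2) 0 1)
  by (rewrite RInt_const; change (scal ?a ?b) with (a * b); rring).
apply RInt_le; [lra | | apply ex_RInt_const |].
- apply continuous_ex_RInt; intros; cont.
- intros x _; apply pow_incr; split; [apply Cmod_ge_0 | apply hM].
Qed.

(** The supremum bound [M] controls the [L^2] part of the norm and [B] the weighted series, and
    [M^2 + B^2 <= (M + B)^2]. This holds for every real [sigma], in particular for [sigma = 0]. *)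
Lemma sobolev_intro sigma f M B : (forall x, continuous (f : R -> CC) x) ->
  (forall x, f (x + 1) = f x) -> (forall x, Cmod (f x) <= M) -> 0 <= B ->
  (forall l, NoDup l -> sobolev_sum sigma f l <= B ^ 2) ->
  is_sobolev sigma f /\ sobolev_norm sigma f <= M + B.
Proof.
intros cf pf hM hB hs.
assert (M0 : 0 <= M) by (apply Rle_trans with (2 := hM 0); apply Cmod_ge_0).
destruct (ex_series_bounded (sobolev_term sigma f) (B ^ 2)) as [h1 h2].
- intros; apply sobolev_term_ge0.
- intros N; specialize (hs (window N) (NoDup_window N)); rewrite sobolev_sum_window in hs.
  generalize (pow2_ge_0 (Cmod (fourier f 0))); lra.
- split; [now repeat split|].
  unfold sobolev_norm; rewrite <- (sqrt_pow2 (M + B)) by lra; apply sqrt_le_1_alt.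
  generalize (sqnorm_L2_le f M cf hM); nra.
Qed.

(** * Absolutely convergent Fourier series, and the embedding of [H^sigma] into bounded functions *)

Lemma Rpower_convex_step p x : 1 < p -> 1 < x ->
  (p - 1) * Rpower x (- p) <= Rpower (x - 1) (1 - p) - Rpower x (1 - p).
Proof.
intros hp hx.
destruct (MVT_gen (fun y => Rpower y (1 - p)) (x - 1) x (fun y => (1 - p) * Rpower y (1 - p - 1)))
  as [c [[h1 h2] e]].
- intros y hy; rewrite Rmin_left, Rmax_right in hy by lra.
  apply is_derive_Reals, derivable_pt_lim_power; lra.
- intros y hy; rewrite Rmin_left, Rmax_right in hy by lra.
  apply derivable_continuous_pt.
  exists ((1 - p) * Rpower y (1 - p - 1)); apply derivable_pt_lim_power; lra.
- rewrite Rmin_left, Rmax_right in * by lra.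
  replace (1 - p - 1) with (- p) in e by ring.
  assert (h : Rpower x (- p) <= Rpower c (- p)).
  { rewrite !Rpower_Ropp; apply Rinv_le_contravar; [apply exp_pos|].
    apply Rle_Rpower_l; lra. }
  replace (Rpower (x - 1) (1 - p) - Rpower x (1 - p)) with ((p - 1) * Rpower c (- p)) by lra.
  apply Rmult_le_compat_l; lra.
Qed.

(** Comparison of [sum n^(- p)] with the integral of [x^(- p)], where [p = 2 sigma > 1]: the steps
    given by the mean value theorem telescope. The threshold [1 / 2] of the Sobolev embedding comes
    from here. *)
Lemma inverse_weight_summable sigma : 1 / 2 < sigma ->
  exists K, 0 < K /\ forall l, NoDup l -> lsum (fun n => / weight sigma n) l <= K.
Proof.
intros hs; set (p := 2 * sigma).
assert (h : forall N, lsum (fun n => / Rpower (INR (S n)) p) (seq 0 (S N)) <=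
  1 + (1 - Rpower (INR (S N)) (1 - p)) / (p - 1)).
{ induction N as [|N IH].
  - change (seq 0 1) with [0%nat]; rewrite lsum_cons; change (lsum ?g []) with 0.
    change (INR 1) with 1; unfold Rpower; rewrite ln_1, !Rmult_0_r, exp_0, Rinv_1; right; unfold p; field; lra.
  - rewrite seq_S, lsum_app, lsum_cons; change (lsum ?g []) with 0; rewrite Nat.add_0_l.
    assert (h := Rpower_convex_step p (INR (S (S N)))).
    rewrite <- Rpower_Ropp.
    replace (INR (S (S N)) - 1) with (INR (S N)) in h by (rewrite (S_INR (S N)); ring).
    assert (h' : Rpower (INR (S (S N))) (- p) <=
      (Rpower (INR (S N)) (1 - p) - Rpower (INR (S (S N))) (1 - p)) / (p - 1)).
    { apply (Rmult_le_reg_l (p - 1)); [unfold p; lra|].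
      replace ((p - 1) * (_ / (p - 1)))
        with (Rpower (INR (S N)) (1 - p) - Rpower (INR (S (S N))) (1 - p))
        by (field; unfold p; lra).
      apply h; [unfold p; lra|].
      rewrite !S_INR; generalize (pos_INR N); lra. }
    rewrite Rplus_0_r; eapply Rle_trans; [apply Rplus_le_compat; [apply IH | apply h']|].
    right; field; unfold p; lra. }
assert (hp : 0 < / (p - 1)) by (apply Rinv_0_lt_compat; unfold p; lra).
(* [1] for the frequency [0], and twice the bound [1 + 1 / (p - 1)] for the pairs [n], [- n]. *)
exists (1 + 2 * (1 + / (p - 1))); split; [lra|].
intros l nd; destruct (incl_window l) as [N hN].
apply Rle_trans with (lsum (fun n => / weight sigma n) (window (S N))).
{ apply lsum_incl; trivial.
  - intros; left; apply Rinv_0_lt_compat, weight_pos.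
  - intros z hz; apply (window_incl N); auto. }
rewrite lsum_window_sum, weight_0, Rinv_1; apply Rplus_le_compat_l.
rewrite (lsum_ext _ (fun n => 2 * / Rpower (INR (S n)) p))
  by (intros n _; rewrite weight_opp, weight_S; fold p; ring).
rewrite lsum_scal; apply Rmult_le_compat_l; [lra|].
eapply Rle_trans; [apply h|]; apply Rplus_le_compat_l.
unfold Rdiv; rewrite <- (Rmult_1_l (/ (p - 1))) at 2; apply Rmult_le_compat_r; [lra|].
generalize (exp_pos ((1 - p) * ln (INR (S N)))); unfold Rpower; lra.
Qed.

(** Cauchy-Schwarz for the summable weight [1 / weight], applied to the factors [1] and
    [weight * a]. *)
Lemma summable_of_weighted sigma : 1 / 2 < sigma -> exists K, 0 < K /\
  forall (a : Z -> R) B, (forall n, 0 <= a n) -> 0 <= B ->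
  (forall l, NoDup l -> lsum (fun n => weight sigma n * a n ^ 2) l <= B ^ 2) ->
  forall l, NoDup l -> lsum a l <= K * B.
Proof.
intros hs; destruct (inverse_weight_summable sigma hs) as [K [hK h]].
exists (sqrt K); split; [now apply sqrt_lt_R0|].
intros a B ha hB hf l nd.
assert (cs := lsum_cauchy_schwarz (fun n => / weight sigma n) (fun _ => 1)
  (fun n => weight sigma n * a n) l
  (fun n => Rlt_le _ _ (Rinv_0_lt_compat _ (weight_pos sigma n)))).
rewrite (lsum_ext _ a l) in cs
  by (intros n _; generalize (weight_pos sigma n); intros; field; lra).
rewrite (lsum_ext (fun n => / weight sigma n * 1 ^ 2) (fun n => / weight sigma n) l) in cs
  by (intros; ring).
rewrite (lsum_ext (fun n => / weight sigma n * (weight sigma n * a n) ^ 2)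
  (fun n => weight sigma n * a n ^ 2) l) in cs
  by (intros n _; generalize (weight_pos sigma n); intros; field; lra).
assert (h1 := h l nd); assert (h2 := hf l nd).
assert (p1 : 0 <= lsum (fun n => / weight sigma n) l)
  by (apply lsum_ge0; intros; left; apply Rinv_0_lt_compat, weight_pos).
assert (p2 : 0 <= lsum (fun n => weight sigma n * a n ^ 2) l).
{ apply lsum_ge0; intros n; apply Rmult_le_pos; [left; apply weight_pos | apply pow2_ge_0]. }
apply Rsqr_incr_0_var; [|apply Rmult_le_pos; [apply sqrt_pos | trivial]].
rewrite !Rsqr_pow2, Rpow_mult_distr, pow2_sqrt by lra.
apply Rle_trans with (1 := cs); apply Rmult_le_compat; trivial.
Qed.

Lemma fourier_summable sigma : 1 / 2 < sigma -> exists K, 0 < K /\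
  forall f B, 0 <= B -> (forall l, NoDup l -> sobolev_sum sigma f l <= B ^ 2) ->
  forall l, NoDup l -> lsum (fun n => Cmod (fourier f n)) l <= K * B.
Proof.
intros hs; destruct (summable_of_weighted sigma hs) as [K [hK h]]; exists K; split; trivial.
intros f B hB hf; apply h; trivial; intros; apply Cmod_ge_0.
Qed.

Definition trig_sum (c : Z -> C) (N : nat) (x : R) : C :=
  csum (fun k => Cmult (c k) (expi k x)) (window N).

Lemma csum_window_S (f : Z -> C) N :
  csum f (window (S N)) =
    Cplus (csum f (window N)) (Cplus (f (Z.of_nat (S N))) (f (- Z.of_nat (S N))%Z)).
Proof.
rewrite window_S; change (csum f (?a :: ?l)) with (Cplus (f a) (csum f l)).
rewrite csum_app; change (csum f [?a]) with (Cplus (f a) (RtoC 0)); cring.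
Qed.

Lemma lsum_window_incr (a : Z -> R) N M : (forall n, 0 <= a n) -> (N <= M)%nat ->
  lsum a (window N) <= lsum a (window M).
Proof.
intros h0 h; apply lsum_incl; trivial; [apply NoDup_window | now apply window_incl].
Qed.

Lemma csum_window_diff (f : Z -> C) N M : (N <= M)%nat ->
  Cmod (Cminus (csum f (window M)) (csum f (window N))) <=
    lsum (fun k => Cmod (f k)) (window M) - lsum (fun k => Cmod (f k)) (window N).
Proof.
induction 1 as [|M h IH].
- replace (Cminus _ _) with (RtoC 0) by cring; rewrite Cmod_0; lra.
- rewrite csum_window_S, lsum_window_S.
  set (u := f (Z.of_nat (S M))); set (v := f (- Z.of_nat (S M))%Z).
  replace (Cminus _ _) with
    (Cplus (Cminus (csum f (window M)) (csum f (window N))) (Cplus u v)) by cring.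
  generalize (Cmod_triangle (Cminus (csum f (window M)) (csum f (window N))) (Cplus u v))
    (Cmod_triangle u v); lra.
Qed.

Lemma Cmod_le_Re_Im (z : C) : Cmod z <= Rabs (Re z) + Rabs (Im z).
Proof.
destruct z as [a b]; simpl.
replace (a, b) with (Cplus (RtoC a) (Cmult (0, 1) (RtoC b)))
  by (unfold Cplus, Cmult, RtoC; simpl; f_equal; ring).
eapply Rle_trans; [apply Cmod_triangle|].
rewrite Cmod_mult, !Cmod_R; right; f_equal.
replace (Cmod (0, 1)) with 1; [ring|].
unfold Cmod; simpl; symmetry; transitivity (sqrt 1); [f_equal; ring | apply sqrt_1].
Qed.

Lemma Rabs_Re_le (z : C) : Rabs (Re z) <= Cmod z.
Proof. eapply Rle_trans; [apply Rmax_l | apply Rmax_Cmod]. Qed.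

Lemma Rabs_Im_le (z : C) : Rabs (Im z) <= Cmod z.
Proof. eapply Rle_trans; [apply Rmax_r | apply Rmax_Cmod]. Qed.

Lemma is_lim_seq_lower (u : nat -> R) (x l : R) :
  (forall N, x <= u N) -> is_lim_seq u l -> x <= l.
Proof. intros h hu; exact (is_lim_seq_le _ _ x l h (is_lim_seq_const x) hu). Qed.

Lemma is_lim_seq_upper (u : nat -> R) (x l : R) :
  (forall N, u N <= x) -> is_lim_seq u l -> l <= x.
Proof. intros h hu; exact (is_lim_seq_le _ _ l x h hu (is_lim_seq_const x)). Qed.

Lemma Cauchy_complex (p : nat -> C) (t : nat -> R) : is_lim_seq t 0 ->
  (forall N M, (N <= M)%nat -> Cmod (Cminus (p M) (p N)) <= t N) ->
  exists z, forall N, Cmod (Cminus (p N) z) <= 2 * t N.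
Proof.
intros ht hp.
assert (key : forall q : nat -> R, (forall N M, (N <= M)%nat -> Rabs (q M - q N) <= t N) ->
  exists l, forall N, Rabs (q N - l) <= t N).
{ intros q hq.
  assert (hc : ex_finite_lim_seq q).
  { apply ex_lim_seq_cauchy_corr; intros eps.
    assert (he : 0 < eps / 2) by (generalize (cond_pos eps); lra).
    destruct (proj1 (is_lim_seq_Reals t 0) ht (eps / 2) he) as [N hN]; exists N.
    intros n m hn hm.
    assert (tN := hN N (Nat.le_refl _)); unfold R_dist in tN; rewrite Rminus_0_r in tN.
    apply Rabs_def2 in tN.
    assert (h1 := Rabs_triang (q n - q N) (- (q m - q N))).
    replace (q n - q N + - (q m - q N)) with (q n - q m) in h1 by ring.
    rewrite Rabs_Ropp in h1; generalize (hq N n hn) (hq N m hm); lra. }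
  destruct hc as [l hl]; exists l; intros N.
  assert (h : is_lim_seq (fun M => Rabs (q (M + N)%nat - q N)) (Rabs (l - q N))).
  { apply (is_lim_seq_abs _ (l - q N)), (is_lim_seq_minus' _ _ l (q N)).
    - now apply is_lim_seq_incr_n.
    - apply is_lim_seq_const. }
  rewrite Rabs_minus_sym.
  apply (is_lim_seq_le _ (fun _ => t N) _ (t N)) in h; [exact h | | apply is_lim_seq_const].
  intros M; apply hq; lia. }
destruct (key (fun N => Re (p N))) as [a ha].
{ intros N M h; apply Rle_trans with (2 := hp N M h).
  exact (Rabs_Re_le (Cminus (p M) (p N))). }
destruct (key (fun N => Im (p N))) as [b hb].
{ intros N M h; apply Rle_trans with (2 := hp N M h).
  exact (Rabs_Im_le (Cminus (p M) (p N))). }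
exists (a, b); intros N; eapply Rle_trans; [apply Cmod_le_Re_Im|].
replace (2 * t N) with (t N + t N) by ring; apply Rplus_le_compat; [apply ha | apply hb].
Qed.

Lemma continuous_trig_sum c N x : continuous (trig_sum c N : R -> CC) x.
Proof.
unfold trig_sum; generalize (window N) as l; induction l as [|k l IH].
- apply continuous_const.
- change (continuous ((fun x => Cplus (Cmult (c k) (expi k x))
    (csum (fun k => Cmult (c k) (expi k x)) l)) : R -> CC) x); cont.
Qed.

Lemma fourier_csum (g : Z -> R -> C) (l : list Z) n :
  (forall k x, continuous (g k : R -> CC) x) ->
  fourier (fun x => csum (fun k => g k x) l) n = csum (fun k => fourier (g k) n) l /\
  forall x, continuous ((fun x => csum (fun k => g k x) l) : R -> CC) x.
Proof.
intros hg; induction l as [|k l [e c]].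
- split; [|intros; apply continuous_const].
  simpl; rewrite fourier_const; now destruct (Z.eq_dec n 0).
- split.
  + change (fourier (fun x => Cplus (g k x) (csum (fun k => g k x) l)) n =
      Cplus (fourier (g k) n) (csum (fun k => fourier (g k) n) l)).
    rewrite <- e; apply fourier_plus; trivial.
  + intros x; apply continuous_Cplus; auto.
Qed.

Lemma uniform_limit_continuous (p : nat -> R -> C) (s : R -> C) (t : nat -> R) :
  (forall N x, continuous (p N : R -> CC) x) -> is_lim_seq t 0 ->
  (forall N x, Cmod (Cminus (p N x) (s x)) <= t N) ->
  forall x, continuous (s : R -> CC) x.
Proof.
intros cp ht h x; apply filterlim_locally; intros eps.
assert (he : 0 < eps / 3) by (generalize (cond_pos eps); lra).
destruct (proj1 (is_lim_seq_Reals t 0) ht (eps / 3) he) as [N hN].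
assert (tN := hN N (Nat.le_refl _)); unfold R_dist in tN; rewrite Rminus_0_r in tN.
apply Rabs_def2 in tN.
assert (hl : locally x (fun y => Cmod (Cminus (p N y) (p N x)) < eps / 3)).
{ assert (cm : continuous (fun y => Cmod (Cminus (p N y) (p N x)) ^ 2) x) by (cont; apply cp).
  assert (he2 : 0 < (eps / 3) ^ 2) by now apply pow_lt.
  generalize (proj1 (filterlim_locally _ _) cm (mkposreal _ he2)); apply filter_imp.
  intros y hy; change (Rabs (Cmod (Cminus (p N y) (p N x)) ^ 2 -
    Cmod (Cminus (p N x) (p N x)) ^ 2) < (eps / 3) ^ 2) in hy.
  replace (Cminus (p N x) (p N x)) with (RtoC 0) in hy by cring.
  rewrite Cmod_0 in hy; apply Rabs_def2 in hy.
  apply Rnot_le_lt; intros hn.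
  assert (hh := pow_incr (eps / 3) _ 2 (conj (Rlt_le _ _ he) hn)).
  destruct hy as [hy _]; simpl in hy, hh; lra. }
revert hl; apply filter_imp; intros y hy.
assert (hd : Cmod (Cminus (s y) (s x)) < eps).
{ replace (Cminus (s y) (s x)) with
    (Cplus (Copp (Cminus (p N y) (s y))) (Cplus (Cminus (p N y) (p N x)) (Cminus (p N x) (s x))))
    by cring.
  eapply Rle_lt_trans; [apply Cmod_triangle|]; rewrite Cmod_opp.
  generalize (Cmod_triangle (Cminus (p N y) (p N x)) (Cminus (p N x) (s x)))
    (h N y) (h N x); lra. }
split; [apply Rle_lt_trans with (2 := hd); apply (Rabs_Re_le (Cminus (s y) (s x)))
       | apply Rle_lt_trans with (2 := hd); apply (Rabs_Im_le (Cminus (s y) (s x)))].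
Qed.

Lemma csum_delta (c : Z -> C) n l : NoDup l ->
  csum (fun k => Cmult (c k) (if Z.eq_dec n k then RtoC 1 else RtoC 0)) l =
    if in_dec Z.eq_dec n l then c n else RtoC 0.
Proof.
induction 1 as [|k l hk nd IH]; [reflexivity|].
change (csum ?f (k :: l)) with (Cplus (f k) (csum f l)); cbv beta; rewrite IH.
destruct (in_dec Z.eq_dec n l) as [hi|hi], (in_dec Z.eq_dec n (k :: l)) as [hj|hj],
  (Z.eq_dec n k) as [e|e]; simpl in hj; subst; try tauto; try cring.
destruct hj; [subst|]; tauto.
Qed.

(** The partial sums over windows are uniformly Cauchy, since their increments are bounded by the
    tail [A - a N] of the absolute series; uniform convergence then transfers continuity,
    periodicity, coefficients and bound to the limit. The rate [t] is twice the tail because real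
    and imaginary parts converge separately. *)
Lemma fourier_series_synthesis (c : Z -> C) K :
  (forall l, NoDup l -> lsum (fun k => Cmod (c k)) l <= K) ->
  exists (s : R -> C) (t : nat -> R),
    (forall x, continuous (s : R -> CC) x) /\ (forall x, s (x + 1) = s x) /\
    (forall n, fourier s n = c n) /\ (forall x, Cmod (s x) <= K) /\
    is_lim_seq t 0 /\ forall N x, Cmod (Cminus (trig_sum c N x) (s x)) <= t N.
Proof.
intros hK; set (a := fun N => lsum (fun k => Cmod (c k)) (window N)).
destruct (ex_finite_lim_seq_incr a K) as [A hA].
{ intros N; apply lsum_window_incr; [intros; apply Cmod_ge_0 | lia]. }
{ intros N; apply hK, NoDup_window. }
assert (hle : forall N, a N <= A).
{ intros N; apply (is_lim_seq_incr_compare a A hA).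
  intros M; apply lsum_window_incr; [intros; apply Cmod_ge_0 | lia]. }
assert (h0 : is_lim_seq (fun N => A - a N) 0).
{ replace (Finite 0) with (Finite (A - A)) by (f_equal; ring).
  apply is_lim_seq_minus'; [apply is_lim_seq_const | exact hA]. }
assert (hm : forall N x, lsum (fun k => Cmod (Cmult (c k) (expi k x))) (window N) = a N).
{ intros N x; apply lsum_ext; intros; rewrite Cmod_mult, Cmod_expi; ring. }
assert (hc : forall x, exists z, forall N,
  Cmod (Cminus (trig_sum c N x) z) <= 2 * (A - a N)).
{ intros x; apply Cauchy_complex; [exact h0|]; intros N M h.
  assert (h' := csum_window_diff (fun k => Cmult (c k) (expi k x)) N M h).
  cbv beta in h'; rewrite !hm in h'; unfold trig_sum; generalize (hle M) (hle N); lra. }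
set (s := fun x => proj1_sig (constructive_indefinite_description _ (hc x))).
assert (hs : forall x N, Cmod (Cminus (trig_sum c N x) (s x)) <= 2 * (A - a N))
  by (intros x; exact (proj2_sig (constructive_indefinite_description _ (hc x)))).
assert (ht : is_lim_seq (fun N => 2 * (A - a N)) 0).
{ replace (Finite 0) with (Rbar_mult 2 0) by (simpl; f_equal; ring).
  now apply is_lim_seq_scal_l. }
assert (cs : forall x, continuous (s : R -> CC) x).
{ apply (uniform_limit_continuous (trig_sum c) s (fun N => 2 * (A - a N))); auto.
  intros; apply continuous_trig_sum. }
assert (lim0 : forall z, (exists N0, forall N, (N0 <= N)%nat -> Cmod z <= 2 * (A - a N)) ->
  z = RtoC 0).
{ intros z [N0 hz]; apply Cmod_eq_0, Rle_antisym; [|apply Cmod_ge_0].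
  apply (is_lim_seq_lower (fun N => 2 * (A - a (N + N0)%nat)) (Cmod z) 0).
  - intros N; apply hz; lia.
  - now apply (is_lim_seq_incr_n (fun N => 2 * (A - a N))). }
exists s, (fun N => 2 * (A - a N)); split; [|split; [|split; [|split; [|split]]]]; auto.
- intros x.
  assert (hx : Cminus (s (x + 1)) (s x) = RtoC 0).
  { destruct (Req_dec (Cmod (Cminus (s (x + 1)) (s x))) 0) as [e|ne]; [now apply Cmod_eq_0|].
    exfalso.
    assert (hb : forall N, Cmod (Cminus (s (x + 1)) (s x)) <= 2 * (2 * (A - a N))).
    { intros N.
      assert (et : trig_sum c N (x + 1) = trig_sum c N x).
      { unfold trig_sum; f_equal; extensionality k; now rewrite expi_periodic. }
      replace (Cminus (s (x + 1)) (s x)) with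
        (Cplus (Copp (Cminus (trig_sum c N (x + 1)) (s (x + 1))))
           (Cminus (trig_sum c N x) (s x))) by (rewrite et; cring).
      eapply Rle_trans; [apply Cmod_triangle|]; rewrite Cmod_opp.
      generalize (hs (x + 1) N) (hs x N); lra. }
    apply ne, Rle_antisym; [|apply Cmod_ge_0].
    apply (is_lim_seq_lower (fun N => 2 * (2 * (A - a N))) _ 0 hb).
    replace (Finite 0) with (Rbar_mult 2 0) by (simpl; f_equal; ring).
    now apply is_lim_seq_scal_l. }
  transitivity (Cplus (Cminus (s (x + 1)) (s x)) (s x)); [cring | rewrite hx; cring].
- intros n.
  assert (hx : Cminus (c n) (fourier s n) = RtoC 0).
  { apply lim0; exists (Z.to_nat (Z.abs n)); intros N hN.
    assert (e : fourier (trig_sum c N) n = c n).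
    { unfold trig_sum.
      assert (ct : forall k x, continuous ((fun x => Cmult (c k) (expi k x)) : R -> CC) x)
        by (intros; cont).
      rewrite (proj1 (fourier_csum (fun k x => Cmult (c k) (expi k x)) (window N) n ct)).
      transitivity (csum (fun k => Cmult (c k) (if Z.eq_dec n k then RtoC 1 else RtoC 0))
        (window N)).
      - f_equal; extensionality k; rewrite fourier_Cmult, fourier_expi by (intros; cont).
        reflexivity.
      - rewrite csum_delta by apply NoDup_window.
        destruct (in_dec Z.eq_dec n (window N)) as [|hn]; [reflexivity|].
        exfalso; apply hn, in_window; lia. }
    rewrite <- e, <- fourier_minus; auto using continuous_trig_sum.
    apply Cmod_fourier_le; [|intros; apply hs].
    intros; apply continuous_Cminus; auto using continuous_trig_sum. }
  transitivity (Cminus (c n) (Cminus (c n) (fourier s n))); [cring | rewrite hx; cring].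
- intros x.
  assert (hb : forall N, Cmod (s x) <= K + 2 * (A - a N)).
  { intros N.
    replace (s x) with (Cplus (trig_sum c N x) (Copp (Cminus (trig_sum c N x) (s x)))) by cring.
    eapply Rle_trans; [apply Cmod_triangle|]; rewrite Cmod_opp.
    apply Rplus_le_compat; [|apply hs].
    eapply Rle_trans; [apply Cmod_csum|]; cbv beta; rewrite hm; apply hK, NoDup_window. }
  replace K with (K + 0) by ring.
  apply (is_lim_seq_lower (fun N => K + 2 * (A - a N)) _ _ hb).
  apply is_lim_seq_plus'; [apply is_lim_seq_const | exact ht].
Qed.

Lemma continuous_Cconj (f : R -> C) x : continuous (f : R -> CC) x ->
  continuous ((fun t => Cconj (f t)) : R -> CC) x.
Proof.
intros h; apply continuous_C_pair; [now apply continuous_Re|].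
apply (continuous_opp (V := R_NormedModule) (fun t => Im (f t))); now apply continuous_Im.
Qed.

Lemma fourier_conj (f : R -> C) n : (forall x, continuous (f : R -> CC) x) ->
  fourier (fun x => Cconj (f x)) n = Cconj (fourier f (- n)).
Proof.
intros cf; rewrite !fourierE, Z.opp_involutive.
assert (e : forall x, Cmult (Cconj (f x)) (expi (- n) x) = Cconj (Cmult (f x) (expi n x))).
{ intros x; rewrite Cmult_conj; f_equal; unfold expi, cis, Cconj; simpl.
  rewrite opp_IZR; replace (2 * PI * - IZR n * x) with (- (2 * PI * IZR n * x)) by ring.
  now rewrite cos_neg, sin_neg. }
rewrite (RInt_ext (V := CC) _ _ 0 1 (fun x _ => e x)).
assert (cg : forall x, continuous ((fun x => Cmult (f x) (expi n x)) : R -> CC) x)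
  by (intros; cont).
rewrite (RInt_C (fun x => Cmult (f x) (expi n x)) 0 1 cg).
rewrite (RInt_C _ 0 1 (fun x => continuous_Cconj _ x (cg x))).
unfold Cconj; simpl; f_equal.
rewrite <- (RInt_opp (V := R_CompleteNormedModule) (fun x => Im (Cmult (f x) (expi n x))));
  [reflexivity|].
apply continuous_ex_RInt; intros; cont.
Qed.

Lemma fourier_Re (f : R -> C) n : (forall x, continuous (f : R -> CC) x) ->
  fourier (toC (fun x => Re (f x))) n =
    Cmult (RtoC (/ 2)) (Cplus (fourier f n) (Cconj (fourier f (- n)))).
Proof.
intros cf.
replace (toC (fun x => Re (f x)))
  with (fun x => Cmult (RtoC (/ 2)) (Cplus (f x) (Cconj (f x)))).
- rewrite fourier_Cmult, fourier_plus, fourier_conj; auto using continuous_Cconj.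
  intros; apply continuous_Cplus; auto using continuous_Cconj.
- extensionality x; unfold toC, Cconj, Cplus, Cmult, RtoC, Re; simpl; f_equal; field.
Qed.

Lemma fourier_Im (f : R -> C) n : (forall x, continuous (f : R -> CC) x) ->
  fourier (toC (fun x => Im (f x))) n =
    Cmult (0, - / 2) (Cminus (fourier f n) (Cconj (fourier f (- n)))).
Proof.
intros cf.
replace (toC (fun x => Im (f x)))
  with (fun x => Cmult (0, - / 2) (Cminus (f x) (Cconj (f x)))).
- rewrite fourier_Cmult, fourier_minus, fourier_conj; auto using continuous_Cconj.
  intros; apply continuous_Cminus; auto using continuous_Cconj.
- extensionality x; unfold toC, Cconj, Cminus, Cplus, Copp, Cmult, RtoC, Im; simpl; f_equal; field.
Qed.

Lemma fourier_unique (f : R -> C) : (forall x, continuous (f : R -> CC) x) ->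
  (forall x, f (x + 1) = f x) -> (forall n, fourier f n = RtoC 0) ->
  forall x, f x = RtoC 0.
Proof.
intros cf pf hf x.
assert (c0 : Cconj (RtoC 0) = RtoC 0) by (unfold Cconj, RtoC; simpl; f_equal; ring).
assert (hr : Re (f x) = 0).
{ apply (fourier_unique0 (fun x => Re (f x))); [intros; cont | intros y; now rewrite pf|].
  intros n; rewrite fourier_Re, !hf, c0 by trivial; cring. }
assert (hi : Im (f x) = 0).
{ apply (fourier_unique0 (fun x => Im (f x))); [intros; cont | intros y; now rewrite pf|].
  intros n; rewrite fourier_Im, !hf, c0 by trivial; cring. }
rewrite (surjective_pairing (f x)); unfold Re, Im in hr, hi; now rewrite hr, hi.
Qed.

(** The sum of the series is continuous and has the same coefficients as [f], so it is [f] by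
    uniqueness. *)
Lemma fourier_inversion (f : R -> C) K : (forall x, continuous (f : R -> CC) x) ->
  (forall x, f (x + 1) = f x) ->
  (forall l, NoDup l -> lsum (fun k => Cmod (fourier f k)) l <= K) ->
  (forall x, Cmod (f x) <= K) /\
  exists t : nat -> R, is_lim_seq t 0 /\
    forall N x, Cmod (Cminus (trig_sum (fourier f) N x) (f x)) <= t N.
Proof.
intros cf pf hK.
destruct (fourier_series_synthesis _ K hK) as [s [t [cs [ps [hs [bs [ht h]]]]]]].
assert (e : forall x, s x = f x).
{ intros x.
  transitivity (Cplus (Cminus (s x) (f x)) (f x)); [cring|].
  rewrite (fourier_unique (fun x => Cminus (s x) (f x))); [cring | | |].
  - intros; cont.
  - intros y; now rewrite pf, ps.
  - intros n; rewrite fourier_minus, hs by trivial; cring. }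
split; [intros x; rewrite <- e; apply bs|].
exists t; split; trivial; intros N x; rewrite <- e; apply h.
Qed.

Lemma sobolev_summable sigma : 1 / 2 < sigma -> exists K, 0 < K /\
  forall f, is_sobolev sigma f -> forall l, NoDup l ->
    lsum (fun k => Cmod (fourier f k)) l <= K * sobolev_norm sigma f.
Proof.
intros hs; destruct (fourier_summable sigma hs) as [K [hK h]]; exists K; split; trivial.
intros f hf; apply h; [apply sobolev_norm_ge0|].
intros l nd; now apply sobolev_sum_le.
Qed.

Lemma sobolev_sup sigma : 1 / 2 < sigma -> exists K, 0 < K /\
  forall f, is_sobolev sigma f -> forall x, Cmod (f x) <= K * sobolev_norm sigma f.
Proof.
intros hs; destruct (sobolev_summable sigma hs) as [K [hK h]]; exists K; split; trivial.
intros f hf; destruct (fourier_inversion f (K * sobolev_norm sigma f)) as [hb _]; trivial;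
  try apply hf; now apply h.
Qed.

(** For [sigma > 1 / 2] the coefficients alone control the supremum, so the bound [M] of
    [sobolev_intro] can be taken to be a multiple of [B]. *)
Lemma sobolev_of_sum sigma : 1 / 2 < sigma -> exists K, 0 < K /\
  forall f B, (forall x, continuous (f : R -> CC) x) -> (forall x, f (x + 1) = f x) ->
    0 <= B -> (forall l, NoDup l -> sobolev_sum sigma f l <= B ^ 2) ->
    is_sobolev sigma f /\ sobolev_norm sigma f <= K * B.
Proof.
intros hs; destruct (fourier_summable sigma hs) as [K [hK h]].
exists (K + 1); split; [lra|]; intros f B cf pf hB hf.
destruct (fourier_inversion f (K * B)) as [hb _]; trivial; [now apply h|].
replace ((K + 1) * B) with (K * B + B) by ring.
now apply sobolev_intro.
Qed.

(** * Convolution estimates, and [H^sigma] as a Banach algebra *)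

Definition summable_by (P : R) (a : Z -> R) : Prop :=
  forall l, NoDup l -> lsum a l <= P.

Lemma lsum_shift (a : Z -> R) (k : Z) P l : summable_by P a -> NoDup l ->
  lsum (fun n => a (n - k)%Z) l <= P.
Proof.
intros ha nd; rewrite <- (lsum_map a (fun n => (n - k)%Z)); apply ha.
apply Injective_map_NoDup; trivial; intros i j; lia.
Qed.

Lemma lsum_reflect (a : Z -> R) (n : Z) P l : summable_by P a -> NoDup l ->
  lsum (fun k => a (n - k)%Z) l <= P.
Proof.
intros ha nd; rewrite <- (lsum_map a (fun k => (n - k)%Z)); apply ha.
apply Injective_map_NoDup; trivial; intros i j; lia.
Qed.

Lemma lsum_weighted_square (p q : Z -> R) l P : (forall k, 0 <= p k) -> lsum p l <= P ->
  lsum (fun k => p k * q k) l ^ 2 <= P * lsum (fun k => p k * q k ^ 2) l.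
Proof.
intros hp hP; assert (cs := lsum_cauchy_schwarz p (fun _ => 1) q l hp).
rewrite (lsum_ext (fun k => p k * (1 * q k)) (fun k => p k * q k)) in cs by (intros; ring).
rewrite (lsum_ext (fun k => p k * 1 ^ 2) p) in cs by (intros; ring).
apply Rle_trans with (1 := cs), Rmult_le_compat_r; trivial.
apply lsum_ge0; intros; apply Rmult_le_pos; [apply hp | apply pow2_ge_0].
Qed.

(** Young's inequality [l^1 * l^2 -> l^2]: Cauchy-Schwarz with respect to the weights [p k],
    followed by an exchange of the two sums. *)
Lemma young_convolution_l (p q : Z -> R) P Q l m :
  (forall k, 0 <= p k) -> summable_by P p -> summable_by Q (fun k => q k ^ 2) ->
  NoDup l -> NoDup m ->
  lsum (fun n => lsum (fun k => p k * q (n - k)%Z) m ^ 2) l <= P ^ 2 * Q.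
Proof.
intros h0 hp hq ndl ndm.
assert (P0 : 0 <= P) by exact (hp [] (NoDup_nil _)).
assert (Q0 : 0 <= Q) by exact (hq [] (NoDup_nil _)).
apply Rle_trans with (lsum (fun n => P * lsum (fun k => p k * q (n - k)%Z ^ 2) m) l).
{ apply lsum_le; intros n _.
  apply (lsum_weighted_square p (fun k => q (n - k)%Z)); auto. }
rewrite lsum_scal, lsum_swap; replace (P ^ 2 * Q) with (P * (P * Q)) by ring.
apply Rmult_le_compat_l; trivial.
apply Rle_trans with (lsum (fun k => Q * p k) m).
- apply lsum_le; intros k _; rewrite lsum_scal, Rmult_comm; apply Rmult_le_compat_r; auto.
  apply (lsum_shift (fun n => q n ^ 2)); trivial.
- rewrite lsum_scal, Rmult_comm; apply Rmult_le_compat_r; auto.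
Qed.

(** The same with the [l^1] factor at [n - k]. It is a separate statement because the truncation of
    [k] to [m] is not preserved by [k |-> n - k]. *)
Lemma young_convolution_r (p q : Z -> R) P Q l m :
  (forall k, 0 <= p k) -> summable_by P p -> summable_by Q (fun k => q k ^ 2) ->
  NoDup l -> NoDup m ->
  lsum (fun n => lsum (fun k => p (n - k)%Z * q k) m ^ 2) l <= P ^ 2 * Q.
Proof.
intros h0 hp hq ndl ndm.
assert (P0 : 0 <= P) by exact (hp [] (NoDup_nil _)).
assert (Q0 : 0 <= Q) by exact (hq [] (NoDup_nil _)).
apply Rle_trans with (lsum (fun n => P * lsum (fun k => p (n - k)%Z * q k ^ 2) m) l).
{ apply lsum_le; intros n _.
  apply (lsum_weighted_square (fun k => p (n - k)%Z) q); auto.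
  now apply lsum_reflect. }
rewrite lsum_scal, lsum_swap; replace (P ^ 2 * Q) with (P * (P * Q)) by ring.
apply Rmult_le_compat_l; trivial.
apply Rle_trans with (lsum (fun k => P * q k ^ 2) m).
- apply lsum_le; intros k _.
  rewrite (lsum_ext _ (fun n => q k ^ 2 * p (n - k)%Z)) by (intros; ring).
  rewrite lsum_scal, Rmult_comm; apply Rmult_le_compat_r; [apply pow2_ge_0|].
  now apply lsum_shift.
- rewrite lsum_scal; apply Rmult_le_compat_l; auto.
Qed.

Definition root_weight (sigma : R) (n : Z) : R := Rpower (zmod n) sigma.

Lemma root_weight_pos sigma n : 0 < root_weight sigma n.
Proof. apply exp_pos. Qed.

Lemma root_weight_sq sigma n : root_weight sigma n ^ 2 = weight sigma n.
Proof.
unfold root_weight, weight; rewrite <- Rpower_pow by apply exp_pos.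
rewrite Rpower_mult; f_equal; simpl; ring.
Qed.

(** [|m + n|] is at most twice the larger of [|m|] and [|n|], whence the factor [2^sigma]; the other
    summand is only added. *)
Lemma root_weight_plus sigma m n : 0 <= sigma ->
  root_weight sigma (m + n) <=
    Rpower 2 sigma * (root_weight sigma m + root_weight sigma n).
Proof.
intros hs.
assert (key : forall a b, zmod a <= zmod b -> zmod (m + n) <= 2 * zmod b ->
  root_weight sigma (m + n) <= Rpower 2 sigma * (root_weight sigma a + root_weight sigma b)).
{ intros a b h h2.
  apply Rle_trans with (Rpower 2 sigma * root_weight sigma b).
  - unfold root_weight; rewrite Rpower_mult_distr; [|lra | generalize (zmod_ge1 b); lra].
    apply Rle_Rpower_l; [lra|]; generalize (zmod_ge1 (m + n)); lra.
  - apply Rmult_le_compat_l; [left; apply exp_pos|].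
    generalize (root_weight_pos sigma a); lra. }
assert (ht : zmod (m + n) <= zmod m + zmod n).
{ unfold zmod; rewrite <- plus_IZR; apply IZR_le; lia. }
destruct (Rle_dec (zmod m) (zmod n)) as [h|h].
- apply key; lra.
- rewrite (Rplus_comm (root_weight sigma m)); apply key; lra.
Qed.

Lemma is_lim_seq_lsum {A} (F : nat -> A -> R) (G : A -> R) l :
  (forall a, is_lim_seq (fun N => F N a) (G a)) ->
  is_lim_seq (fun N => lsum (F N) l) (lsum G l).
Proof.
intros h; induction l as [|a l IH]; [apply is_lim_seq_const|].
rewrite lsum_cons; apply (is_lim_seq_plus' _ _ _ _ (h a) IH).
Qed.

Lemma is_lim_seq_Cmod (p : nat -> C) z (t : nat -> R) : is_lim_seq t 0 ->
  (forall N, Cmod (Cminus (p N) z) <= t N) -> is_lim_seq (fun N => Cmod (p N)) (Cmod z).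
Proof.
intros ht h.
apply (is_lim_seq_le_le (fun N => Cmod z - t N) _ (fun N => Cmod z + t N)).
- intros N.
  assert (h1 := Cmod_triangle (Cminus (p N) z) z).
  assert (h2 := Cmod_triangle (p N) (Copp (Cminus (p N) z))).
  replace (Cplus (Cminus (p N) z) z) with (p N) in h1 by cring.
  replace (Cplus (p N) (Copp (Cminus (p N) z))) with z in h2 by cring.
  rewrite Cmod_opp in h2; generalize (h N); lra.
- replace (Finite (Cmod z)) with (Finite (Cmod z - 0)) by (f_equal; ring).
  apply is_lim_seq_minus'; [apply is_lim_seq_const | exact ht].
- replace (Finite (Cmod z)) with (Finite (Cmod z + 0)) by (f_equal; ring).
  apply is_lim_seq_plus'; [apply is_lim_seq_const | exact ht].
Qed.

(** Only [f] is expanded: its series converges uniformly and [g] is bounded, so the coefficients of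
    the truncated products, which are finite convolutions, converge with an error [M * t N] that is
    uniform in [n]. *)
Lemma fourier_product (f g : R -> C) K M : (forall x, continuous (f : R -> CC) x) ->
  (forall x, f (x + 1) = f x) ->
  (forall l, NoDup l -> lsum (fun k => Cmod (fourier f k)) l <= K) ->
  (forall x, continuous (g : R -> CC) x) -> (forall x, Cmod (g x) <= M) ->
  exists t : nat -> R, is_lim_seq t 0 /\ forall N n,
    Cmod (Cminus (csum (fun k => Cmult (fourier f k) (fourier g (n - k))) (window N))
      (fourier (fun x => Cmult (f x) (g x)) n)) <= t N.
Proof.
intros cf pf hK cg hM.
destruct (fourier_inversion f K cf pf hK) as [_ [t [ht h]]].
assert (M0 : 0 <= M) by (apply Rle_trans with (2 := hM 0); apply Cmod_ge_0).
exists (fun N => M * t N); split.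
{ replace (Finite 0) with (Rbar_mult M 0) by (simpl; f_equal; ring).
  now apply is_lim_seq_scal_l. }
intros N n.
assert (cT : forall x, continuous (trig_sum (fourier f) N : R -> CC) x)
  by (intros; apply continuous_trig_sum).
assert (e : fourier (fun x => Cmult (trig_sum (fourier f) N x) (g x)) n =
  csum (fun k => Cmult (fourier f k) (fourier g (n - k))) (window N)).
{ assert (ct : forall k x,
    continuous ((fun x => Cmult (fourier f k) (Cmult (expi k x) (g x))) : R -> CC) x)
    by (intros; cont).
  replace (fun x => Cmult (trig_sum (fourier f) N x) (g x)) with
    (fun x => csum (fun k => Cmult (fourier f k) (Cmult (expi k x) (g x))) (window N)).
  - rewrite (proj1 (fourier_csum (fun k x => Cmult (fourier f k) (Cmult (expi k x) (g x)))
      (window N) n ct)).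
    f_equal; extensionality k.
    now rewrite fourier_Cmult, fourier_expi_mult by (intros; cont).
  - extensionality x; unfold trig_sum; generalize (window N) as l.
    induction l as [|k l IH]; simpl; [cring | rewrite IH; cring]. }
rewrite <- e, <- fourier_minus by (intros; cont).
apply Cmod_fourier_le; [intros; cont|]; intros x _.
replace (Cminus _ _) with (Cmult (Cminus (trig_sum (fourier f) N x) (f x)) (g x)) by cring.
rewrite Cmod_mult, Rmult_comm; apply Rmult_le_compat; auto using Cmod_ge_0.
Qed.

(* [rho(n) <= 2^sigma (rho(k) + rho(n - k))] splits the weighted convolution into two terms, each
   an [l^1]-[l^2] convolution. *)
Lemma sobolev_sum_convolution sigma f g P Q K L N l : 0 <= sigma ->
  summable_by K (fun k => Cmod (fourier f k)) -> summable_by L (fun k => Cmod (fourier g k)) ->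
  (forall l, NoDup l -> sobolev_sum sigma f l <= P ^ 2) ->
  (forall l, NoDup l -> sobolev_sum sigma g l <= Q ^ 2) -> NoDup l ->
  lsum (fun n => weight sigma n *
    Cmod (csum (fun k => Cmult (fourier f k) (fourier g (n - k))) (window N)) ^ 2) l <=
  2 * Rpower 2 sigma ^ 2 * (L ^ 2 * P ^ 2 + K ^ 2 * Q ^ 2).
Proof.
intros hs hK hL hP hQ nd.
set (rho := root_weight sigma); set (c := Rpower 2 sigma).
set (a := fun k => Cmod (fourier f k)); set (b := fun k => Cmod (fourier g k)).
assert (a0 : forall k, 0 <= a k) by (intros; apply Cmod_ge_0).
assert (b0 : forall k, 0 <= b k) by (intros; apply Cmod_ge_0).
assert (r0 : forall k, 0 <= rho k) by (intros; left; apply root_weight_pos).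
set (X := fun n => lsum (fun k => b (n - k)%Z * (rho k * a k)) (window N)).
set (Y := fun n => lsum (fun k => a k * (rho (n - k)%Z * b (n - k)%Z)) (window N)).
apply Rle_trans with (lsum (fun n => 2 * c ^ 2 * (X n ^ 2 + Y n ^ 2)) l).
- apply lsum_le; intros n _; rewrite <- root_weight_sq; fold rho.
  set (z := csum _ _).
  assert (hz : rho n * Cmod z <= c * (X n + Y n)).
  { apply Rle_trans with (rho n * lsum (fun k => a k * b (n - k)%Z) (window N)).
    - apply Rmult_le_compat_l; trivial.
      eapply Rle_trans; [apply Cmod_csum|]; right; apply lsum_ext; intros; apply Cmod_mult.
    - rewrite <- lsum_scal; unfold X, Y; rewrite <- lsum_plus, <- lsum_scal.
      apply lsum_le; intros k _.
      assert (h := root_weight_plus sigma k (n - k) hs).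
      replace (k + (n - k))%Z with n in h by ring; fold rho c in h.
      assert (ab := Rmult_le_pos _ _ (a0 k) (b0 (n - k)%Z)).
      apply (Rmult_le_compat_r _ _ _ ab) in h.
      apply Rle_trans with (1 := h); right; ring. }
  assert (p0 : 0 <= rho n * Cmod z) by (apply Rmult_le_pos; [trivial | apply Cmod_ge_0]).
  rewrite <- Rpow_mult_distr.
  apply Rle_trans with ((c * (X n + Y n)) ^ 2); [apply pow_incr; lra|].
  rewrite Rpow_mult_distr, (Rmult_comm 2), Rmult_assoc.
  apply Rmult_le_compat_l; [apply pow2_ge_0|].
  generalize (pow2_ge_0 (X n - Y n)); lra.
- rewrite lsum_scal, lsum_plus; apply Rmult_le_compat_l.
  { generalize (pow2_ge_0 c); lra. }
  apply Rplus_le_compat.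
  + apply (young_convolution_r b (fun k => rho k * a k) L (P ^ 2)); auto using NoDup_window.
    intros m ndm; apply Rle_trans with (2 := hP m ndm); right.
    apply lsum_ext; intros k _; unfold rho; now rewrite Rpow_mult_distr, root_weight_sq.
  + apply (young_convolution_l a (fun k => rho k * b k) K (Q ^ 2)); auto using NoDup_window.
    intros m ndm; apply Rle_trans with (2 := hQ m ndm); right.
    apply lsum_ext; intros k _; unfold rho; now rewrite Rpow_mult_distr, root_weight_sq.
Qed.

(** The estimate of the truncated convolutions does not depend on [N], so it passes to the limit
    over every finite set of frequencies, and [sobolev_of_sum] turns it into a bound of the norm. *)
Theorem sobolev_algebra sigma : 1 / 2 < sigma -> exists K, 0 < K /\
  forall f g, is_sobolev sigma f -> is_sobolev sigma g ->
    is_sobolev sigma (fun x => Cmult (f x) (g x)) /\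
    sobolev_norm sigma (fun x => Cmult (f x) (g x)) <=
      K * (sobolev_norm sigma f * sobolev_norm sigma g).
Proof.
intros hs.
destruct (sobolev_summable sigma hs) as [K [hK hsum]].
destruct (sobolev_sup sigma hs) as [M [hM hsup]].
destruct (sobolev_of_sum sigma hs) as [J [hJ hof]].
set (c := Rpower 2 sigma); assert (hc : 0 < c) by apply exp_pos.
(* With [l^1] norms at most [K P] and [K Q], the convolution bound is [2 c^2 (K^2 P^2 Q^2 + K^2 P^2
   Q^2) = (2 c K P Q)^2]. *)
exists (J * (2 * c * K)); split; [repeat apply Rmult_lt_0_compat; lra|].
intros f g hf hg.
set (P := sobolev_norm sigma f); set (Q := sobolev_norm sigma g).
assert (P0 : 0 <= P) by apply sobolev_norm_ge0.
assert (Q0 : 0 <= Q) by apply sobolev_norm_ge0.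
replace (J * (2 * c * K) * (P * Q)) with (J * (2 * c * K * (P * Q))) by ring.
destruct (fourier_product f g (K * P) (M * Q)) as [t [ht h]];
  try apply hf; try apply hg; try (now apply hsum); try now apply hsup.
apply hof.
- intros x; apply continuous_Cmult; [apply hf | apply hg].
- intros x; destruct hf as [_ [pf _]], hg as [_ [pg _]]; now rewrite pf, pg.
- repeat apply Rmult_le_pos; lra.
- intros l nd.
  apply (is_lim_seq_upper (fun N => lsum (fun n => weight sigma n *
    Cmod (csum (fun k => Cmult (fourier f k) (fourier g (n - k))) (window N)) ^ 2) l)).
  + intros N; eapply Rle_trans.
    * apply (sobolev_sum_convolution sigma f g P Q (K * P) (K * Q)); trivial; try lra;
        intros m ndm; try (now apply hsum); now apply sobolev_sum_le.
    * right; fold c; ring.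
  + apply (is_lim_seq_lsum (fun N n => weight sigma n *
      Cmod (csum (fun k => Cmult (fourier f k) (fourier g (n - k))) (window N)) ^ 2)).
    intros n.
    apply (is_lim_seq_scal_l _ (weight sigma n) (Cmod _ ^ 2)).
    assert (hl := is_lim_seq_Cmod _ _ t ht (fun N => h N n)).
    simpl; rewrite Rmult_1_r.
    apply (is_lim_seq_ext (fun N =>
      Cmod (csum (fun k => Cmult (fourier f k) (fourier g (n - k))) (window N)) *
      Cmod (csum (fun k => Cmult (fourier f k) (fourier g (n - k))) (window N))));
      [intros; ring|].
    apply is_lim_seq_mult'; exact hl.
Qed.

(** * Real-valued functions: products, primitives and derivatives *)

Definition Hs (sigma : R) (u : R -> R) : Prop := is_sobolev sigma (toC u).
Definition Hn (sigma : R) (u : R -> R) : R := sobolev_norm sigma (toC u).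

Lemma Hs_continuous sigma u : Hs sigma u -> forall x, continuous u x.
Proof. intros [h _] x; now apply continuous_toC_inv. Qed.

Lemma Hs_periodic sigma u : Hs sigma u -> forall x, u (x + 1) = u x.
Proof. intros [_ [h _]] x; apply RtoC_inj, h. Qed.

Lemma Hn_ge0 sigma u : 0 <= Hn sigma u.
Proof. apply sobolev_norm_ge0. Qed.

Lemma Hs_plus sigma u v : Hs sigma u -> Hs sigma v ->
  Hs sigma (fun x => u x + v x) /\ Hn sigma (fun x => u x + v x) <= Hn sigma u + Hn sigma v.
Proof.
intros hu hv; unfold Hs, Hn.
rewrite (toC_plus u v : toC (fun x => u x + v x) = _).
split; [exact (is_sobolev_plus sigma _ _ hu hv) | exact (sobolev_norm_plus sigma _ _ hu hv)].
Qed.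

Lemma Hs_scal sigma a u : Hs sigma u ->
  Hs sigma (fun x => a * u x) /\ Hn sigma (fun x => a * u x) = Rabs a * Hn sigma u.
Proof.
intros hu; unfold Hs, Hn; rewrite (toC_scal a u : toC (fun x => a * u x) = _).
split; [exact (is_sobolev_scal sigma a _ hu) | exact (sobolev_norm_scal sigma _ a hu)].
Qed.

Lemma Hs_minus sigma u v : Hs sigma u -> Hs sigma v ->
  Hs sigma (fun x => u x - v x) /\ Hn sigma (fun x => u x - v x) <= Hn sigma u + Hn sigma v.
Proof.
intros hu hv; destruct (Hs_scal sigma (-1) v hv) as [h1 h2].
destruct (Hs_plus sigma u _ hu h1) as [h3 h4].
replace (fun x => u x - v x) with (fun x => u x + -1 * v x) by (extensionality x; ring).
rewrite h2, Rabs_m1, Rmult_1_l in h4; exact (conj h3 h4).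
Qed.

Lemma toC_mult u v : toC (fun x => u x * v x) = fun x => Cmult (toC u x) (toC v x).
Proof. extensionality x; apply RtoC_mult. Qed.

Lemma Hs_mult sigma : 1 / 2 < sigma -> exists K, 0 < K /\
  forall u v, Hs sigma u -> Hs sigma v ->
    Hs sigma (fun x => u x * v x) /\ Hn sigma (fun x => u x * v x) <= K * (Hn sigma u * Hn sigma v).
Proof.
intros hs; destruct (sobolev_algebra sigma hs) as [K [hK h]]; exists K; split; trivial.
intros u v hu hv; unfold Hs, Hn; rewrite toC_mult; exact (h _ _ hu hv).
Qed.

Lemma Hs_sup sigma : 1 / 2 < sigma -> exists K, 0 < K /\
  forall u, Hs sigma u -> forall x, Rabs (u x) <= K * Hn sigma u.
Proof.
intros hs; destruct (sobolev_sup sigma hs) as [K [hK h]]; exists K; split; trivial.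
intros u hu x; rewrite <- Cmod_R; exact (h _ hu x).
Qed.

Lemma is_sobolev_le sigma tau f : sigma <= tau -> is_sobolev tau f ->
  is_sobolev sigma f /\ sobolev_norm sigma f <= sobolev_norm tau f.
Proof.
intros hle [cf [pf sf]].
assert (h : forall n, 0 <= sobolev_term sigma f n <= sobolev_term tau f n).
{ intros n; split; [apply sobolev_term_ge0|]; apply Rmult_le_compat_r.
  - generalize (pow2_ge_0 (Cmod (fourier f (Z.of_nat (S n)))))
      (pow2_ge_0 (Cmod (fourier f (- Z.of_nat (S n))))); lra.
  - destruct n as [|n].
    + right; unfold Rpower; simpl INR; now rewrite ln_1, !Rmult_0_r.
    + apply Rle_Rpower; [|lra]; rewrite S_INR; generalize (pos_INR (S n)); lra. }
split.
- repeat split; trivial; apply (ex_series_le (V := R_CompleteNormedModule)) with (2 := sf).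
  intros n; change (norm ?x) with (Rabs x); rewrite Rabs_pos_eq; apply h.
- apply sqrt_le_1_alt, Rplus_le_compat_l; now apply Series_le.
Qed.

Lemma Hs_le sigma tau u : sigma <= tau -> Hs tau u ->
  Hs sigma u /\ Hn sigma u <= Hn tau u.
Proof. apply is_sobolev_le. Qed.

(** Bessel's inequality, as the weights of [H^0] are all [1]. It starts the gain of regularity from
    the supremum norm; the factor [2] counts the [L^2] part and the series. *)
Lemma Hs_continuous_bounded u M : (forall x, continuous u x) -> (forall x, u (x + 1) = u x) ->
  (forall x, Rabs (u x) <= M) -> Hs 0 u /\ Hn 0 u <= 2 * M.
Proof.
intros cu pu hM; replace (2 * M) with (M + M) by ring.
assert (M0 : 0 <= M) by (apply Rle_trans with (2 := hM 0); apply Rabs_pos).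
assert (cC : forall x, continuous (toC u : R -> CC) x) by (intros; now apply continuous_toC).
assert (hC : forall x, Cmod (toC u x) <= M) by (intros x; unfold toC; now rewrite Cmod_R).
apply sobolev_intro; trivial.
- intros x; unfold toC; now rewrite pu.
- intros l nd; apply Rle_trans with (2 := sqnorm_L2_le _ M cC hC).
  apply Rle_trans with (2 := bessel _ l cC nd); right; apply lsum_ext; intros n _.
  unfold weight; rewrite Rmult_0_r, Rpower_O, Rmult_1_l; trivial.
  generalize (zmod_ge1 n); lra.
Qed.

Lemma Rpower_shift x sigma : 0 < x -> Rpower x (2 * (sigma + 1)) = Rpower x (2 * sigma) * x ^ 2.
Proof.
intros hx; rewrite <- Rpower_pow, <- Rpower_plus by trivial; f_equal; simpl; ring.
Qed.

Lemma Cmod_imag (t : R) : Cmod (0, t) = Rabs t.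
Proof.
unfold Cmod; simpl; rewrite <- sqrt_Rsqr_abs; f_equal; unfold Rsqr; ring.
Qed.

(** The coefficients satisfy [|v'^(n)| = 2 PI |n| |v^(n)|], and [2 PI >= 1], so the weighted series
    of [v] at [sigma + 1] is dominated term by term by that of [v'] at [sigma]. The mean, which [v']
    does not see, is controlled by the supremum bound [M]. *)
Lemma Hs_primitive sigma (v v' : R -> R) M : (forall x, is_derive v x (v' x)) ->
  (forall x, v (x + 1) = v x) -> (forall x, Rabs (v x) <= M) -> Hs sigma v' ->
  Hs (sigma + 1) v /\ Hn (sigma + 1) v <= M + Hn sigma v'.
Proof.
intros hd pv hM hv'.
assert (cv : forall x, continuous v x) by (intros x; exact (is_derive_continuous _ _ _ (hd x))).
assert (M0 : 0 <= M) by (apply Rle_trans with (2 := hM 0); apply Rabs_pos).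
assert (hf : forall n, fourier (toC v') n = Cmult (0, 2 * PI * IZR n) (fourier (toC v) n)).
{ intros n; apply fourier_derive; trivial; apply (Hs_continuous sigma _ hv'). }
assert (hpi : 1 <= (2 * PI) ^ 2) by (generalize PI2_1; nra).
assert (ht : forall n, 0 <= sobolev_term (sigma + 1) (toC v) n <= sobolev_term sigma (toC v') n).
{ intros n; split; [apply sobolev_term_ge0|]; unfold sobolev_term.
  rewrite !hf, !Cmod_mult, !Cmod_imag, opp_IZR, <- INR_IZR_INZ.
  replace (2 * PI * - INR (S n)) with (- (2 * PI * INR (S n))) by ring.
  rewrite Rabs_Ropp, !Rpow_mult_distr, pow2_abs, Rpow_mult_distr.
  rewrite Rpower_shift by (apply (lt_INR 0); lia).
  set (A := Cmod (fourier (toC v) (Z.of_nat (S n))) ^ 2).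
  set (B := Cmod (fourier (toC v) (- Z.of_nat (S n))) ^ 2).
  assert (hA : 0 <= A) by apply pow2_ge_0; assert (hB : 0 <= B) by apply pow2_ge_0.
  set (W := Rpower _ _); assert (hW : 0 < W) by apply exp_pos.
  set (X := W * INR (S n) ^ 2 * (A + B)).
  assert (hX : 0 <= X).
  { repeat apply Rmult_le_pos; try lra; apply pos_INR || (simpl; lra). }
  apply Rle_trans with ((2 * PI) ^ 2 * X); [nra | right; unfold X; ring]. }
destruct hv' as [cv' [pv' sv']].
assert (ex : ex_series (sobolev_term (sigma + 1) (toC v))).
{ apply (ex_series_le (V := R_CompleteNormedModule)) with (2 := sv').
  intros n; change (norm ?x) with (Rabs x); rewrite Rabs_pos_eq; apply ht. }
assert (hv : Hs (sigma + 1) v).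
{ repeat split; trivial; intros; [now apply continuous_toC | unfold toC; now rewrite pv]. }
split; [exact hv|].
assert (n0 := Hn_ge0 sigma v').
unfold Hn at 1, sobolev_norm; rewrite <- (sqrt_pow2 (M + Hn sigma v')) by lra.
apply sqrt_le_1_alt.
assert (h1 : sqnorm_L2 (toC v) <= M ^ 2).
{ apply sqnorm_L2_le; [intros; now apply continuous_toC|].
  intros x; unfold toC; now rewrite Cmod_R. }
assert (h2 := Series_le _ _ ht sv').
assert (h3 : Hn sigma v' ^ 2 = sqnorm_L2 (toC v') + Series (sobolev_term sigma (toC v')))
  by (apply sobolev_norm_sq; now repeat split).
assert (h4 := sqnorm_L2_ge0 (toC v') cv').
nra.
Qed.

Lemma fourier_toC_opp u n : (forall x, continuous u x) ->
  fourier (toC u) (- n) = Cconj (fourier (toC u) n).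
Proof.
intros cu.
assert (h := fourier_conj (toC u) (- n)); rewrite Z.opp_involutive in h.
rewrite <- h by (intros; now apply continuous_toC); f_equal.
extensionality x; unfold toC, Cconj, RtoC; simpl; f_equal; ring.
Qed.

(** The derivative has to be constructed: the series with coefficients [2 PI i n u^(n)] converges
    absolutely because [sigma > 1 / 2], and a primitive [V] of its sum has the same coefficients as
    [u] at all [n <> 0]. By uniqueness [u] is [V] plus a constant, hence differentiable. *)
Lemma Hs_derive sigma : 1 / 2 < sigma -> exists K, 0 < K /\
  forall u, Hs (sigma + 1) u ->
    (forall x, is_derive u x (Derive u x)) /\ Hs sigma (Derive u) /\
    Hn sigma (Derive u) <= K * Hn (sigma + 1) u.
Proof.
intros hs.
destruct (summable_of_weighted sigma hs) as [K1 [hK1 hsum]].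
destruct (sobolev_of_sum sigma hs) as [K2 [hK2 hof]].
generalize PI_RGT_0; intros hpi.
exists (K2 * (2 * PI)); split; [apply Rmult_lt_0_compat; lra|].
intros u hu.
assert (cu := Hs_continuous _ _ hu); assert (pu := Hs_periodic _ _ hu).
set (c := fun n => Cmult (0, 2 * PI * IZR n) (fourier (toC u) n)).
set (B := 2 * PI * Hn (sigma + 1) u).
assert (B0 : 0 <= B) by (apply Rmult_le_pos; [lra | apply Hn_ge0]).
assert (hB : forall l, NoDup l -> lsum (fun n => weight sigma n * Cmod (c n) ^ 2) l <= B ^ 2).
{ intros l nd; unfold B; rewrite Rpow_mult_distr.
  apply Rle_trans with ((2 * PI) ^ 2 * sobolev_sum (sigma + 1) (toC u) l).
  - unfold sobolev_sum; rewrite <- lsum_scal; apply lsum_le; intros n _.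
    unfold c; rewrite Cmod_mult, Cmod_imag, Rpow_mult_distr, pow2_abs, Rpow_mult_distr.
    unfold weight; rewrite Rpower_shift by (generalize (zmod_ge1 n); lra).
    assert (hz : IZR n ^ 2 <= zmod n ^ 2).
    { rewrite <- pow2_abs, <- abs_IZR; apply pow_incr; split.
      - apply (IZR_le 0); lia.
      - apply IZR_le; lia. }
    set (W := Rpower _ _); assert (hW : 0 < W) by apply exp_pos.
    set (A := Cmod _ ^ 2); assert (hA : 0 <= A) by apply pow2_ge_0.
    replace (W * _) with ((2 * PI) ^ 2 * (W * A * IZR n ^ 2)) by ring.
    apply Rmult_le_compat_l; [apply pow2_ge_0|].
    replace (W * zmod n ^ 2 * A) with (W * A * zmod n ^ 2) by ring.
    apply Rmult_le_compat_l; trivial; apply Rmult_le_pos; lra.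
  - apply Rmult_le_compat_l; [apply pow2_ge_0 | now apply sobolev_sum_le]. }
destruct (fourier_series_synthesis c (K1 * B)) as [s [_ [cs [ps [es _]]]]].
{ apply (hsum (fun n => Cmod (c n))); trivial; intros; apply Cmod_ge_0. }
(* The sum is real because [c (- n)] is the conjugate of [c n]; taking the real part makes this
   visible and does not change the coefficients. *)
set (v := fun x => Re (s x)).
assert (cv : forall x, continuous v x) by (intros; unfold v; cont).
assert (pv : forall x, v (x + 1) = v x) by (intros; unfold v; now rewrite ps).
assert (fv : forall n, fourier (toC v) n = c n).
{ intros n; unfold v; rewrite fourier_Re, !es by trivial.
  unfold c; rewrite fourier_toC_opp, opp_IZR by trivial.
  destruct (fourier (toC u) n) as [a b].
  unfold Cmult, Cplus, Cconj, RtoC; simpl; f_equal; field. }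
set (V := fun x => RInt v 0 x).
assert (dV : forall x, is_derive V x (v x)) by (intros; now apply is_derive_primitive).
assert (pV : forall x, V (x + 1) = V x).
{ apply primitive_periodic; trivial.
  apply RtoC_inj; rewrite <- fourier_0_toC, fv by trivial; unfold c; rewrite Rmult_0_r.
  apply Cmult_0_l. }
assert (cV : forall x, continuous V x) by (intros x; exact (is_derive_continuous _ _ _ (dV x))).
assert (fV : forall n, n <> 0%Z -> fourier (toC V) n = fourier (toC u) n).
{ intros n hn; assert (e := fourier_derive V v n dV cv pV); rewrite fv in e; unfold c in e.
  assert (nz : (0, 2 * PI * IZR n) <> RtoC 0).
  { intros e'; injection e'; intros e''; apply Rmult_integral in e''.
    destruct e'' as [e''|e'']; [lra | now apply hn, eq_IZR]. }
  transitivity (Cmult (Cinv (0, 2 * PI * IZR n))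
    (Cmult (0, 2 * PI * IZR n) (fourier (toC V) n))).
  - rewrite Cmult_assoc, Cinv_l by trivial; symmetry; apply Cmult_1_l.
  - rewrite <- e, Cmult_assoc, Cinv_l by trivial; apply Cmult_1_l. }
(* The coefficient at [0] is the only one that [u] and [V] may not share. *)
set (m := RInt u 0 1 - RInt V 0 1).
assert (eu : forall x, u x = V x + m).
{ intros x.
  assert (h : u x - V x - m = 0); [|lra].
  apply (fourier_unique0 (fun x => u x - V x - m)).
  - intros; cont.
  - intros y; now rewrite pu, pV.
  - intros n.
    replace (toC (fun x => u x - V x - m)) with
      (fun x => Cminus (Cminus (toC u x) (toC V x)) ((fun _ => RtoC m) x))
      by (extensionality y; unfold toC; now rewrite !RtoC_minus).
    rewrite (fourier_minus (fun x => Cminus (toC u x) (toC V x)) (fun _ => RtoC m)),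
      fourier_minus, fourier_const.
    + destruct (Z.eq_dec n 0) as [->|hn].
      * rewrite !fourier_0_toC by trivial; unfold m; rewrite RtoC_minus; cring.
      * rewrite fV by trivial; cring.
    + intros; now apply continuous_toC.
    + intros; now apply continuous_toC.
    + intros; apply continuous_Cminus; now apply continuous_toC.
    + intros; cont. }
assert (du : forall x, is_derive u x (v x)).
{ intros x; apply (is_derive_ext (fun x => V x + m)); [intros; symmetry; apply eu|].
  apply (is_derive_eq _ _ (v x + 0)); [|rring].
  apply (is_derive_Rplus V (fun _ => m)); [apply dV | apply (is_derive_const (V := R_NormedModule))]. }
assert (ev : Derive u = v) by (extensionality x; apply is_derive_unique, du).
rewrite ev; split; [exact du|].
replace (K2 * (2 * PI) * Hn (sigma + 1) u) with (K2 * B) by (unfold B; ring).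
apply hof; trivial.
- intros; now apply continuous_toC.
- intros x; unfold toC; now rewrite pv.
- intros l nd; apply Rle_trans with (2 := hB l nd); right.
  apply lsum_ext; intros n _; now rewrite fv.
Qed.

(** * Superposition operators *)

Section Superposition.
Variable r : R.
Hypothesis hr : 3 / 2 < r.

(** Capped at [r - 1], so that the gain of one derivative from a capped level ends exactly at [r],
    also when [r] is not an integer. *)
Definition level_exponent (n : nat) : R := Rmin (r - 1) (INR n).

(** The regularities [0, 1, 2, ..., r - 1]; at level [0] the norm is the supremum norm, for which
    products are bounded, unlike for the norm of [H^0]. *)
Definition level (n : nat) (u : R -> R) (B : R) : Prop :=
  match n with
  | O => (forall x, continuous u x) /\ (forall x, u (x + 1) = u x) /\ forall x, Rabs (u x) <= B
  | S _ => Hs (level_exponent n) u /\ Hn (level_exponent n) u <= B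
  end.

Lemma level_exponent_S n : 1 / 2 < level_exponent (S n).
Proof.
unfold level_exponent; rewrite S_INR; generalize (pos_INR n); intros.
apply Rmin_glb_lt; lra.
Qed.

Lemma level_exponent_0 : level_exponent 0 = 0.
Proof. unfold level_exponent; simpl; apply Rmin_right; lra. Qed.

Lemma level_weaken n u B B' : B <= B' -> level n u B -> level n u B'.
Proof.
intros h; destruct n as [|n]; simpl.
- intros [c [p b]]; repeat split; trivial; intros x; specialize (b x); lra.
- intros [hu hb]; split; trivial; lra.
Qed.

Lemma level_plus n u v B B' : level n u B -> level n v B' ->
  level n (fun x => u x + v x) (B + B').
Proof.
destruct n as [|n]; simpl.
- intros [c [p b]] [c' [p' b']]; split; [|split]; intros x; [now cont | now rewrite p, p'|].
  generalize (Rabs_triang (u x) (v x)) (b x) (b' x); lra.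
- intros [hu hb] [hv hb']; destruct (Hs_plus _ _ _ hu hv); split; trivial; lra.
Qed.

Lemma level_mult n : exists K, 0 < K /\ forall u v B B', level n u B -> level n v B' ->
  level n (fun x => u x * v x) (K * (B * B')).
Proof.
destruct n as [|n]; simpl.
- exists 1; split; [lra|]; intros u v B B' [c [p b]] [c' [p' b']].
  split; [|split]; intros x; [now cont | now rewrite p, p'|].
  rewrite Rabs_mult, Rmult_1_l; apply Rmult_le_compat; auto using Rabs_pos.
- destruct (Hs_mult _ (level_exponent_S n)) as [K [hK h]]; exists K; split; trivial.
  intros u v B B' [hu hb] [hv hb']; destruct (h u v hu hv) as [h1 h2]; split; trivial.
  apply Rle_trans with (1 := h2), Rmult_le_compat_l; [lra|].
  apply Rmult_le_compat; auto using Hn_ge0.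
Qed.

Lemma level_of_Hs n : exists K, 0 < K /\ forall u, Hs (r - 1) u -> level n u (K * Hn (r - 1) u).
Proof.
destruct n as [|n]; simpl.
- destruct (Hs_sup (r - 1)) as [K [hK h]]; [lra|]; exists K; split; trivial.
  intros u hu; split; [|split]; [now apply (Hs_continuous (r - 1)) | now apply (Hs_periodic (r - 1))|].
  now apply h.
- exists 1; split; [lra|]; intros u hu; rewrite Rmult_1_l.
  apply Hs_le; trivial; apply Rmin_l.
Qed.

(** The factor [3] is [1] for the supremum of [u] and [2] for the passage from the supremum norm to
    [H^0] at level [0]. *)
Lemma level_primitive n u u' B : (forall x, is_derive u x (u' x)) ->
  (forall x, u (x + 1) = u x) -> (forall x, Rabs (u x) <= B) -> level n u' B ->
  Hs (level_exponent n + 1) u /\ Hn (level_exponent n + 1) u <= 3 * B.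
Proof.
intros hd hp hB hl.
assert (B0 : 0 <= B) by (apply Rle_trans with (2 := hB 0); apply Rabs_pos).
assert (h : Hs (level_exponent n) u' /\ Hn (level_exponent n) u' <= 2 * B).
{ destruct n as [|n]; simpl in hl.
  - rewrite level_exponent_0; now apply Hs_continuous_bounded.
  - destruct hl; split; trivial; lra. }
destruct h as [h1 h2].
destruct (Hs_primitive _ u u' B hd hp hB h1) as [h3 h4]; split; trivial; lra.
Qed.

Lemma Hs_differentiable : exists K, 0 < K /\
  forall u, Hs r u ->
    (forall x, is_derive u x (Derive u x)) /\ Hs (r - 1) (Derive u) /\
    Hn (r - 1) (Derive u) <= K * Hn r u.
Proof.
destruct (Hs_derive (r - 1)) as [K [hK h]]; [lra|]; exists K; split; trivial.
now replace (r - 1 + 1) with r in h by ring.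
Qed.

Variables (F : nat -> R -> R) (a b : R).
Hypothesis hF : forall j x, a <= x <= b -> is_derive (F j) x (F (S j) x).

Lemma family_bounded j : exists C, 0 <= C /\ forall x, a <= x <= b -> Rabs (F j x) <= C.
Proof.
destruct (Rle_dec a b) as [hab|hab].
- destruct (continuity_ab_maj (fun x => Rabs (F j x)) a b hab) as [m [hm _]].
  + intros c hc; apply continuity_pt_filterlim.
    apply (continuous_comp (F j) Rabs); [|apply continuous_Rabs].
    exact (is_derive_continuous _ _ _ (hF j c hc)).
  + exists (Rabs (F j m)); split; [apply Rabs_pos | exact hm].
- exists 0; split; [lra|]; intros; lra.
Qed.

Lemma family_increment j C x y : (forall z, a <= z <= b -> Rabs (F (S j) z) <= C) ->
  a <= x <= b -> a <= y <= b -> exists z, Rmin y x <= z <= Rmax y x /\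
    F j x - F j y = F (S j) z * (x - y).
Proof.
intros hC hx hy.
assert (hz : forall z, Rmin y x <= z <= Rmax y x -> a <= z <= b).
{ intros z [h1 h2]; split; [apply Rle_trans with (2 := h1); apply Rmin_glb; lra
    | apply Rle_trans with (1 := h2); apply Rmax_lub; lra]. }
destruct (MVT_gen (F j) y x (F (S j))) as [z [h e]].
- intros z h; apply hF, hz; lra.
- intros z h; apply continuity_pt_filterlim.
  exact (is_derive_continuous _ _ _ (hF j z (hz z h))).
- now exists z.
Qed.

Lemma family_lipschitz j C x y : (forall z, a <= z <= b -> Rabs (F (S j) z) <= C) ->
  a <= x <= b -> a <= y <= b -> Rabs (F j x - F j y) <= C * Rabs (x - y).
Proof.
intros hC hx hy; destruct (family_increment j C x y hC hx hy) as [z [[h1 h2] e]].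
rewrite e, Rabs_mult; apply Rmult_le_compat_r; [apply Rabs_pos | apply hC].
split; [apply Rle_trans with (2 := h1); apply Rmin_glb; lra
    | apply Rle_trans with (1 := h2); apply Rmax_lub; lra].
Qed.

Lemma family_taylor j C x y : (forall z, a <= z <= b -> Rabs (F (S (S j)) z) <= C) ->
  a <= x <= b -> a <= y <= b ->
  Rabs (F j x - F j y - F (S j) y * (x - y)) <= C * Rabs (x - y) ^ 2.
Proof.
intros hC hx hy.
destruct (family_bounded (S j)) as [C1 [_ hC1]].
destruct (family_increment j C1 x y hC1 hx hy) as [z [[h1 h2] e]].
assert (hz : a <= z <= b).
{ split; [apply Rle_trans with (2 := h1); apply Rmin_glb; lra
    | apply Rle_trans with (1 := h2); apply Rmax_lub; lra]. }
rewrite e, <- Rmult_minus_distr_r, Rabs_mult.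
assert (h := family_lipschitz (S j) C z y hC hz hy).
assert (hzy : Rabs (z - y) <= Rabs (x - y)).
{ revert h1 h2; unfold Rmin, Rmax; destruct (Rle_dec y x); intros;
    unfold Rabs; destruct (Rcase_abs _), (Rcase_abs _); lra. }
assert (C0 : 0 <= C) by (apply Rle_trans with (2 := hC y hy); apply Rabs_pos).
replace (C * Rabs (x - y) ^ 2) with (C * Rabs (x - y) * Rabs (x - y)) by ring.
apply Rmult_le_compat_r; [apply Rabs_pos|].
apply Rle_trans with (1 := h); now apply Rmult_le_compat_l.
Qed.

Variable M : R.

Definition admissible (f : R -> R) : Prop :=
  Hs r f /\ Hn r f <= M /\ forall x, a <= f x <= b.

(** [P u B] reads as a norm bound of [u] by [B]. Values, increments and first-order Taylor
    remainders are bounded together and for all [j], because the derivatives of these functions for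
    [F j] involve such functions for [F (S j)]. The constant is uniform over admissible [f] and
    [g]. *)
Definition superposition_bounds (P : (R -> R) -> R -> Prop) : Prop :=
  forall j, exists C, 0 <= C /\ forall f g, admissible f -> admissible g ->
    let d := Hn r (fun x => f x - g x) in
    P (fun x => F j (f x)) C /\
    P (fun x => F j (f x) - F j (g x)) (C * d) /\
    P (fun x => F j (f x) - F j (g x) - F (S j) (g x) * (f x - g x)) (C * d ^ 2).

Lemma superposition_bounds_weaken (P Q : (R -> R) -> R -> Prop) :
  (forall u B, P u B -> Q u B) -> superposition_bounds P -> superposition_bounds Q.
Proof.
intros hPQ h j; destruct (h j) as [C [hC hP]]; exists C; split; trivial.
intros f g hf hg d; destruct (hP f g hf hg) as [h1 [h2 h3]]; auto.
Qed.

Lemma superposition_continuous j f x : admissible f -> continuous (fun x => F j (f x)) x.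
Proof.
intros [hf [_ hab]]; apply (continuous_comp f (F j)).
- exact (Hs_continuous _ _ hf x).
- exact (is_derive_continuous _ _ _ (hF j (f x) (hab x))).
Qed.

(** Pointwise mean value and Taylor estimates on [[a, b]], with [|f x - g x| <= K d] from the
    embedding of [H^r] into bounded functions; whence the factors [K] and [K^2] in the constant. *)
Lemma superposition_level_0 : superposition_bounds (level 0).
Proof.
intros j.
destruct (family_bounded j) as [C0 [p0 b0]], (family_bounded (S j)) as [C1 [p1 b1]],
  (family_bounded (S (S j))) as [C2 [p2 b2]].
destruct (Hs_sup r) as [K [hK hsup]]; [lra|].
assert (q1 : 0 <= C1 * K) by (apply Rmult_le_pos; lra).
assert (q2 : 0 <= C2 * K ^ 2) by (apply Rmult_le_pos; [lra | apply pow2_ge_0]).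
exists (C0 + C1 * K + C2 * K ^ 2); split; [lra|].
intros f g hf hg d.
assert (cf := fun x => superposition_continuous j f x hf).
assert (cg := fun x => superposition_continuous j g x hg).
assert (cg1 := fun x => superposition_continuous (S j) g x hg).
destruct hf as [hf [_ rf]], hg as [hg [_ rg]].
assert (d0 : 0 <= d) by apply Hn_ge0.
assert (pf := Hs_periodic _ _ hf); assert (pg := Hs_periodic _ _ hg).
destruct (Hs_minus r f g hf hg) as [hd _].
assert (hx : forall x, Rabs (f x - g x) <= K * d) by (intros; now apply (hsup _ hd)).
assert (cof := Hs_continuous _ _ hf); assert (cog := Hs_continuous _ _ hg).
assert (d2 : 0 <= d ^ 2) by apply pow2_ge_0.
split; [|split]; (split; [intros; now cont | split; intros x; [now rewrite ?pf, ?pg|]]).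
- generalize (b0 (f x) (rf x)); lra.
- apply Rle_trans with (C1 * (K * d)); [|nra].
  apply Rle_trans with (1 := family_lipschitz j C1 (f x) (g x) b1 (rf x) (rg x)).
  now apply Rmult_le_compat_l.
- apply Rle_trans with (C2 * (K * d) ^ 2); [|rewrite Rpow_mult_distr; nra].
  apply Rle_trans with (1 := family_taylor j C2 (f x) (g x) b2 (rf x) (rg x)).
  apply Rmult_le_compat_l; trivial; apply pow_incr; split; [apply Rabs_pos | trivial].
Qed.

(* The derivatives of the three functions are polynomials in the same functions for [F (S j)] and
   in the derivatives of [g] and of [f - g]. *)
Lemma superposition_level_step n : superposition_bounds (level n) ->
  superposition_bounds (fun u B =>
    Hs (level_exponent n + 1) u /\ Hn (level_exponent n + 1) u <= B).
Proof.
intros hn j.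
destruct (superposition_level_0 j) as [C0 [p0 hC0]].
destruct (hn (S j)) as [C1 [p1 hC1]].
destruct (level_mult n) as [K [hK hmul]], (level_of_Hs n) as [L [hL hlev]].
destruct Hs_differentiable as [N [hN hder]].
(* No function is admissible when [M] is negative; [M'] keeps the constants nonnegative in that case
   too. *)
set (M' := Rmax M 0); assert (hM' : 0 <= M') by apply Rmax_r.
set (E := L * N); assert (hE : 0 <= E) by (apply Rmult_le_pos; lra).
assert (q1 : 0 <= K * (C1 * (E * M'))) by (repeat apply Rmult_le_pos; lra).
assert (q2 : 0 <= K * (C1 * E)) by (repeat apply Rmult_le_pos; lra).
(* [C0] bounds the suprema; the two products bound the derivatives, whose factors are a derivative
   of [f] or [g], of size [E * M'], or that of [f - g], of size [E * d]. *)
set (C := C0 + K * (C1 * (E * M')) + K * (C1 * E)).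
exists (3 * C); split; [unfold C; lra|].
intros f g hf hg; destruct (hC0 f g hf hg) as [a1 [a2 a3]].
destruct (hC1 f g hf hg) as [b1 [b2 b3]].
destruct (hC1 g g hg hg) as [b4 _].
destruct hf as [hf [mf rf]], hg as [hg [mg rg]].
set (d := Hn r (fun x => f x - g x)) in *; intros d'; subst d'.
assert (d0 : 0 <= d) by apply Hn_ge0.
assert (d2 : 0 <= d ^ 2) by apply pow2_ge_0.
destruct (Hs_minus r f g hf hg) as [hd _].
destruct (hder f hf) as [df [hf' nf']], (hder g hg) as [dg [hg' ng']].
destruct (hder _ hd) as [dd [hd' nd']]; fold d in nd'.
set (f' := Derive f) in *; set (g' := Derive g) in *; set (e' := Derive (fun x => f x - g x)) in *.
assert (lev_of : forall u B, Hs (r - 1) u -> Hn (r - 1) u <= N * B -> level n u (E * B)).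
{ intros u B hu hb; apply (level_weaken n u (L * Hn (r - 1) u)); [|now apply hlev].
  unfold E; rewrite Rmult_assoc; apply Rmult_le_compat_l; lra. }
assert (lf : level n f' (E * M')).
{ apply lev_of; trivial; apply Rle_trans with (1 := nf'), Rmult_le_compat_l; [lra|].
  apply Rle_trans with (1 := mf), Rmax_l. }
assert (lg : level n g' (E * M')).
{ apply lev_of; trivial; apply Rle_trans with (1 := ng'), Rmult_le_compat_l; [lra|].
  apply Rle_trans with (1 := mg), Rmax_l. }
assert (ld : level n e' (E * d)) by now apply lev_of.
assert (ef : forall x, f' x = g' x + e' x).
{ intros x; assert (h : e' x = f' x - g' x); [|rewrite h; ring].
  apply is_derive_unique; now apply is_derive_Rminus. }
assert (dF : forall i h h' x, (forall x, a <= h x <= b) -> is_derive h x h' ->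
  is_derive (fun x => F i (h x)) x (F (S i) (h x) * h')).
{ intros i h h' x rh dh; apply (is_derive_Rcomp (F i) h); auto. }
split; [|split].
- apply (level_primitive n _ (fun x => F (S j) (f x) * f' x)).
  + intros x; now apply dF.
  + apply a1.
  + intros x; destruct a1 as [_ [_ h]]; specialize (h x); unfold C; lra.
  + apply (level_weaken n _ (K * (C1 * (E * M')))); [unfold C; lra | now apply hmul].
- rewrite Rmult_assoc.
  apply (level_primitive n _ (fun x =>
    (F (S j) (f x) - F (S j) (g x)) * f' x + F (S j) (g x) * e' x)).
  + intros x; apply (is_derive_eq _ _ (F (S j) (f x) * f' x - F (S j) (g x) * g' x));
      [|rewrite ef; rring].
    apply (is_derive_Rminus (fun x => F j (f x)) (fun x => F j (g x))); now apply dF.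
  + apply a2.
  + intros x; destruct a2 as [_ [_ h]]; apply Rle_trans with (1 := h x).
    apply Rmult_le_compat_r; trivial; unfold C; lra.
  + apply (level_weaken n _ (K * ((C1 * d) * (E * M')) + K * (C1 * (E * d)))).
    * unfold C; generalize (Rmult_le_pos _ _ p0 d0); lra.
    * apply level_plus; apply hmul; trivial.
- rewrite Rmult_assoc.
  apply (level_primitive n _ (fun x =>
    (F (S j) (f x) - F (S j) (g x) - F (S (S j)) (g x) * (f x - g x)) * g' x +
    (F (S j) (f x) - F (S j) (g x)) * e' x)).
  + intros x; apply (is_derive_eq _ _ (F (S j) (f x) * f' x - F (S j) (g x) * g' x -
      (F (S (S j)) (g x) * g' x * (f x - g x) + F (S j) (g x) * (f' x - g' x))));
      [|rewrite ef; rring].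
    apply (is_derive_Rminus (fun x => F j (f x) - F j (g x))
      (fun x => F (S j) (g x) * (f x - g x))).
    * apply (is_derive_Rminus (fun x => F j (f x)) (fun x => F j (g x))); now apply dF.
    * apply (is_derive_Rmult (fun x => F (S j) (g x)) (fun x => f x - g x)); [now apply dF|].
      now apply is_derive_Rminus.
  + apply a3.
  + intros x; destruct a3 as [_ [_ h]]; apply Rle_trans with (1 := h x).
    apply Rmult_le_compat_r; trivial; unfold C; lra.
  + apply (level_weaken n _ (K * ((C1 * d ^ 2) * (E * M')) + K * ((C1 * d) * (E * d)))).
    * unfold C; generalize (Rmult_le_pos _ _ p0 d2); lra.
    * now apply level_plus; apply hmul.
Qed.

Lemma superposition_level n : superposition_bounds (level n).
Proof.
induction n as [|n IH]; [apply superposition_level_0|].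
apply (superposition_bounds_weaken _ _) with (2 := superposition_level_step n IH).
intros u B [hu hb]; simpl.
assert (hle : level_exponent (S n) <= level_exponent n + 1).
{ unfold level_exponent; rewrite S_INR; unfold Rmin.
  destruct (Rle_dec _ _), (Rle_dec _ _); lra. }
destruct (Hs_le _ _ u hle hu) as [h1 h2]; split; trivial; lra.
Qed.

(** For an integer [n > r - 1] the level [n] is already [H^(r - 1)], and one more step reaches
    [H^r]. *)
Theorem superposition_Hs : superposition_bounds (fun u B => Hs r u /\ Hn r u <= B).
Proof.
destruct (INR_unbounded (r - 1)) as [n hn].
assert (h := superposition_level_step n (superposition_level n)).
replace (level_exponent n + 1) with r in h; [exact h|].
unfold level_exponent; rewrite Rmin_left; lra.
Qed.

End Superposition.

(** * Differential calculus in [H^r] *)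

Lemma HR_ext r (u v : HR r) : (forall x, fn u x = fn v x) -> u = v.
Proof. intros h; apply ns_ext; extensionality x; apply h. Qed.

Lemma fn_plus r (u v : HR r) x : fn (plus u v) x = fn u x + fn v x.
Proof. reflexivity. Qed.

Lemma fn_opp r (u : HR r) x : fn (opp u) x = - fn u x.
Proof. reflexivity. Qed.

Lemma fn_minus r (u v : HR r) x : fn (minus u v) x = fn u x - fn v x.
Proof. reflexivity. Qed.

Lemma fn_scal r (a : R) (u : HR r) x : fn (scal a u) x = a * fn u x.
Proof. reflexivity. Qed.

Lemma Hs_fn r (u : HR r) : Hs r (fn u).
Proof. exact (proj2_sig u). Qed.

Lemma norm_HR r (u : HR r) : norm u = Hn r (fn u).
Proof. reflexivity. Qed.

Lemma prod_norm_ge0 {E : NormedModule R_AbsRing} (l : list E) : 0 <= Defs.prod_norm l.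
Proof.
induction l as [|v l IH]; simpl; [lra|]; apply Rmult_le_pos; [apply norm_ge_0 | exact IH].
Qed.

Lemma prod_norm_app {E : NormedModule R_AbsRing} (l m : list E) :
  Defs.prod_norm (l ++ m) = Defs.prod_norm l * Defs.prod_norm m.
Proof.
induction l as [|v l IH]; [symmetry; apply Rmult_1_l|].
change (norm v * Defs.prod_norm (l ++ m) = norm v * Defs.prod_norm l * Defs.prod_norm m).
rewrite IH; ring.
Qed.

Lemma prod_norm_cons {E : NormedModule R_AbsRing} (v : E) l :
  Defs.prod_norm (v :: l) = norm v * Defs.prod_norm l.
Proof. reflexivity. Qed.

(** * Products of families of multilinear maps with values in [H^r] *)

Section Leibniz.
Variable r : R.
Hypothesis hr : 1 / 2 < r.
Context {E : NormedModule R_AbsRing}.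

Lemma Hs_mult_mem u v : Hs r u -> Hs r v -> Hs r (fun x => u x * v x).
Proof. intros hu hv; destruct (Hs_mult r hr) as [K [_ h]]; now apply h. Qed.

Definition hmul (u v : HR r) : HR r :=
  exist _ (fun x => fn u x * fn v x) (Hs_mult_mem _ _ (Hs_fn r u) (Hs_fn r v)).

Lemma fn_hmul u v x : fn (hmul u v) x = fn u x * fn v x.
Proof. reflexivity. Qed.

Lemma norm_hmul : exists K, 0 < K /\ forall u v, norm (hmul u v) <= K * (norm u * norm v).
Proof.
destruct (Hs_mult r hr) as [K [hK h]]; exists K; split; trivial.
intros u v; apply (h (fn u) (fn v)); apply Hs_fn.
Qed.

(** [leib l P Q] is the sum of [P l1 * Q l2] over the ways to split [l] into two subsequences. *)
Fixpoint leib (l : list E) (P Q : list E -> HR r) : HR r :=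
  match l with
  | nil => hmul (P nil) (Q nil)
  | v :: l => plus (leib l (fun m => P (v :: m)) Q) (leib l P (fun m => Q (v :: m)))
  end.

Ltac hring := apply HR_ext; intros; rewrite ?fn_hmul, ?fn_plus, ?fn_minus, ?fn_opp,
  ?fn_scal, ?fn_hmul, ?fn_plus, ?fn_minus, ?fn_scal, ?fn_hmul; rring.

Lemma leib_ext l (P P' Q Q' : list E -> HR r) :
  (forall m, (length m <= length l)%nat -> P m = P' m) ->
  (forall m, (length m <= length l)%nat -> Q m = Q' m) -> leib l P Q = leib l P' Q'.
Proof.
revert P P' Q Q'; induction l as [|v l IH]; intros P P' Q Q' hP hQ; simpl.
- rewrite hP, hQ by (simpl; lia); reflexivity.
- simpl in hP, hQ; f_equal; apply IH; intros m hm; [apply hP | apply hQ | apply hP | apply hQ];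
    simpl; lia.
Qed.

Lemma leib_plus_l l (P P' Q : list E -> HR r) :
  leib l (fun m => plus (P m) (P' m)) Q = plus (leib l P Q) (leib l P' Q).
Proof.
revert P P' Q; induction l as [|v l IH]; intros P P' Q; simpl.
- hring.
- rewrite (IH (fun m => P (v :: m)) (fun m => P' (v :: m))), IH; hring.
Qed.

Lemma leib_plus_r l (P Q Q' : list E -> HR r) :
  leib l P (fun m => plus (Q m) (Q' m)) = plus (leib l P Q) (leib l P Q').
Proof.
revert P Q Q'; induction l as [|v l IH]; intros P Q Q'; simpl.
- hring.
- rewrite IH, (IH P (fun m => Q (v :: m)) (fun m => Q' (v :: m))); hring.
Qed.

Lemma leib_scal_l l (a : R) (P Q : list E -> HR r) :
  leib l (fun m => scal a (P m)) Q = scal a (leib l P Q).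
Proof.
revert P Q; induction l as [|v l IH]; intros P Q; simpl.
- hring.
- rewrite (IH (fun m => P (v :: m))), IH; hring.
Qed.

Lemma leib_scal_r l (a : R) (P Q : list E -> HR r) :
  leib l P (fun m => scal a (Q m)) = scal a (leib l P Q).
Proof.
revert P Q; induction l as [|v l IH]; intros P Q; simpl.
- hring.
- rewrite IH, (IH P (fun m => Q (v :: m))); hring.
Qed.

Lemma leib_minus_l l (P P' Q : list E -> HR r) :
  leib l (fun m => minus (P m) (P' m)) Q = minus (leib l P Q) (leib l P' Q).
Proof.
transitivity (plus (leib l P Q) (scal (-1) (leib l P' Q))); [|hring].
rewrite <- leib_scal_l, <- leib_plus_l; apply leib_ext; intros m _; [hring | reflexivity].
Qed.

Lemma leib_minus_r l (P Q Q' : list E -> HR r) :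
  leib l P (fun m => minus (Q m) (Q' m)) = minus (leib l P Q) (leib l P Q').
Proof.
transitivity (plus (leib l P Q) (scal (-1) (leib l P Q'))); [|hring].
rewrite <- leib_scal_r, <- leib_plus_r; apply leib_ext; intros m _; [reflexivity | hring].
Qed.

(** These conditions concern all lengths up to [n], instead of one exact length as in
    [bounded_multilinear], because [leib l P Q] evaluates [P] and [Q] on every subsequence of
    [l]. *)
Definition additive_le (n : nat) {F : NormedModule R_AbsRing} (P : list E -> F) : Prop :=
  forall (l1 l2 : list E) (v w : E), (length l1 + S (length l2) <= n)%nat ->
    P (l1 ++ plus v w :: l2) = plus (P (l1 ++ v :: l2)) (P (l1 ++ w :: l2)).

Definition homogeneous_le (n : nat) {F : NormedModule R_AbsRing} (P : list E -> F) : Prop :=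
  forall (l1 l2 : list E) (a : R) (v : E), (length l1 + S (length l2) <= n)%nat ->
    P (l1 ++ scal a v :: l2) = scal a (P (l1 ++ v :: l2)).

Definition bounded_le (n : nat) {F : NormedModule R_AbsRing} (P : list E -> F) (M : R) : Prop :=
  forall l, (length l <= n)%nat -> norm (P l) <= M * Defs.prod_norm l.

Lemma bounded_le_ge0 n {F : NormedModule R_AbsRing} (P : list E -> F) M :
  bounded_le n P M -> 0 <= M.
Proof.
intros h; specialize (h nil (Nat.le_0_l n)); simpl in h; rewrite Rmult_1_r in h.
apply Rle_trans with (2 := h), norm_ge_0.
Qed.

Lemma bounded_le_weaken n n' {F : NormedModule R_AbsRing} (P : list E -> F) M M' :
  (n' <= n)%nat -> M <= M' -> bounded_le n P M -> bounded_le n' P M'.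
Proof.
intros hn hM h l hl; apply Rle_trans with (M * Defs.prod_norm l); [apply h; lia|].
apply Rmult_le_compat_r; [apply prod_norm_ge0 | exact hM].
Qed.

Lemma leib_additive n (P Q : list E -> HR r) : additive_le n P -> additive_le n Q ->
  additive_le n (fun l => leib l P Q).
Proof.
intros hP hQ l1; revert n P Q hP hQ; induction l1 as [|u l1 IH]; intros n P Q hP hQ l2 v w hl.
- cbn [app leib length Nat.add] in *.
  etransitivity.
  { apply f_equal2; apply leib_ext; intros m hm;
      [apply (hP nil m); simpl; lia | reflexivity | reflexivity | apply (hQ nil m); simpl; lia]. }
  rewrite leib_plus_l, leib_plus_r; cbn [app]; hring.
- cbn [app leib length Nat.add] in *; destruct n as [|n]; [lia|].
  rewrite (IH n (fun m => P (u :: m)) Q), (IH n P (fun m => Q (u :: m)));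
    [hring | | | | | |]; try lia; intros k1 k2 v' w' hk;
    (apply hP || apply hQ || apply (hP (u :: k1)) || apply (hQ (u :: k1))); simpl; lia.
Qed.

Lemma leib_homogeneous n (P Q : list E -> HR r) : homogeneous_le n P -> homogeneous_le n Q ->
  homogeneous_le n (fun l => leib l P Q).
Proof.
intros hP hQ l1; revert n P Q hP hQ; induction l1 as [|u l1 IH]; intros n P Q hP hQ l2 a v hl.
- cbn [app leib length Nat.add] in *.
  etransitivity.
  { apply f_equal2; apply leib_ext; intros m hm;
      [apply (hP nil m); simpl; lia | reflexivity | reflexivity | apply (hQ nil m); simpl; lia]. }
  rewrite leib_scal_l, leib_scal_r; cbn [app]; hring.
- cbn [app leib length Nat.add] in *; destruct n as [|n]; [lia|].
  rewrite (IH n (fun m => P (u :: m)) Q), (IH n P (fun m => Q (u :: m)));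
    [hring | | | | | |]; try lia; intros k1 k2 a' v' hk;
    (apply hP || apply hQ || apply (hP (u :: k1)) || apply (hQ (u :: k1))); simpl; lia.
Qed.

(** The factor [2^n] counts the splittings of a list of length at most [n]; each contributes one
    product, bounded by the algebra constant [K]. *)
Lemma leib_bound : exists K, 0 < K /\ forall n (P Q : list E -> HR r) a b,
  bounded_le n P a -> bounded_le n Q b -> bounded_le n (fun l => leib l P Q) (2 ^ n * K * (a * b)).
Proof.
destruct norm_hmul as [K [hK hmulK]]; exists K; split; trivial.
assert (h : forall l (P Q : list E -> HR r) a b, bounded_le (length l) P a -> bounded_le (length l) Q b ->
  norm (leib l P Q) <= 2 ^ length l * K * (a * b) * Defs.prod_norm l).
{ induction l as [|v l IH]; intros P Q a b hP hQ.
  - simpl; eapply Rle_trans; [apply hmulK|].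
    replace (1 * K * (a * b) * 1) with (K * (a * b)) by ring.
    apply Rmult_le_compat_l; [lra|].
    specialize (hP nil (Nat.le_refl _)); specialize (hQ nil (Nat.le_refl _)).
    simpl in hP, hQ; rewrite Rmult_1_r in hP, hQ.
    apply Rmult_le_compat; auto using norm_ge_0.
  - simpl; eapply Rle_trans; [apply norm_triangle|].
    assert (h1 : norm (leib l (fun m => P (v :: m)) Q) <=
      2 ^ length l * K * (a * norm v * b) * Defs.prod_norm l).
    { apply IH; intros m hm.
      - eapply Rle_trans; [apply hP; simpl; lia|].
        rewrite prod_norm_cons; right; rring.
      - apply hQ; simpl; lia. }
    assert (h2 : norm (leib l P (fun m => Q (v :: m))) <=
      2 ^ length l * K * (a * (b * norm v)) * Defs.prod_norm l).
    { apply IH; intros m hm.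
      - apply hP; simpl; lia.
      - eapply Rle_trans; [apply hQ; simpl; lia|].
        rewrite prod_norm_cons; right; rring. }
    fold (Defs.prod_norm l); eapply Rle_trans; [apply Rplus_le_compat; [apply h1 | apply h2]|].
    right; rring. }
intros n P Q a b hP hQ l hl.
assert (ha := bounded_le_ge0 _ _ _ hP); assert (hb := bounded_le_ge0 _ _ _ hQ).
eapply Rle_trans; [apply (h l P Q a b)|].
- now apply (bounded_le_weaken n _ P a a); [|lra|].
- now apply (bounded_le_weaken n _ Q b b); [|lra|].
- repeat apply Rmult_le_compat_r; try apply prod_norm_ge0.
  + now apply Rmult_le_pos.
  + lra.
  + apply Rle_pow; [lra | exact hl].
Qed.

(* Product rule: the remainder is [leib rho Q1 + leib P' (Q1 - Q0) + leib P0 rho'], where [rho] and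
   [rho'] are the remainders of the two factors. *)
Lemma leib_remainder : exists K, 0 < K /\ forall n (P0 P1 Q0 Q1 : list E -> HR r) h a b c eta,
  0 <= c -> 0 <= eta <= 1 -> norm h <= 1 -> 0 <= b ->
  bounded_le (S n) P0 a -> bounded_le (S n) Q0 (b * c) ->
  bounded_le n (fun m => minus (minus (P1 m) (P0 m)) (P0 (h :: m))) (eta * norm h) ->
  bounded_le n (fun m => minus (minus (Q1 m) (Q0 m)) (Q0 (h :: m))) (eta * norm h * c) ->
  bounded_le n (fun l => minus (minus (leib l P1 Q1) (leib l P0 Q0)) (leib (h :: l) P0 Q0))
    (2 ^ n * K * (eta * (2 * b + 1 + a) + a * (b + 1) * norm h) * norm h * c).
Proof.
destruct leib_bound as [K [hK hbd]]; exists K; split; trivial.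
intros n P0 P1 Q0 Q1 h a b c eta hc [he1 he2] hh hb hP hQ hrP hrQ l hl.
set (rP := fun m => minus (minus (P1 m) (P0 m)) (P0 (h :: m))) in *.
set (rQ := fun m => minus (minus (Q1 m) (Q0 m)) (Q0 (h :: m))) in *.
assert (t0 : 0 <= norm h) by apply norm_ge_0.
set (t := norm h) in *.
assert (ha := bounded_le_ge0 _ _ _ hP).
assert (hbc : 0 <= b * c) by now apply Rmult_le_pos.
assert (hP' : bounded_le n (fun m => P0 (h :: m)) (a * t)).
{ intros m hm; eapply Rle_trans; [apply hP; simpl; lia|].
  rewrite prod_norm_cons; fold t; right; ring. }
assert (hQ' : bounded_le n (fun m => Q0 (h :: m)) (b * c * t)).
{ intros m hm; eapply Rle_trans; [apply hQ; simpl; lia|].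
  rewrite prod_norm_cons; fold t; right; ring. }
assert (hdQ : bounded_le n (fun m => minus (Q1 m) (Q0 m)) ((b + 1) * c * t)).
{ intros m hm.
  replace (minus (Q1 m) (Q0 m)) with (plus (rQ m) (Q0 (h :: m))) by (unfold rQ; hring).
  eapply Rle_trans; [apply norm_triangle|].
  assert (h1 := hrQ m hm); assert (h2 := hQ' m hm).
  assert (p := prod_norm_ge0 m).
  assert (h3 : eta * t * c * Defs.prod_norm m <= 1 * t * c * Defs.prod_norm m)
    by (repeat apply Rmult_le_compat_r; trivial).
  lra. }
assert (hQ1 : bounded_le n Q1 ((2 * b + 1) * c)).
{ intros m hm.
  replace (Q1 m) with (plus (minus (Q1 m) (Q0 m)) (Q0 m)) by hring.
  eapply Rle_trans; [apply norm_triangle|].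
  assert (h1 := hdQ m hm); assert (h2 : norm (Q0 m) <= b * c * Defs.prod_norm m) by (apply hQ; lia).
  assert (p := prod_norm_ge0 m).
  assert (h3 : (b + 1) * c * t * Defs.prod_norm m <= (b + 1) * c * 1 * Defs.prod_norm m).
  { apply Rmult_le_compat_r, Rmult_le_compat_l; trivial; apply Rmult_le_pos; lra. }
  lra. }
replace (minus (minus (leib l P1 Q1) (leib l P0 Q0)) (leib (h :: l) P0 Q0)) with
  (plus (leib l rP Q1) (plus (leib l (fun m => P0 (h :: m)) (fun m => minus (Q1 m) (Q0 m)))
     (leib l P0 rQ))).
- eapply Rle_trans; [apply norm_triangle|].
  assert (h1 := hbd n _ _ _ _ hrP hQ1 l hl).
  assert (h2 := hbd n _ _ _ _ hP' hdQ l hl).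
  assert (h3 := hbd n _ _ _ _ (bounded_le_weaken (S n) n P0 a a (Nat.le_succ_diag_r n)
    (Rle_refl a) hP) hrQ l hl).
  assert (h4 := norm_triangle (leib l (fun m => P0 (h :: m)) (fun m => minus (Q1 m) (Q0 m)))
    (leib l P0 rQ)).
  eapply Rle_trans; [apply Rplus_le_compat; [apply h1|]|].
  { eapply Rle_trans; [apply h4|]; apply Rplus_le_compat; [apply h2 | apply h3]. }
  right; ring.
- unfold rP, rQ; rewrite !leib_minus_l, !leib_minus_r; simpl; hring.
Qed.

End Leibniz.

(** * Smooth maps given together with their differentials of all orders *)

Lemma locally_of_norm {E : NormedModule R_AbsRing} (x : E) (P : E -> Prop) (d : R) : 0 < d ->
  (forall y, norm (minus y x) < d -> P y) -> locally x P.
Proof.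
intros hd h; apply locally_le_locally_norm; exists (mkposreal d hd); intros y hy; now apply h.
Qed.

Lemma norm_of_locally {E : NormedModule R_AbsRing} (x : E) (P : E -> Prop) : locally x P ->
  exists d, 0 < d /\ forall y, norm (minus y x) < d -> P y.
Proof.
intros h; apply locally_norm_le_locally in h; destruct h as [d hd].
exists d; split; [apply cond_pos | exact hd].
Qed.

(** The conditions of [smooth_on] with the differentials [D] named, so that those of a sum, product
    or composite can be built from those of the parts. *)
Definition smooth_data {E F : NormedModule R_AbsRing} (W : E -> Prop) (f : E -> F)
    (D : list E -> E -> F) : Prop :=
  (forall x, W x -> D nil x = f x) /\
  (forall k x, W x -> bounded_multilinear k (fun l => D l x)) /\
  (forall k x, W x -> forall eps : posreal, locally x (fun y =>
     forall l, length l = k ->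
       norm (minus (minus (D l y) (D l x)) (D (minus y x :: l) x))
         <= eps * norm (minus y x) * Defs.prod_norm l)).

Lemma smooth_on_intro {E F : NormedModule R_AbsRing} (W : E -> Prop) (f : E -> F) D :
  open W -> smooth_data W f D -> smooth_on W f.
Proof. intros hW h; split; trivial; now exists D. Qed.

Ltac norm0 :=
  match goal with |- norm ?z <= _ => replace (norm z) with 0 by (symmetry; exact norm_zero) end.

Lemma minus_self_module {V : NormedModule R_AbsRing} (v : V) : minus v v = zero.
Proof. exact (minus_eq_zero v). Qed.

Lemma norm_remainder_self {V : NormedModule R_AbsRing} (v : V) :
  norm (minus (minus v v) zero) = 0.
Proof.
rewrite minus_self_module; transitivity (norm (zero : V)); [|exact norm_zero].
apply f_equal; exact (minus_eq_zero (zero : V)).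
Qed.

Lemma forall_locally_lt {E : NormedModule R_AbsRing} (x : E) (P : nat -> E -> Prop) n :
  (forall k, locally x (P k)) -> locally x (fun y => forall k, (k <= n)%nat -> P k y).
Proof.
intros h; induction n as [|n IH].
- generalize (h O); apply filter_imp; intros y hy k hk; replace k with O by lia; exact hy.
- generalize (filter_and _ _ (h (S n)) IH); apply filter_imp; intros y [h1 h2] k hk.
  destruct (Nat.eq_dec k (S n)) as [->|]; [trivial | apply h2; lia].
Qed.

Section Data.
Context {E F : NormedModule R_AbsRing}.
Variables (W : E -> Prop) (f : E -> F) (D : list E -> E -> F).

Lemma smooth_data_additive n x : smooth_data W f D -> W x -> additive_le n (fun l => D l x).
Proof.
intros [_ [h _]] hx l1 l2 v w _.
now apply (proj1 (h (length l1 + S (length l2))%nat x hx)).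
Qed.

Lemma smooth_data_homogeneous n x : smooth_data W f D -> W x ->
  homogeneous_le n (fun l => D l x).
Proof.
intros [_ [h _]] hx l1 l2 a v _.
now apply (proj1 (proj2 (h (length l1 + S (length l2))%nat x hx))).
Qed.

Lemma smooth_data_bounded n x : smooth_data W f D -> W x ->
  exists M, bounded_le n (fun l => D l x) M.
Proof.
intros [_ [h _]] hx; induction n as [|n [M hM]].
- destruct (proj2 (proj2 (h O x hx))) as [M hM]; exists M; intros l hl; apply hM; lia.
- destruct (proj2 (proj2 (h (S n) x hx))) as [M' hM']; exists (Rmax M M'); intros l hl.
  destruct (Nat.eq_dec (length l) (S n)) as [e|ne].
  + apply Rle_trans with (1 := hM' l e), Rmult_le_compat_r; [apply prod_norm_ge0 | apply Rmax_r].
  + eapply Rle_trans; [apply hM; lia|].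
    apply Rmult_le_compat_r; [apply prod_norm_ge0 | apply Rmax_l].
Qed.

Lemma smooth_data_remainder n x eps : smooth_data W f D -> W x -> 0 < eps ->
  locally x (fun y => bounded_le n
    (fun l => minus (minus (D l y) (D l x)) (D (minus y x :: l) x)) (eps * norm (minus y x))).
Proof.
intros [_ [_ h]] hx he.
assert (hk := forall_locally_lt x _ n (fun k => h k x hx (mkposreal eps he))).
revert hk; apply filter_imp; intros y hy l hl; now apply (hy (length l)).
Qed.

Lemma smooth_data_intro : (forall x, W x -> D nil x = f x) ->
  (forall n x, W x -> additive_le n (fun l => D l x)) ->
  (forall n x, W x -> homogeneous_le n (fun l => D l x)) ->
  (forall n x, W x -> exists M, bounded_le n (fun l => D l x) M) ->
  (forall n x eps, W x -> 0 < eps -> locally x (fun y => bounded_le n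
    (fun l => minus (minus (D l y) (D l x)) (D (minus y x :: l) x)) (eps * norm (minus y x)))) ->
  smooth_data W f D.
Proof.
intros h0 ha hh hb hr; split; [exact h0 | split].
- intros k x hx; split; [|split].
  + intros l1 l2 v w e; exact (ha k x hx l1 l2 v w (Nat.eq_le_incl _ _ e)).
  + intros l1 l2 a v e; exact (hh k x hx l1 l2 a v (Nat.eq_le_incl _ _ e)).
  + destruct (hb k x hx) as [M hM]; exists M; intros l e; apply hM; lia.
- intros k x hx eps; generalize (hr k x eps hx (cond_pos eps)); apply filter_imp.
  intros y hy l e; apply hy; lia.
Qed.

End Data.

Lemma smooth_data_restrict {E F : NormedModule R_AbsRing} (W W' : E -> Prop) (f g : E -> F) D :
  (forall x, W' x -> W x) -> (forall x, W' x -> f x = g x) ->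
  smooth_data W f D -> smooth_data W' g D.
Proof.
intros hW hfg [h0 [h1 h2]]; split; [|split]; auto.
intros x hx; rewrite h0, hfg; auto.
Qed.

Lemma smooth_data_linear_comp {E F G : NormedModule R_AbsRing} (W : E -> Prop) (f : E -> F) D
    (L : F -> G) : is_linear L -> smooth_data W f D ->
  smooth_data W (fun x => L (f x)) (fun l x => L (D l x)).
Proof.
intros hL h; destruct (linear_norm L hL) as [M [hM hLM]].
apply smooth_data_intro.
- intros x hx; now rewrite (proj1 h).
- intros n x hx l1 l2 v w hl.
  rewrite (smooth_data_additive W f D n x h hx l1 l2 v w hl); exact (linear_plus L hL _ _).
- intros n x hx l1 l2 a v hl.
  rewrite (smooth_data_homogeneous W f D n x h hx l1 l2 a v hl); exact (linear_scal L hL a _).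
- intros n x hx; destruct (smooth_data_bounded W f D n x h hx) as [C hC].
  exists (M * C); intros l hl; eapply Rle_trans; [apply hLM|].
  rewrite Rmult_assoc; apply Rmult_le_compat_l; [lra | now apply hC].
- intros n x eps hx he.
  assert (he' : 0 < eps / M) by now apply Rdiv_lt_0_compat.
  generalize (smooth_data_remainder W f D n x _ h hx he'); apply filter_imp; intros y hy l hl.
  rewrite <- !linear_minus by trivial; eapply Rle_trans; [apply hLM|].
  apply Rle_trans with (M * (eps / M * norm (minus y x) * Defs.prod_norm l)).
  + apply Rmult_le_compat_l; [lra | now apply hy].
  + right; field; lra.
Qed.

Lemma minus_plus_plus {G : AbelianGroup} (a b c d : G) :
  minus (plus a b) (plus c d) = plus (minus a c) (minus b d).
Proof.
unfold minus; rewrite opp_plus, !plus_assoc; f_equal.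
now rewrite <- !plus_assoc, (plus_comm b).
Qed.

Lemma plus_minus_cancel {G : AbelianGroup} (a b : G) : plus (minus a b) b = a.
Proof. unfold minus; rewrite <- plus_assoc, plus_opp_l; apply plus_zero_r. Qed.

Lemma remainder_plus {V : NormedModule R_AbsRing} (a b c d e f : V) :
  minus (minus (plus a b) (plus c d)) (plus e f) =
    plus (minus (minus a c) e) (minus (minus b d) f).
Proof.
transitivity (minus (plus (minus a c) (minus b d)) (plus e f)).
- apply (f_equal (fun z : V => minus z (plus e f))).
  exact (@minus_plus_plus (NormedModule.AbelianGroup R_AbsRing V) a b c d).
- exact (@minus_plus_plus (NormedModule.AbelianGroup R_AbsRing V) _ _ e f).
Qed.

Lemma smooth_data_plus {E F : NormedModule R_AbsRing} (W : E -> Prop) (f g : E -> F) Df Dg :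
  smooth_data W f Df -> smooth_data W g Dg ->
  smooth_data W (fun x => plus (f x) (g x)) (fun l x => plus (Df l x) (Dg l x)).
Proof.
intros hf hg; apply smooth_data_intro.
- intros x hx; now rewrite (proj1 hf), (proj1 hg).
- intros n x hx l1 l2 v w hl.
  rewrite (smooth_data_additive W f Df n x hf hx l1 l2 v w hl),
    (smooth_data_additive W g Dg n x hg hx l1 l2 v w hl).
  rewrite <- !plus_assoc; f_equal; rewrite !plus_assoc; f_equal; apply plus_comm.
- intros n x hx l1 l2 a v hl.
  rewrite (smooth_data_homogeneous W f Df n x hf hx l1 l2 a v hl),
    (smooth_data_homogeneous W g Dg n x hg hx l1 l2 a v hl).
  symmetry; exact (scal_distr_l (V := NormedModule.ModuleSpace R_AbsRing F) a _ _).
- intros n x hx; destruct (smooth_data_bounded W f Df n x hf hx) as [C hC],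
    (smooth_data_bounded W g Dg n x hg hx) as [C' hC'].
  exists (C + C'); intros l hl; eapply Rle_trans; [apply norm_triangle|].
  rewrite Rmult_plus_distr_r; apply Rplus_le_compat; auto.
- intros n x eps hx he.
  assert (he' : 0 < eps / 2) by lra.
  generalize (filter_and _ _ (smooth_data_remainder W f Df n x _ hf hx he')
    (smooth_data_remainder W g Dg n x _ hg hx he')).
  apply filter_imp; intros y [h1 h2] l hl.
  rewrite remainder_plus; eapply Rle_trans; [apply norm_triangle|].
  generalize (h1 l hl) (h2 l hl); cbv beta; lra.
Qed.

Lemma smooth_data_linear {E F : NormedModule R_AbsRing} (W : E -> Prop) (L : E -> F) :
  is_linear L -> smooth_data W L (fun l x =>
    match l with nil => L x | v :: nil => L v | _ => zero end).
Proof.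
intros hL; destruct (linear_norm L hL) as [M [hM hLM]].
apply smooth_data_intro; trivial.
- intros n x hx [|u l1] [|z l2] v w _; simpl.
  + exact (linear_plus L hL _ _).
  + symmetry; apply plus_zero_l.
  + destruct l1; simpl; symmetry; apply plus_zero_l.
  + destruct l1; simpl; symmetry; apply plus_zero_l.
- intros n x hx [|u l1] [|z l2] a v _; simpl.
  + exact (linear_scal L hL a _).
  + symmetry; exact (scal_zero_r (V := NormedModule.ModuleSpace R_AbsRing F) a).
  + destruct l1; simpl; symmetry; exact (scal_zero_r (V := NormedModule.ModuleSpace R_AbsRing F) a).
  + destruct l1; simpl; symmetry; exact (scal_zero_r (V := NormedModule.ModuleSpace R_AbsRing F) a).
- intros n x hx; exists (norm (L x) + M); intros [|v [|w l]] _; simpl.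
  + generalize (norm_ge_0 (L x)); lra.
  + apply Rle_trans with (1 := hLM v).
    rewrite Rmult_1_r; apply Rmult_le_compat_r; [apply norm_ge_0|].
    generalize (norm_ge_0 (L x)); lra.
  + norm0; apply Rmult_le_pos; [generalize (norm_ge_0 (L x)); lra|].
    apply (prod_norm_ge0 (v :: w :: l)).
- intros n x eps hx he; apply filter_forall; intros y [|v l] _; simpl.
  + rewrite <- linear_minus, minus_self_module by trivial; norm0.
    repeat apply Rmult_le_pos; try lra; apply norm_ge_0.
  + match goal with |- norm ?z <= _ =>
      replace (norm z) with 0 by (symmetry; destruct l; apply norm_remainder_self) end.
    repeat apply Rmult_le_pos; try lra; try apply norm_ge_0; apply (prod_norm_ge0 l).
Qed.

Lemma smooth_data_const {E F : NormedModule R_AbsRing} (W : E -> Prop) (c : F) :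
  smooth_data W (fun _ => c) (fun l _ => match l with nil => c | _ => zero end).
Proof.
apply smooth_data_intro; trivial.
- intros n x hx [|u l1] l2 v w _; simpl; symmetry; apply plus_zero_l.
- intros n x hx [|u l1] l2 a v _; simpl; symmetry; exact (scal_zero_r (V := NormedModule.ModuleSpace R_AbsRing F) a).
- intros n x hx; exists (norm c); intros [|v l] _; simpl; [lra|].
  norm0; apply Rmult_le_pos; [apply norm_ge_0 | apply (prod_norm_ge0 (v :: l))].
- intros n x eps hx he; apply filter_forall; intros y l _.
  match goal with |- norm ?z <= _ =>
    replace (norm z) with 0 by (symmetry; destruct l; apply norm_remainder_self) end.
  repeat apply Rmult_le_pos; try lra; try apply norm_ge_0; apply (prod_norm_ge0 l).
Qed.

(** The remainder of order zero, taken with [eps = 1], gives a local Lipschitz bound of [f] at [x].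
    The chain rule and the openness of pointwise conditions rest on it. *)
Lemma smooth_data_continuous {E F : NormedModule R_AbsRing} (W : E -> Prop) (f : E -> F) D x :
  open W -> smooth_data W f D -> W x -> exists C, 0 < C /\
    locally x (fun y => W y /\ norm (minus (minus (f y) (f x)) (D [minus y x] x))
      <= norm (minus y x) /\ norm (minus (f y) (f x)) <= C * norm (minus y x)).
Proof.
intros hW h hx; destruct (smooth_data_bounded W f D 1 x h hx) as [M hM].
assert (M0 := bounded_le_ge0 _ _ _ hM).
exists (M + 1); split; [lra|].
generalize (filter_and _ _ (hW x hx) (smooth_data_remainder W f D 0 x 1 h hx Rlt_0_1)).
apply filter_imp; intros y [hy hr].
assert (hr' : norm (minus (minus (f y) (f x)) (D [minus y x] x)) <= norm (minus y x)).
{ rewrite <- (proj1 h y hy), <- (proj1 h x hx).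
  eapply Rle_trans; [exact (hr nil (Nat.le_refl _))|].
  right; change (1 * norm (minus y x) * 1 = norm (minus y x)); rring. }
repeat split; trivial.
assert (h1 : norm (D [minus y x] x) <= M * norm (minus y x)).
{ eapply Rle_trans; [apply hM; simpl; lia|].
  right; change (M * (norm (minus y x) * 1) = M * norm (minus y x)); rring. }
replace (minus (f y) (f x)) with
  (plus (minus (minus (f y) (f x)) (D [minus y x] x)) (D [minus y x] x)).
- eapply Rle_trans; [apply norm_triangle|]; lra.
- exact (@plus_minus_cancel (NormedModule.AbelianGroup R_AbsRing F) _ _).
Qed.

Section Product.
Variable r : R.
Hypothesis hr : 1 / 2 < r.
Context {E : NormedModule R_AbsRing}.
Variable W : E -> Prop.

Lemma locally_small (x : E) d : 0 < d -> locally x (fun y => norm (minus y x) < d).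
Proof. intros hd; now apply (locally_of_norm x _ d). Qed.

Lemma smooth_data_mult (f g : E -> HR r) Df Dg :
  smooth_data W f Df -> smooth_data W g Dg ->
  smooth_data W (fun x => hmul r hr (f x) (g x))
    (fun l x => leib r hr l (fun m => Df m x) (fun m => Dg m x)).
Proof.
intros hf hg; apply smooth_data_intro.
- intros x hx; simpl; now rewrite (proj1 hf), (proj1 hg).
- intros n x hx; apply leib_additive;
    [apply (smooth_data_additive W f) | apply (smooth_data_additive W g)]; trivial.
- intros n x hx; apply leib_homogeneous;
    [apply (smooth_data_homogeneous W f) | apply (smooth_data_homogeneous W g)]; trivial.
- intros n x hx; destruct (leib_bound r hr (E := E)) as [K [_ hK]].
  destruct (smooth_data_bounded W f Df n x hf hx) as [a ha].
  destruct (smooth_data_bounded W g Dg n x hg hx) as [b hb].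
  exists (2 ^ n * K * (a * b)); now apply hK.
- intros n x eps hx he.
  destruct (leib_remainder r hr (E := E)) as [K [hK rem]].
  destruct (smooth_data_bounded W f Df (S n) x hf hx) as [a ha].
  destruct (smooth_data_bounded W g Dg (S n) x hg hx) as [b hb].
  assert (a0 := bounded_le_ge0 _ _ _ ha); assert (b0 := bounded_le_ge0 _ _ _ hb).
  (* When [norm (minus y x) <= eta], the error of the product rule is at most [c * eta] times the
     increment; [eta] is then taken below [eps / c]. *)
  set (c := 2 ^ n * K * (2 * b + 1 + a + a * (b + 1))).
  assert (hc : 0 < c).
  { apply Rmult_lt_0_compat; [apply Rmult_lt_0_compat; [apply pow_lt; lra | lra]|].
    generalize (Rmult_le_pos a (b + 1) a0); lra. }
  set (eta := Rmin 1 (eps / c)).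
  assert (hd : 0 < eps / c) by now apply Rdiv_lt_0_compat.
  assert (h1 : 0 < eta) by (apply Rmin_glb_lt; lra).
  assert (h2 : eta <= 1) by apply Rmin_l.
  assert (h3 : c * eta <= eps).
  { apply Rle_trans with (c * (eps / c)); [apply Rmult_le_compat_l; [lra | apply Rmin_r]|].
    right; field; lra. }
  generalize (filter_and _ _ (locally_small x eta h1) (filter_and _ _
    (smooth_data_remainder W f Df n x eta hf hx h1)
    (smooth_data_remainder W g Dg n x eta hg hx h1))).
  apply filter_imp; intros y [hy [rf rg]].
  assert (t0 := norm_ge_0 (minus y x)).
  rewrite <- (Rmult_1_r b) in hb; rewrite <- (Rmult_1_r (eta * norm (minus y x))) in rg.
  eapply bounded_le_weaken; [apply Nat.le_refl | |
    exact (rem n (fun m => Df m x) (fun m => Df m y) (fun m => Dg m x) (fun m => Dg m y)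
      (minus y x) a b 1 eta Rle_0_1 (conj (Rlt_le _ _ h1) h2)
      (Rle_trans _ _ _ (Rlt_le _ _ hy) h2) b0 ha hb rf rg)].
  rewrite Rmult_1_r; apply Rmult_le_compat_r; trivial.
  apply Rle_trans with (2 := h3); unfold c.
  rewrite (Rmult_assoc (2 ^ n * K)); apply Rmult_le_compat_l.
  { apply Rmult_le_pos; [apply pow_le; lra | lra]. }
  assert (h4 : a * (b + 1) * norm (minus y x) <= a * (b + 1) * eta)
    by (apply Rmult_le_compat_l; [apply Rmult_le_pos; lra | lra]).
  lra.
Qed.

End Product.

(** * Composition with a family of maps each of which differentiates to multiplication by the
    next *)

Section Chain.
Variable r : R.
Hypothesis hr : 1 / 2 < r.
Context {E : NormedModule R_AbsRing}.
Variables (N : nat -> HR r -> HR r) (O : HR r -> Prop).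
Hypothesis hN : forall j a, O a -> forall eps, 0 < eps -> locally a (fun b =>
  norm (minus (minus (N j b) (N j a)) (hmul r hr (N (S j) a) (minus b a)))
    <= eps * norm (minus b a)).
Variables (W : E -> Prop) (f : E -> HR r) (Df : list E -> E -> HR r).
Hypothesis hW : open W.
Hypothesis hf : smooth_data W f Df.
Hypothesis hO : forall x, W x -> O (f x).

(** The last vector [v] of [l ++ [v]] is the direction of the innermost differentiation, which
    turns [N j (f x)] into [N (S j) (f x) * Df [v] x]; [l] is then distributed by the product
    rule.  The recursion is on a bound for the length of the list. *)
Fixpoint chain_fuel (n j : nat) (l : list E) (x : E) : HR r :=
  match n with
  | 0%nat => N j (f x)
  | S n =>
    match rev l with
    | nil => N j (f x)
    | v :: l' => leib r hr (rev l') (fun m => chain_fuel n (S j) m x) (fun m => Df (m ++ [v]) x)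
    end
  end.

Definition chain (j : nat) (l : list E) (x : E) : HR r := chain_fuel (length l) j l x.

Lemma chain_fuel_enough n n' j l x : (length l <= n)%nat -> (length l <= n')%nat ->
  chain_fuel n j l x = chain_fuel n' j l x.
Proof.
revert n' j l; induction n as [|n IH]; intros [|n'] j l h h'; trivial.
- destruct l; [reflexivity | simpl in h; lia].
- destruct l; [reflexivity | simpl in h'; lia].
- cbn [chain_fuel]; destruct (rev l) as [|v l'] eqn:e; trivial.
  assert (hl : length l = S (length l')) by now rewrite <- length_rev, e.
  apply leib_ext; intros m hm; trivial.
  rewrite length_rev in hm; apply IH; lia.
Qed.

Lemma chain_nil j x : chain j nil x = N j (f x).
Proof. reflexivity. Qed.

Lemma chain_snoc j l v x :
  chain j (l ++ [v]) x = leib r hr l (fun m => chain (S j) m x) (fun m => Df (m ++ [v]) x).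
Proof.
unfold chain at 1; rewrite length_app, Nat.add_1_r; cbn [chain_fuel].
rewrite rev_app_distr; cbn [rev app]; rewrite rev_involutive.
apply leib_ext; intros m hm; trivial; apply chain_fuel_enough; lia.
Qed.

(** In the last slot additivity is that of [Df], which alone receives this vector. In an earlier
    slot it is that of the Leibniz sum, by induction for the factor [chain (S j)]. *)
Lemma chain_additive n j x : W x -> additive_le n (fun l => chain j l x).
Proof.
intros hx; revert j; induction n as [|n IH]; intros j l1 l2 v w hl; [lia|].
destruct l2 as [|u l2 _] using rev_ind.
- rewrite !chain_snoc.
  rewrite <- leib_plus_r; apply leib_ext; intros m hm; trivial.
  exact (smooth_data_additive W f Df (S (length m)) x hf hx m nil v w ltac:(simpl; lia)).
- rewrite length_app in hl; simpl in hl.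
  rewrite !app_comm_cons, !app_assoc, !chain_snoc.
  apply (leib_additive r hr n (fun m => chain (S j) m x) (fun m => Df (m ++ [u]) x));
    [apply IH | | lia].
  intros k1 k2 v' w' hk; rewrite <- !app_assoc; cbn [app].
  apply (smooth_data_additive W f Df (S n) x hf hx k1 (k2 ++ [u]) v' w').
  rewrite length_app; simpl; lia.
Qed.

Lemma chain_homogeneous n j x : W x -> homogeneous_le n (fun l => chain j l x).
Proof.
intros hx; revert j; induction n as [|n IH]; intros j l1 l2 a v hl; [lia|].
destruct l2 as [|u l2 _] using rev_ind.
- rewrite !chain_snoc.
  rewrite <- leib_scal_r; apply leib_ext; intros m hm; trivial.
  exact (smooth_data_homogeneous W f Df (S (length m)) x hf hx m nil a v ltac:(simpl; lia)).
- rewrite length_app in hl; simpl in hl.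
  rewrite !app_comm_cons, !app_assoc, !chain_snoc.
  apply (leib_homogeneous r hr n (fun m => chain (S j) m x) (fun m => Df (m ++ [u]) x));
    [apply IH | | lia].
  intros k1 k2 a' v' hk; rewrite <- !app_assoc; cbn [app].
  apply (smooth_data_homogeneous W f Df (S n) x hf hx k1 (k2 ++ [u]) a' v').
  rewrite length_app; simpl; lia.
Qed.

Lemma bounded_snoc n (P : list E -> HR r) M v : bounded_le (S n) P M ->
  bounded_le n (fun m => P (m ++ [v])) (M * norm v).
Proof.
intros h m hm; eapply Rle_trans; [apply h; rewrite length_app; simpl; lia|].
rewrite prod_norm_app; right; change (Defs.prod_norm [v]) with (norm v * 1); rring.
Qed.

Lemma chain_bounded n j x : W x -> exists M, bounded_le n (fun l => chain j l x) M.
Proof.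
intros hx; revert j; induction n as [|n IH]; intros j.
- exists (norm (N j (f x))); intros [|v l] hl; [|simpl in hl; lia].
  rewrite chain_nil; simpl; lra.
- destruct (IH (S j)) as [a ha].
  destruct (smooth_data_bounded W f Df (S n) x hf hx) as [b hb].
  destruct (leib_bound r hr (E := E)) as [K [hK bd]].
  assert (a0 := bounded_le_ge0 _ _ _ ha); assert (b0 := bounded_le_ge0 _ _ _ hb).
  assert (c0 : 0 <= 2 ^ n * K * (a * b)).
  { apply Rmult_le_pos; [apply Rmult_le_pos; [apply pow_le; lra | lra]|].
    now apply Rmult_le_pos. }
  exists (norm (N j (f x)) + 2 ^ n * K * (a * b)); intros l hl.
  destruct l as [|v l _] using rev_ind.
  + rewrite chain_nil; simpl; lra.
  + rewrite length_app in hl; simpl in hl; rewrite chain_snoc.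
    eapply Rle_trans; [apply (bd n _ _ a (b * norm v) ha (bounded_snoc _ _ _ _ hb)); lia|].
    rewrite prod_norm_app; change (Defs.prod_norm [v]) with (norm v * 1).
    generalize (norm_ge_0 (N j (f x))) (prod_norm_ge0 l) (norm_ge_0 v); intros p1 p2 p3.
    generalize (Rmult_le_pos _ _ p2 p3); intros p4.
    generalize (Rmult_le_pos _ _ p1 p4); lra.
Qed.

(** The first-order chain rule. Half of [eps] pays for the remainder of [N j] at [f x], whose
    increment is at most [C] times that of [x], and half for the remainder of [f] multiplied by
    [N (S j) (f x)]. *)
Lemma chain_remainder_nil j x eps : W x -> 0 < eps -> locally x (fun y =>
  norm (minus (minus (N j (f y)) (N j (f x))) (chain j [minus y x] x)) <= eps * norm (minus y x)).
Proof.
intros hx he.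
destruct (norm_hmul r hr) as [K [hK hmulK]].
destruct (smooth_data_continuous W f Df x hW hf hx) as [C [hC hc]].
set (p := norm (N (S j) (f x))); assert (p0 : 0 <= p) by apply norm_ge_0.
assert (h1 : 0 < eps / 2 / C) by (apply Rdiv_lt_0_compat; lra).
assert (h2 : 0 < eps / 2 / (K * (p + 1))).
{ apply Rdiv_lt_0_compat; [lra | apply Rmult_lt_0_compat; lra]. }
destruct (norm_of_locally _ _ (hN j (f x) (hO x hx) _ h1)) as [d [hd hNd]].
assert (h3 : 0 < d / C) by now apply Rdiv_lt_0_compat.
generalize (filter_and _ _ hc (filter_and _ _ (locally_small x _ h3)
  (smooth_data_remainder W f Df 0 x _ hf hx h2))).
apply filter_imp; intros y [[hy [_ hl]] [hs hrem]].
assert (hfd : norm (minus (f y) (f x)) < d).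
{ apply Rle_lt_trans with (1 := hl).
  apply Rlt_le_trans with (C * (d / C)); [apply Rmult_lt_compat_l; trivial | right; field; lra]. }
assert (hN1 := hNd (f y) hfd).
assert (hrem' : norm (minus (minus (f y) (f x)) (Df [minus y x] x)) <=
  eps / 2 / (K * (p + 1)) * norm (minus y x)).
{ rewrite <- (proj1 hf y hy), <- (proj1 hf x hx).
  eapply Rle_trans; [exact (hrem nil (Nat.le_refl _))|].
  right; exact (Rmult_1_r _). }
change (chain j [minus y x] x) with (hmul r hr (N (S j) (f x)) (Df [minus y x] x)).
set (h := minus y x) in *.
replace (minus (minus (N j (f y)) (N j (f x))) (hmul r hr (N (S j) (f x)) (Df [h] x))) with
  (plus (minus (minus (N j (f y)) (N j (f x)))
      (hmul r hr (N (S j) (f x)) (minus (f y) (f x))))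
    (hmul r hr (N (S j) (f x)) (minus (minus (f y) (f x)) (Df [h] x)))).
- eapply Rle_trans; [apply norm_triangle|].
  assert (e1 : eps / 2 / C * norm (minus (f y) (f x)) <= eps / 2 * norm h).
  { apply Rle_trans with (eps / 2 / C * (C * norm h)); [apply Rmult_le_compat_l; lra|].
    right; field; lra. }
  assert (e2 : norm (hmul r hr (N (S j) (f x)) (minus (minus (f y) (f x)) (Df [h] x))) <=
    eps / 2 * norm h).
  { eapply Rle_trans; [apply hmulK|]; fold p.
    apply Rle_trans with (K * ((p + 1) * (eps / 2 / (K * (p + 1)) * norm h))).
    - apply Rmult_le_compat_l; [lra|]; apply Rmult_le_compat; try lra; apply norm_ge_0.
    - right; field; lra. }
  lra.
- apply HR_ext; intros t; rewrite ?fn_plus, ?fn_minus, ?fn_hmul, ?fn_minus; rring.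
Qed.

Lemma chain_remainder n : forall j x eps, W x -> 0 < eps -> locally x (fun y => bounded_le n
  (fun l => minus (minus (chain j l y) (chain j l x)) (chain j (minus y x :: l) x))
  (eps * norm (minus y x))).
Proof.
induction n as [|n IH]; intros j x eps hx he.
- generalize (chain_remainder_nil j x eps hx he); apply filter_imp; intros y hy [|v l] hl.
  + eapply Rle_trans; [exact hy|]; right; symmetry; exact (Rmult_1_r _).
  + simpl in hl; lia.
- destruct (leib_remainder r hr (E := E)) as [K [hK rem]].
  destruct (chain_bounded (S n) (S j) x hx) as [a ha].
  destruct (smooth_data_bounded W f Df (S (S n)) x hf hx) as [b hb].
  assert (a0 := bounded_le_ge0 _ _ _ ha); assert (b0 := bounded_le_ge0 _ _ _ hb).
  set (c := 2 ^ n * K * (2 * b + 1 + a + a * (b + 1))).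
  assert (hc : 0 < c).
  { apply Rmult_lt_0_compat; [apply Rmult_lt_0_compat; [apply pow_lt; lra | lra]|].
    generalize (Rmult_le_pos a (b + 1) a0); lra. }
  set (eta := Rmin 1 (eps / c)).
  assert (hd : 0 < eps / c) by now apply Rdiv_lt_0_compat.
  assert (h1 : 0 < eta) by (apply Rmin_glb_lt; lra).
  assert (h2 : eta <= 1) by apply Rmin_l.
  assert (h3 : c * eta <= eps).
  { apply Rle_trans with (c * (eps / c)); [apply Rmult_le_compat_l; [lra | apply Rmin_r]|].
    right; field; lra. }
  generalize (filter_and _ _ (chain_remainder_nil j x eps hx he)
   (filter_and _ _ (locally_small x eta h1) (filter_and _ _
    (IH (S j) x eta hx h1) (smooth_data_remainder W f Df (S n) x eta hf hx h1)))).
  apply filter_imp; intros y [h0 [hy [rN rf]]] l hl.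
  assert (t0 := norm_ge_0 (minus y x)).
  destruct l as [|v l _] using rev_ind.
  { eapply Rle_trans; [exact h0|]; right; symmetry; exact (Rmult_1_r _). }
  rewrite length_app in hl; simpl in hl.
  (* The new direction enters at the front and the recursion peels off the end, so all three terms
     are Leibniz sums with the same last vector [v], and the product rule for [leib] applies. *)
  rewrite app_comm_cons, !chain_snoc.
  assert (v0 := norm_ge_0 v).
  eapply Rle_trans.
  (* The parameter [c] of [leib_remainder] is [norm v]: the second factor carries [v] as a fixed
     argument, and its bounds are proportional to it. *)
  + apply (rem n (fun m => chain (S j) m x) (fun m => chain (S j) m y)
      (fun m => Df (m ++ [v]) x) (fun m => Df (m ++ [v]) y) (minus y x) a b (norm v) eta);
      trivial; try lra; try lia.
    * exact (bounded_snoc (S n) (fun m => Df m x) b v hb).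
    * intros m hm.
      assert (h := rf (m ++ [v]) ltac:(rewrite length_app; simpl; lia)).
      rewrite prod_norm_app in h; change (Defs.prod_norm [v]) with (norm v * 1) in h.
      eapply Rle_trans; [exact h|]; right; rring.
  + rewrite prod_norm_app; change (Defs.prod_norm [v]) with (norm v * 1).
    replace (eps * norm (minus y x) * (Defs.prod_norm l * (norm v * 1)))
      with (eps * norm (minus y x) * norm v * Defs.prod_norm l) by ring.
    repeat (apply Rmult_le_compat_r; [now try apply prod_norm_ge0|]).
    apply Rle_trans with (2 := h3); unfold c.
    rewrite (Rmult_assoc (2 ^ n * K)); apply Rmult_le_compat_l.
    { apply Rmult_le_pos; [apply pow_le; lra | lra]. }
    assert (h4 : a * (b + 1) * norm (minus y x) <= a * (b + 1) * eta)
      by (apply Rmult_le_compat_l; [apply Rmult_le_pos; lra | lra]).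
    lra.
Qed.

(** Since the differential of [N j] is multiplication by [N (S j)], every further differential is
    again a sum of products of the same kind; no combinatorial formula for higher derivatives of a
    composite is involved. *)
Lemma smooth_data_chain : smooth_data W (fun x => N 0 (f x)) (chain 0).
Proof.
apply smooth_data_intro.
- reflexivity.
- intros n x hx; now apply chain_additive.
- intros n x hx; now apply chain_homogeneous.
- intros n x hx; now apply chain_bounded.
- intros n x eps hx he; now apply chain_remainder.
Qed.

End Chain.

(** * Superposition operators as smooth maps on open subsets of [H^r] *)

Lemma periodic_range (u : R -> R) : (forall x, continuous u x) -> (forall x, u (x + 1) = u x) ->
  exists p q, forall x, u p <= u x <= u q.
Proof.
intros cu pu.
destruct (continuity_ab_min u 0 1 Rle_0_1) as [p [hp _]].
{ intros c _; apply continuity_pt_filterlim, cu. }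
destruct (continuity_ab_maj u 0 1 Rle_0_1) as [q [hq _]].
{ intros c _; apply continuity_pt_filterlim, cu. }
exists p, q; intros x.
rewrite <- (periodic_IZR u pu (- Int_part x) x), opp_IZR.
change (x + - IZR (Int_part x)) with (frac_part x).
destruct (base_fp x) as [h1 h2]; split; [apply hp | apply hq]; lra.
Qed.

(** Junk value [0] when [u] is not of class [H^r]. *)
Definition HR_of (r : R) (u : R -> R) : HR r :=
  match excluded_middle_informative (Hs r u) with
  | left h => exist _ u h
  | right _ => zero
  end.

Lemma fn_HR_of r u x : Hs r u -> fn (HR_of r u) x = u x.
Proof.
intros h; unfold HR_of; destruct (excluded_middle_informative _); [reflexivity | contradiction].
Qed.

(** Openness and convexity in the form in which they are used: the extreme values [p], [q] of a
    periodic function with values in [I] lie strictly inside a compact interval contained in [I]. *)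
Definition open_interval (I : R -> Prop) : Prop :=
  forall p q, I p -> I q -> exists a b, a < p /\ q < b /\ forall z, a <= z <= b -> I z.

Definition derivative_family (I : R -> Prop) (F : nat -> R -> R) : Prop :=
  (forall j x, I x -> is_derive (F j) x (F (S j) x)) /\ open_interval I.

Definition superpose (r : R) (F : nat -> R -> R) (j : nat) (u : HR r) : HR r :=
  HR_of r (fun x => F j (fn u x)).

Section Superpose.
Variable r : R.
Hypothesis hr : 3 / 2 < r.

Lemma half_lt : 1 / 2 < r.
Proof. lra. Qed.

(** The range of [u] is compact, and the supremum norm is at most [K] times the norm of [H^r]. A
    ball whose radius is below the two margins divided by [K] therefore keeps all values in
    [[a, b]]; the radius is also at most [1], whence the norm bound [norm u + 1]. *)
Lemma superpose_admissible I (u : HR r) : open_interval I -> (forall x, I (fn u x)) ->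
  exists a b M d, 0 < d /\ (forall z, a <= z <= b -> I z) /\
    forall v : HR r, norm (minus v u) < d -> admissible r a b M (fn v).
Proof.
intros hI hu.
destruct (periodic_range (fn u)) as [p [q hpq]].
{ apply (Hs_continuous r), Hs_fn. }
{ apply (Hs_periodic r), Hs_fn. }
destruct (hI (fn u p) (fn u q)) as [a [b [ha [hb hab]]]]; auto.
destruct (Hs_sup r half_lt) as [K [hK hsup]].
set (d := Rmin 1 (Rmin ((fn u p - a) / K) ((b - fn u q) / K))).
assert (h1 : 0 < (fn u p - a) / K) by (apply Rdiv_lt_0_compat; lra).
assert (h2 : 0 < (b - fn u q) / K) by (apply Rdiv_lt_0_compat; lra).
exists a, b, (norm u + 1), d; split; [repeat apply Rmin_glb_lt; lra|]; split; trivial.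
intros v hv.
assert (l1 : d <= 1) by apply Rmin_l.
assert (l2 : K * d <= fn u p - a).
{ apply Rle_trans with (K * ((fn u p - a) / K)); [|right; field; lra].
  apply Rmult_le_compat_l; [lra|].
  eapply Rle_trans; [apply Rmin_r | apply Rmin_l]. }
assert (l3 : K * d <= b - fn u q).
{ apply Rle_trans with (K * ((b - fn u q) / K)); [|right; field; lra].
  apply Rmult_le_compat_l; [lra|].
  eapply Rle_trans; [apply Rmin_r | apply Rmin_r]. }
split; [apply Hs_fn | split].
- rewrite <- norm_HR; replace v with (plus (minus v u) u)
    by (apply HR_ext; intros; rewrite fn_plus, fn_minus; rring).
  eapply Rle_trans; [apply norm_triangle | lra].
- intros x.
  assert (hx : Rabs (fn (minus v u) x) <= K * norm (minus v u))
    by (apply hsup, Hs_fn).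
  rewrite fn_minus in hx.
  assert (hx' : Rabs (fn v x - fn u x) <= K * d).
  { apply Rle_trans with (1 := hx), Rmult_le_compat_l; lra. }
  apply Rabs_le_between in hx'; generalize (hpq x); lra.
Qed.

Variables (I : R -> Prop) (F : nat -> R -> R).
Hypothesis hF : derivative_family I F.

Lemma fn_superpose (u : HR r) j x : (forall x, I (fn u x)) ->
  fn (superpose r F j u) x = F j (fn u x).
Proof.
intros hu; apply (fn_HR_of r (fun x => F j (fn u x))).
destruct (superpose_admissible I u (proj2 hF) hu) as [a [b [M [d [hd [hI hadm]]]]]].
destruct (superposition_Hs r hr F a b (fun j x h => proj1 hF j x (hI x h)) M j) as [C [_ hC]].
assert (hu' : admissible r a b M (fn u)).
{ apply hadm; replace (norm (minus u u)) with 0; trivial.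
  symmetry; rewrite minus_self_module; exact norm_zero. }
exact (proj1 (proj1 (hC _ _ hu' hu'))).
Qed.

Lemma superpose_derivative (u : HR r) j eps : (forall x, I (fn u x)) -> 0 < eps ->
  locally u (fun v => norm (minus (minus (superpose r F j v) (superpose r F j u))
    (hmul r half_lt (superpose r F (S j) u) (minus v u))) <= eps * norm (minus v u)).
Proof.
intros hu he.
destruct (superpose_admissible I u (proj2 hF) hu) as [a [b [M [d [hd [hI hadm]]]]]].
destruct (superposition_Hs r hr F a b (fun j x h => proj1 hF j x (hI x h)) M j) as [C [C0 hC]].
(* The Taylor remainder is at most [C t^2], hence at most [eps t] for [t] below this radius; [C + 1]
   avoids a division by [0]. *)
assert (hd' : 0 < eps / (C + 1)) by (apply Rdiv_lt_0_compat; lra).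
assert (hm : 0 < Rmin d (eps / (C + 1))) by now apply Rmin_glb_lt.
apply (locally_of_norm u _ _ hm); intros v hv.
assert (v1 : norm (minus v u) < d) by (apply Rlt_le_trans with (1 := hv), Rmin_l).
assert (v2 : norm (minus v u) < eps / (C + 1)) by (apply Rlt_le_trans with (1 := hv), Rmin_r).
assert (hu' : admissible r a b M (fn u)).
{ apply hadm; replace (norm (minus u u)) with 0; trivial.
  symmetry; rewrite minus_self_module; exact norm_zero. }
assert (hv' := hadm v v1).
assert (hIv : forall x, I (fn v x)) by (intros x; apply hI, hv').
destruct (proj2 (proj2 (hC _ _ hv' hu'))) as [_ h].
rewrite norm_HR.
match goal with |- Hn r ?g <= _ => replace g with (fun x =>
  F j (fn v x) - F j (fn u x) - F (S j) (fn u x) * (fn v x - fn u x)) end.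
- apply Rle_trans with (1 := h); change (Hn r _) with (norm (minus v u)).
  assert (t0 := norm_ge_0 (minus v u)); set (t := norm (minus v u)) in *.
  replace (C * t ^ 2) with (C * t * t) by ring.
  apply Rmult_le_compat_r; trivial.
  apply Rle_trans with ((C + 1) * (eps / (C + 1))); [|right; field; lra].
  apply Rmult_le_compat; lra.
- extensionality x; rewrite fn_minus, fn_minus, fn_hmul, fn_minus, !fn_superpose by trivial.
  reflexivity.
Qed.

End Superpose.

(** The openness of [W] is kept apart: it is established for each domain in turn, often from the
    smoothness of a map on a larger one. *)
Definition smooth {E F : NormedModule R_AbsRing} (W : E -> Prop) (f : E -> F) : Prop :=
  exists D, smooth_data W f D.

Section Smooth.
Context {E : NormedModule R_AbsRing}.
Variable W : E -> Prop.

Lemma smooth_ext {F : NormedModule R_AbsRing} (f g : E -> F) :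
  (forall x, W x -> f x = g x) -> smooth W f -> smooth W g.
Proof. intros h [D hD]; exists D; now apply (smooth_data_restrict W W f g). Qed.

Lemma smooth_subset {F : NormedModule R_AbsRing} (W' : E -> Prop) (f : E -> F) :
  (forall x, W x -> W' x) -> smooth W' f -> smooth W f.
Proof. intros h [D hD]; exists D; now apply (smooth_data_restrict W' W f f). Qed.

Lemma smooth_plus {F : NormedModule R_AbsRing} (f g : E -> F) :
  smooth W f -> smooth W g -> smooth W (fun x => plus (f x) (g x)).
Proof.
intros [D hD] [D' hD']; exact (ex_intro _ _ (smooth_data_plus W f g D D' hD hD')).
Qed.

Lemma smooth_linear {F : NormedModule R_AbsRing} (L : E -> F) : is_linear L -> smooth W L.
Proof. intros h; eexists; now apply smooth_data_linear. Qed.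

Lemma smooth_const {F : NormedModule R_AbsRing} (c : F) : smooth W (fun _ => c).
Proof. eexists; apply smooth_data_const. Qed.

Lemma smooth_linear_comp {F G : NormedModule R_AbsRing} (L : F -> G) (f : E -> F) :
  is_linear L -> smooth W f -> smooth W (fun x => L (f x)).
Proof.
intros hL [D hD]; exact (ex_intro _ _ (smooth_data_linear_comp W f D L hL hD)).
Qed.

Variable r : R.

Lemma smooth_mult hr (f g : E -> HR r) : smooth W f -> smooth W g ->
  smooth W (fun x => hmul r hr (f x) (g x)).
Proof.
intros [D hD] [D' hD']; exact (ex_intro _ _ (smooth_data_mult r hr W f g D D' hD hD')).
Qed.

Lemma smooth_superpose (hr : 3 / 2 < r) I F j (f : E -> HR r) : open W ->
  derivative_family I F -> (forall y, W y -> forall x, I (fn (f y) x)) ->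
  smooth W f -> smooth W (fun y => superpose r F j (f y)).
Proof.
intros hW hF hI [D hD].
(* The family is shifted by [j], so that the chain rule, stated for index [0], starts from [F j]. *)
exists (chain r (half_lt r hr) (fun i => superpose r F (j + i)) f D 0).
assert (h := smooth_data_chain (E := E) r (half_lt r hr) (fun i => superpose r F (j + i))
  (fun u => forall x, I (fn u x))).
cbv beta in h; rewrite Nat.add_0_r in h; apply h; trivial.
intros i a ha eps he; rewrite Nat.add_succ_r.
now apply (superpose_derivative r hr I F hF).
Qed.

End Smooth.

(** A smooth [f] is locally Lipschitz, and values in [I] persist under small perturbations in [H^r].
    The domains of all local expressions are obtained by iterating this lemma. *)
Lemma open_pointwise {E : NormedModule R_AbsRing} r (hr : 3 / 2 < r) (W : E -> Prop) I
    (f : E -> HR r) : open W -> open_interval I -> smooth W f ->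
  open (fun y => W y /\ forall x, I (fn (f y) x)).
Proof.
intros hW hI [D hD] y [hy hIy].
destruct (superpose_admissible r hr I (f y) hI hIy) as [a [b [M [d [hd [hab hadm]]]]]].
destruct (smooth_data_continuous W f D y hW hD hy) as [C [hC hc]].
assert (h3 : 0 < d / C) by now apply Rdiv_lt_0_compat.
generalize (filter_and _ _ hc (locally_small y _ h3)); apply filter_imp.
intros z [[hz [_ hl]] hs]; split; trivial; intros x; apply hab, (hadm (f z)).
apply Rle_lt_trans with (1 := hl).
apply Rlt_le_trans with (C * (d / C)); [now apply Rmult_lt_compat_l | right; field; lra].
Qed.

(** * The functions that are superposed, with all their derivatives *)

Lemma open_interval_pos : open_interval (fun x => 0 < x).
Proof. intros p q hp hq; exists (p / 2), (q + 1); repeat split; try lra; intros; lra. Qed.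

Lemma open_interval_all : open_interval (fun _ => True).
Proof. intros p q _ _; exists (p - 1), (q + 1); repeat split; trivial; lra. Qed.

Lemma open_interval_Rabs c : open_interval (fun x => Rabs x < c).
Proof.
intros p q hp hq; apply Rabs_def2 in hp; apply Rabs_def2 in hq.
exists ((p - c) / 2), ((q + c) / 2); repeat split; try lra.
intros z hz; apply Rabs_def1; lra.
Qed.

(** The falling factorial [a (a - 1) ... (a - j + 1)] times [x^(a - j)]; [a = 1 / 2] gives the
    square root and [a = -1] the inverse. *)
Definition power_family (a : R) (j : nat) (x : R) : R :=
  fold_right (fun i p => (a - INR i) * p) 1 (seq 0 j) * Rpower x (a - INR j).

Lemma derivative_family_power a : derivative_family (fun x => 0 < x) (power_family a).
Proof.
split.
- intros j x hx; unfold power_family; rewrite seq_S.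
  rewrite fold_right_app; cbn [fold_right].
  assert (e : forall l c, fold_right (fun i p => (a - INR i) * p) c l =
    fold_right (fun i p => (a - INR i) * p) 1 l * c).
  { induction l as [|i l IH]; intros c; simpl; [ring | rewrite IH; ring]. }
  rewrite (e _ ((a - INR (0 + j)) * 1)), Nat.add_0_l.
  set (c := fold_right _ 1 _).
  apply (is_derive_eq _ _ (c * ((a - INR j) * Rpower x (a - INR j - 1)))).
  + apply is_derive_scal; apply is_derive_Reals; now apply derivable_pt_lim_power.
  + rewrite S_INR; replace (a - (INR j + 1)) with (a - INR j - 1) by ring; rring.
- apply open_interval_pos.
Qed.

(** Each derivative advances the phase by [PI / 2]; the sine is the member of phase
    [c = - PI / 2]. *)
Definition cos_family (c : R) (j : nat) (x : R) : R := cos (x + c + INR j * (PI / 2)).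

Lemma derivative_family_cos c : derivative_family (fun _ => True) (cos_family c).
Proof.
split.
- intros j x _; unfold cos_family; rewrite S_INR.
  replace (x + c + (INR j + 1) * (PI / 2)) with (PI / 2 + (x + c + INR j * (PI / 2))) by ring.
  set (y := x + c + INR j * (PI / 2)).
  replace (cos (PI / 2 + y)) with (- sin y) by (rewrite sin_cos; ring).
  unfold y; auto_derive; [trivial | rring].
- apply open_interval_all.
Qed.

(* With [theta = atan x], so that [d theta / d x = cos theta ^ 2]. *)
Definition atan_family (j : nat) (x : R) : R :=
  match j with
  | O => atan x
  | S n => INR (fact n) * (cos (atan x) ^ S n * sin (INR (S n) * (atan x + PI / 2)))
  end.

Lemma cos_atan_sq x : cos (atan x) ^ 2 = / (1 + x ^ 2).
Proof.
assert (h0 : 0 < cos (atan x)) by (destruct (atan_bound x); apply cos_gt_0; lra).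
assert (ht := tan_atan x).
unfold tan in ht.
assert (hs : sin (atan x) = x * cos (atan x)) by (rewrite <- ht at 2; field; lra).
generalize (sin2_cos2 (atan x)); unfold Rsqr; rewrite hs; intros e.
assert (hp : 0 < 1 + x ^ 2) by (generalize (pow2_ge_0 x); lra).
apply (Rmult_eq_reg_r (1 + x ^ 2)); [|lra].
rewrite Rinv_l by lra; apply (eq_trans (y := x * cos (atan x) * (x * cos (atan x)) + cos (atan x) * cos (atan x))); [ring | exact e].
Qed.

Lemma derivative_family_atan : derivative_family (fun _ => True) atan_family.
Proof.
split.
- intros j x _.
  assert (da : is_derive atan x (cos (atan x) ^ 2)).
  { rewrite cos_atan_sq; apply is_derive_Reals, derivable_pt_lim_atan. }
  destruct j as [|n].
  + apply (is_derive_eq _ _ _ _ da); unfold atan_family.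
    change (INR (fact 0)) with 1; change (INR 1) with 1.
    rewrite !Rmult_1_l, (Rplus_comm (atan x)), <- cos_sin; rring.
  + set (m := S n).
    assert (e : forall t, is_derive (fun t => cos t ^ m * sin (INR m * (t + PI / 2))) t
      (INR m * (cos t ^ n * (cos t * cos (INR m * (t + PI / 2)) -
        sin t * sin (INR m * (t + PI / 2)))))).
    { intros t; unfold m; auto_derive; [trivial|]. change (match n with O => 1 | S _ => INR n + 1 end) with (INR (S n)); rring. }
    assert (h := is_derive_Rcomp _ atan x _ _ (e (atan x)) da).
    apply (is_derive_scal _ _ (INR (fact n))) in h.
    apply (is_derive_eq _ _ _ _ h); unfold atan_family; fold m.
    replace (sin (INR (S m) * (atan x + PI / 2))) with
      (cos (atan x) * cos (INR m * (atan x + PI / 2)) -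
       sin (atan x) * sin (INR m * (atan x + PI / 2))).
    * replace (fact m) with (m * fact n)%nat by reflexivity; rewrite mult_INR.
      unfold m; cbn [pow]; rring.
    * rewrite <- cos_plus, S_INR.
      replace ((INR m + 1) * (atan x + PI / 2)) with
        (PI / 2 + (atan x + INR m * (atan x + PI / 2))) by ring.
      now rewrite <- cos_sin.
- apply open_interval_all.
Qed.

(** * Linear maps between the model spaces *)

Lemma is_sobolev_rotate r (c : C) f : Cmod c = 1 -> is_sobolev r f ->
  is_sobolev r (fun x => Cmult c (f x)) /\
  sobolev_norm r (fun x => Cmult c (f x)) = sobolev_norm r f.
Proof.
intros hc [cf [pf sf]].
assert (ht : forall n, sobolev_term r f n = sobolev_term r (fun x => Cmult c (f x)) n).
{ intros n; unfold sobolev_term; rewrite !fourier_Cmult, !Cmod_mult, hc by trivial.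
  now rewrite !Rmult_1_l. }
split; [split; [|split]|].
- intros x; cont.
- intros x; now rewrite pf.
- exact (ex_series_ext (sobolev_term r f) _ ht sf).
- unfold sobolev_norm; rewrite (Series_ext _ _ ht).
  apply (f_equal (fun a => sqrt (a + _))).
  apply RInt_ext; intros x _; now rewrite Cmod_mult, hc, Rmult_1_l.
Qed.

Definition pairC (a b : R -> R) : R -> C := fun x => (a x, b x).

Lemma pairCE a b : pairC a b = fun x => Cplus (toC a x) (Cmult Ci (toC b x)).
Proof.
extensionality x; unfold pairC, toC, Ci, RtoC, Cplus, Cmult; simpl; f_equal; ring.
Qed.

Lemma Cmod_Ci : Cmod Ci = 1.
Proof. unfold Ci; rewrite Cmod_imag; apply Rabs_R1. Qed.

Lemma is_sobolev_pairC r a b : Hs r a -> Hs r b ->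
  is_sobolev r (pairC a b) /\ sobolev_norm r (pairC a b) <= Hn r a + Hn r b.
Proof.
intros ha hb; rewrite pairCE.
destruct (is_sobolev_rotate r Ci (toC b) Cmod_Ci hb) as [h1 h2].
split; [exact (is_sobolev_plus r _ _ ha h1)|].
eapply Rle_trans; [exact (sobolev_norm_plus r _ _ ha h1) | rewrite h2; apply Rle_refl].
Qed.

(** Common part of the bounds for [Re f] and [Im f]: their coefficients mix those of [f] at [n] and
    [- n], which carry the same weight and are paired in [sobolev_term]. *)
Lemma fourier_half_sum r (f : R -> C) (g : R -> R) : is_sobolev r f ->
  (forall x, continuous g x) -> (forall x, g (x + 1) = g x) ->
  (forall x, Rabs (g x) <= Cmod (f x)) ->
  (forall n, Cmod (fourier (toC g) n) <= / 2 * (Cmod (fourier f n) + Cmod (fourier f (- n)))) ->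
  Hs r g /\ Hn r g <= sobolev_norm r f.
Proof.
intros [cf [pf sf]] cg pg hle hn.
assert (h : forall n, 0 <= sobolev_term r (toC g) n <= sobolev_term r f n).
{ intros n; split; [apply sobolev_term_ge0|]; apply Rmult_le_compat_l; [left; apply exp_pos|].
  set (m := Z.of_nat (S n)).
  assert (h1 := hn m); assert (h2 := hn (- m)%Z); rewrite Z.opp_involutive in h2.
  assert (h3 := pow_incr _ _ 2 (conj (Cmod_ge_0 _) h1)).
  assert (h4 := pow_incr _ _ 2 (conj (Cmod_ge_0 _) h2)).
  generalize (pow2_ge_0 (Cmod (fourier f m) - Cmod (fourier f (- m)%Z))); nra. }
split.
- split; [intros; now apply continuous_toC | split].
  + intros x; unfold toC; now rewrite pg.
  + apply (ex_series_le (V := R_CompleteNormedModule)) with (2 := sf).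
    intros n; change (norm ?x) with (Rabs x); rewrite Rabs_pos_eq; apply h.
- apply sqrt_le_1_alt, Rplus_le_compat; [|now apply Series_le].
  apply RInt_le; [lra | | |].
  + apply continuous_ex_RInt; intros; cont.
  + apply continuous_ex_RInt; intros; cont.
  + intros x _; unfold toC; rewrite Cmod_R; apply pow_incr; split; [apply Rabs_pos | apply hle].
Qed.

Lemma Hs_Re r f : is_sobolev r f ->
  Hs r (fun x => Re (f x)) /\ Hn r (fun x => Re (f x)) <= sobolev_norm r f.
Proof.
intros hf; assert (h := hf); destruct h as [cf [pf _]].
apply (fourier_half_sum r f); trivial.
- intros; cont.
- intros x; now rewrite pf.
- intros; apply Rabs_Re_le.
- intros n; rewrite fourier_Re, Cmod_mult, Cmod_R, Rabs_pos_eq by (trivial; lra).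
  apply Rmult_le_compat_l; [lra|]; rewrite <- (Cmod_conj (fourier f (- n))).
  apply Cmod_triangle.
Qed.

Lemma Hs_Im r f : is_sobolev r f ->
  Hs r (fun x => Im (f x)) /\ Hn r (fun x => Im (f x)) <= sobolev_norm r f.
Proof.
intros hf; assert (h := hf); destruct h as [cf [pf _]].
apply (fourier_half_sum r f); trivial.
- intros; cont.
- intros x; now rewrite pf.
- intros; apply Rabs_Im_le.
- intros n; rewrite fourier_Im, Cmod_mult, Cmod_imag, Rabs_Ropp, Rabs_pos_eq by (trivial; lra).
  apply Rmult_le_compat_l; [lra|]; rewrite <- (Cmod_conj (fourier f (- n))).
  rewrite <- (Cmod_opp (Cconj _)); apply Cmod_triangle.
Qed.

(** All coefficients but one vanish. The case [k = 0] gives the constants, and general [k] the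
    factor that a map to the circle of degree [k] contributes. *)
Lemma is_sobolev_expi r k : is_sobolev r (expi k).
Proof.
destruct (sobolev_intro r (expi k) 1 (root_weight r k)) as [h _]; trivial.
- intros; cont.
- intros; apply expi_periodic.
- intros; rewrite Cmod_expi; lra.
- left; apply root_weight_pos.
- intros l nd; rewrite root_weight_sq; unfold sobolev_sum.
  induction nd as [|n l hn nd IH]; [left; apply weight_pos|].
  rewrite lsum_cons, fourier_expi; destruct (Z.eq_dec n k) as [->|ne].
  + rewrite (lsum_ext _ (fun _ => 0)), lsum_zero, Cmod_1; [right; ring|].
    intros m hm; rewrite fourier_expi; destruct (Z.eq_dec m k); [subst; contradiction|].
    rewrite Cmod_0; ring.
  + rewrite Cmod_0; replace (weight r n * 0 ^ 2 + _) with
      (lsum (fun n => weight r n * Cmod (fourier (expi k) n) ^ 2) l) by ring; exact IH.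
Qed.

Lemma Hs_one r : Hs r (fun _ => 1).
Proof.
destruct (Hs_Re r _ (is_sobolev_expi r 0)) as [h _].
now replace (fun _ : R => 1) with (fun x => Re (expi 0 x)) by
  (extensionality x; now rewrite expi_0).
Qed.

Lemma Hs_const r c : Hs r (fun _ => c) /\ Hn r (fun _ => c) = Rabs c * Hn r (fun _ => 1).
Proof.
destruct (Hs_scal r c _ (Hs_one r)) as [h1 h2].
replace (fun _ : R => c) with (fun _ : R => c * 1) by (extensionality x; ring).
now split.
Qed.

Definition mean (u : R -> R) : R := RInt u 0 1.

Lemma Rabs_mean_le r : 1 / 2 < r -> exists K, 0 < K /\
  forall u, Hs r u -> Rabs (mean u) <= K * Hn r u.
Proof.
intros hr; destruct (Hs_sup r hr) as [K [hK h]]; exists K; split; trivial.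
intros u hu; rewrite <- (Rmult_1_l (K * Hn r u)); replace 1 with (1 - 0) at 1 by ring.
apply abs_RInt_le_const; [lra | | intros; now apply h].
apply continuous_ex_RInt, (Hs_continuous r u hu).
Qed.

Lemma mean_plus (u v : R -> R) : (forall x, continuous u x) -> (forall x, continuous v x) ->
  mean (fun x => u x + v x) = mean u + mean v.
Proof.
intros hu hv; apply (RInt_plus (V := R_CompleteNormedModule)); now apply continuous_ex_RInt.
Qed.

Lemma mean_scal (a : R) (u : R -> R) : (forall x, continuous u x) -> mean (fun x => a * u x) = a * mean u.
Proof.
intros hu; apply (RInt_scal (V := R_CompleteNormedModule)); now apply continuous_ex_RInt.
Qed.

Lemma mean_const c : mean (fun _ => c) = c.
Proof. unfold mean; rewrite RInt_const; exact (Rmult_1_l' c) || (change ((1 - 0) * c = c); ring). Qed.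

Section LinearMaps.
Variable s : R.
Hypothesis hs : 5 / 2 < s.
Let r := s - 1.

Lemma hr_half : 1 / 2 < s - 1.
Proof. lra. Qed.

Lemma hr_three_halves : 3 / 2 < s - 1.
Proof. lra. Qed.

Lemma Hs_derive_s : exists K, 0 < K /\
  forall u, Hs s u ->
    (forall x, is_derive u x (Derive u x)) /\ Hs (s - 1) (Derive u) /\
    Hn (s - 1) (Derive u) <= K * Hn s u.
Proof.
destruct (Hs_derive (s - 1) hr_half) as [K h]; exists K.
now replace (s - 1 + 1) with s in h by ring.
Qed.

Lemma Hs_Derive u : Hs s u -> Hs (s - 1) (Derive u).
Proof. intros hu; destruct Hs_derive_s as [K [_ h]]; exact (proj1 (proj2 (h u hu))). Qed.

Lemma Hs_is_derive u : Hs s u -> forall x, is_derive u x (Derive u x).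
Proof. intros hu; destruct Hs_derive_s as [K [_ h]]; exact (proj1 (h u hu)). Qed.

Lemma HR0_mem (v : HR0 s) : Hs s (fn v) /\ fn v 0 = 0.
Proof. exact (proj2_sig v). Qed.

Lemma Hperp_mem (h : Hperp (s - 1)) :
  is_sobolev (s - 1) (fn h) /\ Re (RInt (V := CC) (fn h) 0 1) = 0.
Proof. exact (proj2_sig h). Qed.

Definition deriv_map (v : HR0 s) : HR (s - 1) :=
  exist _ (Derive (fn v)) (Hs_Derive _ (proj1 (HR0_mem v))).

Lemma is_linear_deriv_map : is_linear deriv_map.
Proof.
split.
- intros u v; apply HR_ext; intros x; rewrite fn_plus.
  apply is_derive_unique.
  apply (is_derive_Rplus (fn u) (fn v)); apply Hs_is_derive, HR0_mem.
- intros a u; apply HR_ext; intros x.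
  apply is_derive_unique; apply (is_derive_scal (fn u)); apply Hs_is_derive, HR0_mem.
- destruct Hs_derive_s as [K [hK h]]; exists K; split; trivial.
  intros u; exact (proj2 (proj2 (h (fn u) (proj1 (HR0_mem u))))).
Qed.

(** The mean is kept as a constant function, so that scalars such as inner products and denominators
    remain in [HR (s - 1)] and are handled by the same product and superposition operators. *)
Definition mean_map (u : HR (s - 1)) : HR (s - 1) :=
  exist _ (fun _ => mean (fn u)) (proj1 (Hs_const (s - 1) (mean (fn u)))).

Lemma fn_continuous rho (u : HR rho) x : continuous (fn u) x.
Proof. apply (Hs_continuous rho), Hs_fn. Qed.

Lemma is_linear_mean_map : is_linear mean_map.
Proof.
split.
- intros u v; apply HR_ext; intros x; rewrite fn_plus.
  apply (mean_plus (fn u) (fn v)); intros; apply fn_continuous.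
- intros a u; apply HR_ext; intros x.
  apply (mean_scal a (fn u)); intros; apply fn_continuous.
- destruct (Rabs_mean_le (s - 1) hr_half) as [K [hK h]].
  assert (p : 0 <= Hn (s - 1) (fun _ => 1)) by apply Hn_ge0.
  exists (K * (Hn (s - 1) (fun _ => 1) + 1)); split; [apply Rmult_lt_0_compat; lra|].
  intros u; rewrite norm_HR; change (fn (mean_map u)) with (fun _ : R => mean (fn u)).
  rewrite (proj2 (Hs_const (s - 1) _)).
  assert (h1 := h (fn u) (Hs_fn _ u)); rewrite <- norm_HR in h1.
  assert (n0 := norm_ge_0 u).
  apply Rle_trans with (K * norm u * Hn (s - 1) (fun _ => 1)); [now apply Rmult_le_compat_r|].
  assert (0 <= K * norm u) by (apply Rmult_le_pos; lra); lra.
Qed.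

(** Subtracting the mean makes the primitive periodic, hence bounded, and [Hs_primitive] then gains
    one derivative. *)
Lemma Hs_mean_free_primitive (u : R -> R) : Hs (s - 1) u ->
  (forall x, is_derive (fun x => RInt (fun t => u t - mean u) 0 x) x (u x - mean u)) /\
  Hs s (fun x => RInt (fun t => u t - mean u) 0 x).
Proof.
intros hu; set (w := fun t => u t - mean u).
assert (cu := Hs_continuous _ _ hu); assert (pu := Hs_periodic _ _ hu).
assert (cw : forall x, continuous w x) by (intros; unfold w; cont).
assert (hw : Hs (s - 1) w) by (apply Hs_minus; [trivial | apply Hs_const]).
assert (d : forall x, is_derive (fun x => RInt w 0 x) x (w x))
  by (intros; now apply is_derive_primitive).
split; [exact d|].
assert (p : forall x, RInt w 0 (x + 1) = RInt w 0 x).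
{ apply primitive_periodic; trivial.
  - intros x; unfold w; now rewrite pu.
  - change (mean (fun t => u t - mean u) = 0).
    transitivity (mean u - mean (fun _ => mean u)); [|rewrite mean_const; ring].
    apply (RInt_minus (V := R_CompleteNormedModule)); apply continuous_ex_RInt; trivial.
    intros; cont. }
destruct (periodic_range (fun x => RInt w 0 x)
  (fun x => is_derive_continuous _ _ _ (d x)) p) as [a [b hab]].
set (M := Rmax (Rabs (RInt w 0 a)) (Rabs (RInt w 0 b))).
assert (hM : forall x, Rabs (RInt w 0 x) <= M).
{ intros x; destruct (hab x) as [h1 h2].
  generalize (Rmax_l (Rabs (RInt w 0 a)) (Rabs (RInt w 0 b)))
    (Rmax_r (Rabs (RInt w 0 a)) (Rabs (RInt w 0 b)))
    (Rle_abs (RInt w 0 b)) (Rle_abs (- RInt w 0 a)).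
  rewrite Rabs_Ropp; intros; apply Rabs_le; unfold M; lra. }
generalize (proj1 (Hs_primitive (s - 1) (fun x => RInt w 0 x) w M d p hM hw)).
replace (s - 1 + 1) with s by ring; exact (fun h => h).
Qed.

Lemma primitive_mem (u : HR (s - 1)) :
  ns_mem (sobolev_R0 s) (fun x => RInt (fun t => fn u t - mean (fn u)) 0 x).
Proof.
split; [apply (Hs_mean_free_primitive (fn u)), Hs_fn|].
exact (RInt_point (V := R_CompleteNormedModule) 0 _).
Qed.

Definition primitive_map (u : HR (s - 1)) : HR0 s := exist _ _ (primitive_mem u).

(** For the bound, the integrand is at most [(L + K) * norm u], and so is the primitive on [[0, 1]];
    periodicity extends this to the line, where [Hs_primitive] applies. *)
Lemma is_linear_primitive_map : is_linear primitive_map.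
Proof.
assert (ex : forall (u : HR (s - 1)) a b, ex_RInt (fun t => fn u t - mean (fn u)) a b).
{ intros u a b; apply continuous_ex_RInt; intros x.
  apply continuous_Rminus; [apply fn_continuous | apply continuous_const]. }
split.
- intros u v; apply ns_ext; extensionality x.
  transitivity (RInt (fun t => plus (fn u t - mean (fn u)) (fn v t - mean (fn v))) 0 x).
  + apply RInt_ext; intros t _; change (fn (plus u v) t) with (fn u t + fn v t).
    change (mean (fn (plus u v))) with (mean (fun t => fn u t + fn v t)).
    rewrite (mean_plus (fn u) (fn v)) by (intros; apply fn_continuous).
    change plus with Rplus; rring.
  + apply (RInt_plus (V := R_CompleteNormedModule)); apply ex.
- intros a u; apply ns_ext; extensionality x.
  transitivity (RInt (fun t => scal a (fn u t - mean (fn u))) 0 x).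
  + apply RInt_ext; intros t _; change (fn (scal a u) t) with (a * fn u t).
    change (mean (fn (scal a u))) with (mean (fun t => a * fn u t)).
    rewrite (mean_scal a (fn u)) by (intros; apply fn_continuous).
    change (@scal _ _ ?p ?q) with (p * q); rring.
  + apply (RInt_scal (V := R_CompleteNormedModule)); apply ex.
- destruct (Rabs_mean_le (s - 1) hr_half) as [K [hK hm]].
  destruct (Hs_sup (s - 1) hr_half) as [L [hL hsup]].
  assert (p0 : 0 <= Hn (s - 1) (fun _ => 1)) by apply Hn_ge0.
  set (p := Hn (s - 1) (fun _ => 1)) in *.
  assert (q0 : 0 <= K * p) by (apply Rmult_le_pos; lra).
  exists (L + K + 1 + K * p); split; [lra|].
  intros u; assert (n0 := norm_ge_0 u).
  assert (hu := Hs_fn _ u).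
  assert (m1 := hm _ hu); rewrite <- norm_HR in m1.
  set (w := fun t => fn u t - mean (fn u)).
  assert (hw : Hs (s - 1) w /\ Hn (s - 1) w <= norm u + K * norm u * p).
  { destruct (Hs_const (s - 1) (mean (fn u))) as [c1 c2].
    destruct (Hs_minus (s - 1) (fn u) (fun _ => mean (fn u)) hu c1) as [h1 h2].
    split; trivial; apply Rle_trans with (1 := h2), Rplus_le_compat; [apply Rle_refl|].
    rewrite c2; now apply Rmult_le_compat_r. }
  destruct hw as [hw nw].
  destruct (Hs_mean_free_primitive (fn u) hu) as [d hp]; fold w in d, hp.
  assert (pp := Hs_periodic _ _ hp); cbv beta in pp.
  assert (b01 : forall x, 0 <= x <= 1 -> Rabs (RInt w 0 x) <= (L + K) * norm u).
  { intros x hx; apply Rle_trans with ((x - 0) * ((L + K) * norm u)).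
    - apply abs_RInt_le_const; [lra | apply ex |]; intros t _.
      unfold w; eapply Rle_trans; [apply Rabs_triang|]; rewrite Rabs_Ropp.
      assert (h1 := hsup _ hu t); rewrite <- norm_HR in h1; lra.
    - rewrite <- (Rmult_1_l ((L + K) * norm u)) at 2; apply Rmult_le_compat_r; [|lra].
      apply Rmult_le_pos; lra. }
  assert (ball : forall x, Rabs (RInt w 0 x) <= (L + K) * norm u).
  { intros x; rewrite <- (periodic_IZR (fun x => RInt w 0 x) pp (- Int_part x) x), opp_IZR.
    change (x + - IZR (Int_part x)) with (frac_part x).
    destruct (base_fp x); apply b01; lra. }
  destruct (Hs_primitive (s - 1) (fun x => RInt w 0 x) w _ d pp ball hw) as [_ h].
  replace (s - 1 + 1) with s in h by ring.
  apply Rle_trans with (1 := h); lra.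
Qed.

End LinearMaps.

(** * The map [Phi] in coordinates *)

Section Operations.
Variable r : R.
Hypothesis hr : 3 / 2 < r.

Definition hsqrt : HR r -> HR r := superpose r (power_family (/ 2)) 0.
Definition hinv : HR r -> HR r := superpose r (power_family (-1)) 0.
Definition hcos : HR r -> HR r := superpose r (cos_family 0) 0.
Definition hsin : HR r -> HR r := superpose r (cos_family (- (PI / 2))) 0.
Definition hatan : HR r -> HR r := superpose r atan_family 0.

Lemma fn_hsqrt u x : (forall x, 0 < fn u x) -> fn (hsqrt u) x = sqrt (fn u x).
Proof.
intros hu; unfold hsqrt.
rewrite (fn_superpose r hr _ _ (derivative_family_power (/ 2)) u 0 x hu).
unfold power_family; simpl; rewrite Rminus_0_r, Rmult_1_l; now apply Rpower_sqrt.
Qed.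

Lemma fn_hinv u x : (forall x, 0 < fn u x) -> fn (hinv u) x = / fn u x.
Proof.
intros hu; unfold hinv.
rewrite (fn_superpose r hr _ _ (derivative_family_power (-1)) u 0 x hu).
unfold power_family; simpl; rewrite Rminus_0_r, Rmult_1_l.
replace (-1) with (- (1)) by ring; rewrite Rpower_Ropp, Rpower_1; trivial.
Qed.

Lemma fn_hcos u x : fn (hcos u) x = cos (fn u x).
Proof.
unfold hcos; rewrite (fn_superpose r hr _ _ (derivative_family_cos 0) u 0 x (fun _ => Logic.I)).
unfold cos_family; f_equal; simpl; ring.
Qed.

Lemma fn_hsin u x : fn (hsin u) x = sin (fn u x).
Proof.
unfold hsin.
rewrite (fn_superpose r hr _ _ (derivative_family_cos _) u 0 x (fun _ => Logic.I)).
unfold cos_family; simpl; rewrite <- (cos_shift (fn u x)), <- cos_neg; f_equal; ring.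
Qed.

Lemma fn_hatan u x : fn (hatan u) x = atan (fn u x).
Proof.
exact (fn_superpose r hr _ _ derivative_family_atan u 0 x (fun _ => Logic.I)).
Qed.

Context {E : NormedModule R_AbsRing}.
Variable W : E -> Prop.
Hypothesis hW : open W.

Lemma smooth_hsqrt (f : E -> HR r) : (forall y, W y -> forall x, 0 < fn (f y) x) ->
  smooth W f -> smooth W (fun y => hsqrt (f y)).
Proof. intros hp hf; exact (smooth_superpose W r hr _ _ 0 f hW (derivative_family_power _) hp hf). Qed.

Lemma smooth_hinv (f : E -> HR r) : (forall y, W y -> forall x, 0 < fn (f y) x) ->
  smooth W f -> smooth W (fun y => hinv (f y)).
Proof. intros hp hf; exact (smooth_superpose W r hr _ _ 0 f hW (derivative_family_power _) hp hf). Qed.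

Lemma smooth_hcos (f : E -> HR r) : smooth W f -> smooth W (fun y => hcos (f y)).
Proof.
exact (smooth_superpose W r hr _ _ 0 f hW (derivative_family_cos _) (fun _ _ _ => Logic.I)).
Qed.

Lemma smooth_hsin (f : E -> HR r) : smooth W f -> smooth W (fun y => hsin (f y)).
Proof.
exact (smooth_superpose W r hr _ _ 0 f hW (derivative_family_cos _) (fun _ _ _ => Logic.I)).
Qed.

Lemma smooth_hatan (f : E -> HR r) : smooth W f -> smooth W (fun y => hatan (f y)).
Proof.
exact (smooth_superpose W r hr _ _ 0 f hW derivative_family_atan (fun _ _ _ => Logic.I)).
Qed.

Lemma is_linear_hscal (c : R) : is_linear (fun u : HR r => scal c u).
Proof. apply (is_linear_scal_r (V := HR r) c); intros; apply Rmult_comm. Qed.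

Lemma smooth_minus (f g : E -> HR r) : smooth W f -> smooth W g ->
  smooth W (fun y => minus (f y) (g y)).
Proof.
intros hf hg.
apply (smooth_ext W (fun y => plus (f y) (scal (-1) (g y)))).
- intros y _; apply HR_ext; intros x; rewrite fn_plus, fn_scal, fn_minus; rring.
- apply smooth_plus; trivial.
  now apply (smooth_linear_comp W (fun u : HR r => scal (-1) u)); [apply is_linear_hscal|].
Qed.

End Operations.

(** Halving the lift [4 PI k x + u] gives [2 PI k x + u / 2]. The first term contributes the
    periodic exponential [expi k] and the second a superposition by cosine and sine, so the product
    is in [H^r] for every degree [k]. *)
Lemma half_exp_components r alpha : 3 / 2 < r -> is_sobolev_circle r alpha ->
  Hs r (fun x => Re (half_exp (alpha x))) /\ Hs r (fun x => Im (half_exp (alpha x))).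
Proof.
intros hr [k [u [hu ha]]].
set (v := scal (1 / 2) (HR_of r u) : HR r).
assert (hv : forall x, fn v x = u x / 2).
{ intros x; unfold v; rewrite fn_scal, fn_HR_of by exact hu; rfield. }
assert (he : forall x, half_exp (alpha x) =
  Cmult (expi k x) (fn (hcos r v) x, fn (hsin r v) x)).
{ intros x; rewrite ha, half_exp_angle, fn_hcos, fn_hsin, hv by trivial.
  change (cos (u x / 2), sin (u x / 2)) with (cis (u x / 2)).
  unfold expi; rewrite <- cis_plus; f_equal; field. }
assert (h : is_sobolev r (fun x => half_exp (alpha x))).
{ replace (fun x => half_exp (alpha x)) with
    (fun x => Cmult (expi k x) (pairC (fn (hcos r v)) (fn (hsin r v)) x))
    by (extensionality x; symmetry; apply he).
  destruct (sobolev_algebra r) as [K [_ hK]]; [lra|].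
  apply hK; [apply is_sobolev_expi | apply is_sobolev_pairC; apply Hs_fn]. }
split; [now apply Hs_Re | now apply Hs_Im].
Qed.

Lemma half_exp_shift a t : half_exp (circle_shift a t) = Cmult (half_exp a) (cis (t / 2)).
Proof.
unfold circle_shift; rewrite half_exp_angle; unfold half_exp; rewrite <- cis_plus.
f_equal; field.
Qed.

Lemma Cmod_half_exp a : Cmod (half_exp a) = 1.
Proof. apply Cmod_cis. Qed.

Lemma angle_representative a : angle (representative a) = a.
Proof.
apply circle4pi_eq; rewrite representative_angle.
assert (h := representative_bounds a); generalize PI_RGT_0; intros hpi.
replace (Int_part (representative a / (4 * PI))) with 0%Z; [ring|].
apply (Int_part_spec (representative a / (4 * PI)) 0).
split.
- apply (Rmult_lt_reg_r (4 * PI)); [lra|].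
  replace ((representative a / (4 * PI) - 1) * (4 * PI)) with (representative a - 4 * PI)
    by (field; lra); lra.
- apply Rmult_le_pos; [lra | left; apply Rinv_0_lt_compat; lra].
Qed.

Lemma circle_shift_0 a : circle_shift a 0 = a.
Proof. unfold circle_shift; rewrite Rplus_0_r; apply angle_representative. Qed.

Lemma circle_shift_angle a t : circle_shift (angle a) t = angle (a + t).
Proof.
apply angle_eq; rewrite representative_angle.
eexists (- _)%Z; rewrite opp_IZR; ring.
Qed.

Lemma cis_eq_1 t : cis t = RtoC 1 -> exists k : Z, t = 2 * PI * IZR k.
Proof.
intros h; injection h; intros _ hc.
replace t with (2 * (t / 2)) in hc by field; rewrite cos_2a_sin in hc.
assert (hs : sin (t / 2) = 0) by (apply Rsqr_0_uniq; unfold Rsqr; lra).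
destruct (sin_eq_0_0 _ hs) as [k hk]; exists k; lra.
Qed.

Lemma cis_inj t t' : cis t = cis t' -> exists k : Z, t = t' + 2 * PI * IZR k.
Proof.
intros h; destruct (cis_eq_1 (t - t')) as [k hk]; [|exists k; lra].
replace (t - t') with (- t' + t) by ring.
rewrite cis_plus, h, <- cis_plus, Rplus_opp_l; apply cis_0.
Qed.

(** Half-angles that agree modulo [2 PI] come from angles that agree modulo [4 PI]; the length of
    the target circle makes [Phi] injective. *)
Lemma half_exp_inj a b : half_exp a = half_exp b -> a = b.
Proof.
intros h; rewrite <- (angle_representative a), <- (angle_representative b).
apply angle_eq; destruct (cis_inj _ _ h) as [k hk]; exists k; lra.
Qed.

Section Forward.
Variable s : R.
Hypothesis hs : 5 / 2 < s.
Notation r := (s - 1).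

Lemma G_point_derive p : G_point s p -> Hs r (Derive (fst p)) /\
  (forall x, is_derive (fst p) x (Derive (fst p) x)) /\
  (forall x, 0 < Derive (fst p) x) /\ fst p 1 = 1.
Proof.
intros [[h1 [h2 h3]] _].
assert (d : forall x, is_derive (fst p) x (1 + Derive (fun x => fst p x - x) x)).
{ intros x; apply (is_derive_ext (fun x => x + (fst p x - x))); [intros; rring|].
  apply (is_derive_Rplus (fun x => x) (fun x => fst p x - x)).
  - auto_derive; trivial.
  - now apply (Hs_is_derive s). }
assert (e : Derive (fst p) = fun x => 1 + Derive (fun x => fst p x - x) x)
  by (extensionality x; apply is_derive_unique, d).
split; [|split; [|split; [exact h3|]]].
- rewrite e; apply Hs_plus; [apply Hs_one | exact (Hs_Derive s hs _ h1)].
- intros x; rewrite e; apply d.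
- assert (hp := Hs_periodic s _ h1 0); cbv beta in hp; rewrite Rplus_0_l, h2 in hp; lra.
Qed.

Lemma mean_derive p : G_point s p -> mean (Derive (fst p)) = 1.
Proof.
intros hp; destruct (G_point_derive p hp) as [h1 [h2 [_ h4]]].
apply is_RInt_unique; replace 1 with (minus (fst p 1) (fst p 0)) at 2.
- apply (is_RInt_derive (V := R_CompleteNormedModule)); intros x _; trivial.
  exact (Hs_continuous _ _ h1 x).
- rewrite h4, (proj1 (proj2 (proj1 hp))); apply Rminus_0_r.
Qed.

Variable p : G_ambient.
Hypothesis hp : G_point s p.

Definition dphi : HR r := HR_of r (Derive (fst p)).
Definition base_cos : HR r := HR_of r (fun x => Re (half_exp (snd p x))).
Definition base_sin : HR r := HR_of r (fun x => Im (half_exp (snd p x))).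

Lemma fn_dphi x : fn dphi x = Derive (fst p) x.
Proof. apply fn_HR_of, G_point_derive, hp. Qed.

Lemma fn_base x : half_exp (snd p x) = (fn base_cos x, fn base_sin x).
Proof.
destruct (half_exp_components r (snd p)) as [h1 h2]; [lra | apply hp |].
unfold base_cos, base_sin; rewrite !fn_HR_of by trivial; apply surjective_pairing.
Qed.

Definition slope (V : TG s) : HR r := plus dphi (deriv_map s hs (fst V)).

Definition half_angle (V : TG s) : HR r := scal (1 / 2) (snd V).

Notation "u ** v" := (hmul r (hr_half s hs) u v) (at level 40, left associativity).

(** With [Phi_im], the map [V |-> Phi (p + V)] as an expression in [H^r], by the addition formulas
    for cosine and sine. It serves twice: at [p = (id, alpha)] for the charts and at a general [p]
    for the isometry. *)
Definition Phi_re (V : TG s) : HR r :=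
  hsqrt r (slope V) **
    minus (base_cos ** hcos r (half_angle V)) (base_sin ** hsin r (half_angle V)).

Definition Phi_im (V : TG s) : HR r :=
  hsqrt r (slope V) **
    plus (base_cos ** hsin r (half_angle V)) (base_sin ** hcos r (half_angle V)).

Lemma fn_slope V x : fn (slope V) x = Derive (fst p) x + Derive (fn (fst V)) x.
Proof. unfold slope; rewrite fn_plus, fn_dphi; reflexivity. Qed.

Lemma fn_half_angle V x : fn (half_angle V) x = fn (snd V) x / 2.
Proof. unfold half_angle; rewrite fn_scal; rfield. Qed.

Definition increasing_shift (V : TG s) : Prop := forall x, 0 < fn (slope V) x.

Lemma Derive_shift (V : TG s) x :
  is_derive (fst (G_shift p V)) x (fn (slope V) x).
Proof.
rewrite fn_slope; apply (is_derive_Rplus (fst p) (fn (fst V))).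
- now apply G_point_derive.
- apply (Hs_is_derive s hs), HR0_mem.
Qed.

Lemma fn_Phi_re V x : increasing_shift V -> fn (Phi_re V) x =
  sqrt (fn (slope V) x) * (fn base_cos x * cos (fn (half_angle V) x) -
    fn base_sin x * sin (fn (half_angle V) x)).
Proof.
intros hV; assert (hr := hr_three_halves s hs); unfold Phi_re.
rewrite fn_hmul, fn_minus, !fn_hmul, (fn_hsqrt r hr _ x hV), (fn_hcos r hr (half_angle V) x),
  (fn_hsin r hr (half_angle V) x); reflexivity.
Qed.

Lemma fn_Phi_im V x : increasing_shift V -> fn (Phi_im V) x =
  sqrt (fn (slope V) x) * (fn base_cos x * sin (fn (half_angle V) x) +
    fn base_sin x * cos (fn (half_angle V) x)).
Proof.
intros hV; assert (hr := hr_three_halves s hs); unfold Phi_im.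
rewrite fn_hmul, fn_plus, !fn_hmul, (fn_hsqrt r hr _ x hV), (fn_hcos r hr (half_angle V) x),
  (fn_hsin r hr (half_angle V) x); reflexivity.
Qed.

Lemma Phi_shift V : increasing_shift V ->
  Phi (G_shift p V) = pairC (fn (Phi_re V)) (fn (Phi_im V)).
Proof.
intros hV; extensionality x; unfold Phi.
rewrite (is_derive_unique _ _ _ (Derive_shift V x)).
change (snd (G_shift p V) x) with (circle_shift (snd p x) (fn (snd V) x)).
rewrite half_exp_shift, fn_base.
unfold pairC; rewrite (fn_Phi_re V x hV), (fn_Phi_im V x hV), fn_half_angle.
unfold cis, Cmult, RtoC; simpl; f_equal; rring.
Qed.

Lemma shift_G_point V : increasing_shift V -> G_point s (G_shift p V).
Proof.
intros hV; split; [split; [|split]|].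
- replace (fun x => fst (G_shift p V) x - x) with
    (fun x => (fst p x - x) + fn (fst V) x) by (extensionality x; simpl; ring).
  apply Hs_plus; [apply hp | apply HR0_mem].
- change (fst p 0 + fn (fst V) 0 = 0).
  rewrite (proj1 (proj2 (proj1 hp))), (proj2 (HR0_mem s (fst V))); ring.
- intros x; rewrite (is_derive_unique _ _ _ (Derive_shift V x)); apply hV.
- destruct hp as [_ [k [u [hu ha]]]].
  exists k, (fun x => u x + fn (snd V) x); split.
  + apply (Hs_plus r); [exact hu | apply Hs_fn].
  + intros x; change (circle_shift (snd p x) (fn (snd V) x) =
      angle (4 * PI * IZR k * x + (u x + fn (snd V) x))).
    rewrite ha, circle_shift_angle; f_equal; ring.
Qed.

Lemma shift_zero : G_shift p (zero : TG s) = p.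
Proof.
destruct p as [phi alpha]; unfold G_shift; simpl; f_equal.
- extensionality x; apply Rplus_0_r.
- extensionality x; apply circle_shift_0.
Qed.

Lemma increasing_shift_zero : increasing_shift zero.
Proof.
intros x; rewrite fn_slope.
replace (Derive (fn (fst (zero : TG s))) x) with 0 by (symmetry; exact (Derive_const 0 x)).
rewrite Rplus_0_r; now apply G_point_derive.
Qed.

Lemma is_linear_slope : is_linear (fun V : TG s => deriv_map s hs (fst V)).
Proof.
apply (is_linear_comp (fun V : TG s => fst V)); [apply is_linear_fst | apply is_linear_deriv_map].
Qed.

Lemma smooth_slope W : smooth W slope.
Proof. apply smooth_plus; [apply smooth_const | apply smooth_linear, is_linear_slope]. Qed.

Lemma open_increasing_shift : open increasing_shift.
Proof.
assert (h := open_pointwise r (hr_three_halves s hs) (fun _ => True) (fun x => 0 < x) slope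
  open_true open_interval_pos (smooth_slope _)).
revert h; apply open_ext; intros V; unfold increasing_shift; tauto.
Qed.

Lemma smooth_half_angle W : smooth W half_angle.
Proof.
apply (smooth_linear_comp W (fun u : HR r => scal (1 / 2) u)); [apply is_linear_hscal|].
apply smooth_linear, is_linear_snd.
Qed.

Lemma smooth_Phi_re : smooth increasing_shift Phi_re.
Proof.
assert (hr := hr_three_halves s hs); assert (o := open_increasing_shift).
assert (ha := smooth_half_angle increasing_shift).
apply smooth_mult; [exact (smooth_hsqrt r hr _ o _ (fun y h => h) (smooth_slope _))|].
apply smooth_minus; apply smooth_mult; try apply smooth_const.
- exact (smooth_hcos r hr _ o _ ha).
- exact (smooth_hsin r hr _ o _ ha).
Qed.

Lemma smooth_Phi_im : smooth increasing_shift Phi_im.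
Proof.
assert (hr := hr_three_halves s hs); assert (o := open_increasing_shift).
assert (ha := smooth_half_angle increasing_shift).
apply smooth_mult; [exact (smooth_hsqrt r hr _ o _ (fun y h => h) (smooth_slope _))|].
apply smooth_plus; apply smooth_mult; try apply smooth_const.
- exact (smooth_hsin r hr _ o _ ha).
- exact (smooth_hcos r hr _ o _ ha).
Qed.

Lemma Phi_U_point : U_point r (Phi p).
Proof.
destruct (G_point_derive p hp) as [_ [_ [hpos _]]].
assert (hm : forall x, Cmod (Phi p x) = sqrt (Derive (fst p) x)).
{ intros x; unfold Phi; rewrite Cmod_mult, Cmod_half_exp, Cmod_R, Rabs_pos_eq by apply sqrt_pos.
  apply Rmult_1_r. }
split; [|split].
- rewrite <- shift_zero, Phi_shift by apply increasing_shift_zero.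
  apply is_sobolev_pairC; apply Hs_fn.
- apply (eq_trans (y := mean (Derive (fst p)))); [|now apply mean_derive].
  apply RInt_ext; intros x _.
  rewrite hm, pow2_sqrt; [reflexivity | left; apply hpos].
- intros x; rewrite hm; apply sqrt_lt_R0, hpos.
Qed.

End Forward.

(** * The isometry *)

Section Complexify.
Variable r : R.

Lemma im_map_mem (b : HR r) : ns_mem (sobolev_C r) (fun x => Cmult Ci (toC (fn b) x)).
Proof. apply (is_sobolev_rotate r Ci _ Cmod_Ci (Hs_fn r b)). Qed.

Definition re_map (a : HR r) : HC r := exist _ (toC (fn a)) (Hs_fn r a).
Definition im_map (b : HR r) : HC r := exist _ _ (im_map_mem b).

Lemma is_linear_re_map : is_linear re_map.
Proof.
split.
- intros u v; apply ns_ext; exact (toC_plus (fn u) (fn v)).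
- intros c u; apply ns_ext; change (toC (fun x => c * fn u x) = scal c (toC (fn u)
    : fun_ModuleSpace C_R_ModuleSpace)).
  rewrite scal_fun_C; exact (toC_scal c (fn u)).
- exists 1; split; [lra|]; intros u; rewrite Rmult_1_l; apply Rle_refl.
Qed.

Lemma is_linear_im_map : is_linear im_map.
Proof.
split.
- intros u v; apply ns_ext; extensionality x.
  change (Cmult Ci (RtoC (fn u x + fn v x)) =
    Cplus (Cmult Ci (RtoC (fn u x))) (Cmult Ci (RtoC (fn v x)))).
  rewrite RtoC_plus; cring.
- intros c u; apply ns_ext; extensionality x.
  transitivity (Cmult (RtoC c) (Cmult Ci (RtoC (fn u x)))).
  + change (Cmult Ci (RtoC (c * fn u x)) = Cmult (RtoC c) (Cmult Ci (RtoC (fn u x)))).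
    rewrite RtoC_mult; cring.
  + symmetry; exact (scal_R_Cmult c (Cmult Ci (RtoC (fn u x)))).
- exists 1; split; [lra|]; intros u; rewrite Rmult_1_l; right.
  exact (proj2 (is_sobolev_rotate r Ci _ Cmod_Ci (Hs_fn r u))).
Qed.

Lemma fn_re_im (a b : HR r) : fn (plus (re_map a) (im_map b)) = pairC (fn a) (fn b).
Proof. symmetry; apply (pairCE (fn a) (fn b)). Qed.

End Complexify.

(** Evaluation at [x] is continuous on [H^r], so the differential can be computed at each [x] as the
    derivative of a real function of [t]. The differential of [Phi] is thus found without expanding
    the terms that the calculus has built. *)
Lemma smooth_data_directional {E : NormedModule R_AbsRing} r (W : E -> Prop) (f : E -> HR r) D
    (V : E) x : 1 / 2 < r -> open W -> smooth_data W f D -> W zero ->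
  is_derive (fun t => fn (f (scal t V)) x) 0 (fn (D [V] zero) x).
Proof.
intros hr hW hD h0.
destruct (Hs_sup r hr) as [K [hK hsup]].
split; [apply (is_linear_scal_l (V := R_NormedModule))|].
intros x0 hx0; rewrite <- (is_filter_lim_locally_unique (V := R_NormedModule) 0 x0 hx0); intros eps.
assert (nV := norm_ge_0 V).
(* [norm V + 1] instead of [norm V], which may be [0]. *)
assert (he : 0 < eps / (K * (norm V + 1))).
{ apply Rdiv_lt_0_compat; [apply cond_pos | apply Rmult_lt_0_compat; lra]. }
destruct (norm_of_locally _ _ (filter_and _ _ (hW zero h0)
  (smooth_data_remainder W f D 0 zero _ hD h0 he))) as [d [hd hdr]].
assert (hd' : 0 < d / (norm V + 1)) by (apply Rdiv_lt_0_compat; lra).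
apply (locally_of_norm (E := R_NormedModule) 0 _ _ hd'); intros t ht.
change (Rabs (t - 0) < d / (norm V + 1)) in ht; rewrite Rminus_0_r in ht.
assert (et : minus (scal t V) zero = scal t V).
{ unfold minus; rewrite opp_zero; apply plus_zero_r. }
assert (hn : norm (minus (scal t V) zero) <= Rabs t * norm V).
{ rewrite et; apply (norm_scal t V). }
destruct (hdr (scal t V)) as [hWt hrem].
{ apply Rle_lt_trans with (1 := hn).
  apply Rle_lt_trans with (Rabs t * (norm V + 1)).
  - apply Rmult_le_compat_l; [apply Rabs_pos | lra].
  - apply Rlt_le_trans with (d / (norm V + 1) * (norm V + 1)).
    + apply Rmult_lt_compat_r; lra.
    + right; field; lra. }
specialize (hrem nil (Nat.le_refl _)).
assert (eD : D [minus (scal t V) zero] zero = scal t (D [V] zero)).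
{ rewrite et.
  exact (smooth_data_homogeneous W f D 1 zero hD h0 nil nil t V (Nat.le_refl _)). }
assert (hrem' : norm (minus (minus (f (scal t V)) (f zero)) (scal t (D [V] zero))) <=
  eps / (K * (norm V + 1)) * norm (minus (scal t V) zero) * 1).
{ rewrite <- (proj1 hD _ hWt), <- (proj1 hD _ h0), <- eD; exact hrem. }
assert (hx := hsup _ (Hs_fn r (minus (minus (f (scal t V)) (f zero)) (scal t (D [V] zero)))) x).
rewrite !fn_minus, fn_scal, <- norm_HR in hx.
assert (e0 : scal 0 V = zero) by exact (scal_zero_l V).
change (Rabs (fn (f (scal t V)) x - fn (f (scal 0 V)) x - (t - 0) * fn (D [V] zero) x)
  <= eps * Rabs (t - 0)).
rewrite e0, Rminus_0_r.
apply Rle_trans with (1 := hx).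
apply Rle_trans with (K * (eps / (K * (norm V + 1)) * (Rabs t * norm V) * 1)).
- apply Rmult_le_compat_l; [lra|].
  apply Rle_trans with (1 := hrem'); apply Rmult_le_compat_r; [lra|].
  apply Rmult_le_compat_l; lra.
- replace (K * (eps / (K * (norm V + 1)) * (Rabs t * norm V) * 1)) with
    (eps * Rabs t * (norm V / (norm V + 1))) by (field; lra).
  rewrite <- (Rmult_1_r (eps * Rabs t)) at 2; apply Rmult_le_compat_l.
  + apply Rmult_le_pos; [left; apply cond_pos | apply Rabs_pos].
  + apply (Rmult_le_reg_r (norm V + 1)); [lra|].
    replace (norm V / (norm V + 1) * (norm V + 1)) with (norm V) by (field; lra); lra.
Qed.

Lemma smooth_data_filterdiff {E F : NormedModule R_AbsRing} (W : E -> Prop) (f : E -> F) D x :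
  open W -> smooth_data W f D -> W x -> filterdiff f (locally x) (fun v => D [v] x).
Proof.
intros hW hD hx; split.
- destruct (smooth_data_bounded W f D 1 x hD hx) as [M hM].
  assert (M0 := bounded_le_ge0 _ _ _ hM).
  split.
  + intros v w; exact (smooth_data_additive W f D 1 x hD hx nil nil v w (Nat.le_refl _)).
  + intros a v; exact (smooth_data_homogeneous W f D 1 x hD hx nil nil a v (Nat.le_refl _)).
  + exists (M + 1); split; [lra|]; intros v.
    eapply Rle_trans; [exact (hM [v] (Nat.le_refl _))|].
    change (Defs.prod_norm [v]) with (norm v * 1); generalize (norm_ge_0 v); lra.
- intros y hy; rewrite <- (is_filter_lim_locally_unique x y hy); clear y hy; intros eps.
  generalize (filter_and _ _ (hW x hx)
    (smooth_data_remainder W f D 0 x eps hD hx (cond_pos eps))).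
  apply filter_imp; intros y [hy hr].
  rewrite <- (proj1 hD y hy), <- (proj1 hD x hx).
  eapply Rle_trans; [exact (hr nil (Nat.le_refl _))|].
  right; exact (Rmult_1_r _).
Qed.

Lemma RInt_Re (f : R -> C) a b : (forall x, continuous (f : R -> CC) x) ->
  Re (RInt (V := CC) f a b) = RInt (fun x => Re (f x)) a b.
Proof. intros h; now rewrite RInt_C. Qed.

Theorem Phi_isometry s : 5 / 2 < s -> is_isometry s (s - 1) Phi.
Proof.
intros hs p hp.
destruct (smooth_Phi_re s hs p) as [DA hA], (smooth_Phi_im s hs p) as [DB hB].
assert (o := open_increasing_shift s hs p).
assert (i0 := increasing_shift_zero s hs p hp).
set (F := fun V => plus (re_map (s - 1) (Phi_re s hs p V)) (im_map (s - 1) (Phi_im s hs p V))).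
set (DF := fun l V => plus (re_map (s - 1) (DA l V)) (im_map (s - 1) (DB l V))).
assert (hF : smooth_data (increasing_shift s hs p) F DF).
{ apply smooth_data_plus; apply smooth_data_linear_comp; trivial.
  - apply is_linear_re_map.
  - apply is_linear_im_map. }
set (P := Derive (fst p)).
destruct (G_point_derive s hs p hp) as [hP1 [hP2 [hP3 hP4]]]; fold P in hP1, hP2, hP3.
set (cs := fn (base_cos s p)); set (sn := fn (base_sin s p)).
assert (cs2 : forall x, cs x ^ 2 + sn x ^ 2 = 1).
{ intros x; assert (h := Cmod_half_exp (snd p x)).
  rewrite (fn_base s hs p hp) in h; fold (cs x) (sn x) in h.
  assert (h2 := Cmod2_alt (cs x, sn x)); rewrite h in h2; simpl in h2 |- *; lra. }
assert (slope_t : forall (V : TG s) t x,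
  fn (slope s hs p (scal t V)) x = P x + t * Derive (fn (fst V)) x).
{ intros V t x; rewrite fn_slope by trivial; f_equal.
  apply (Derive_scal (fn (fst V))). }
assert (angle_t : forall (V : TG s) t x, fn (half_angle s (scal t V)) x = t * fn (snd V) x / 2).
{ intros V t x; now rewrite fn_half_angle. }
assert (inc : forall V, locally 0 (fun t => increasing_shift s hs p (scal t V))).
{ intros V.
  assert (c : continuous (fun t : R => scal t V) 0)
    by exact (linear_cont (U := R_NormedModule) _ 0 (is_linear_scal_l V)).
  apply c; rewrite (scal_zero_l V : scal 0 V = zero); now apply o. }
(* Read off pointwise, as the derivative at [t = 0] of the explicit formula for [Phi_re] at [t V];
   for [t] near [0] the shift is still increasing, so that the formula is valid. *)
assert (eA : forall V x, fn (DA [V] zero) x =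
  Derive (fn (fst V)) x / (2 * sqrt (P x)) * cs x - sqrt (P x) * (fn (snd V) x / 2) * sn x).
{ intros V x.
  assert (h := smooth_data_directional _ _ _ _ V x (hr_half s hs) o hA i0).
  rewrite <- (is_derive_unique _ _ _ h); apply is_derive_unique.
  apply (is_derive_ext_loc (fun t => sqrt (P x + t * Derive (fn (fst V)) x) *
    (cs x * cos (t * fn (snd V) x / 2) - sn x * sin (t * fn (snd V) x / 2)))).
  - generalize (inc V); apply filter_imp; intros t ht.
    symmetry; rewrite <- (slope_t V t x), <- (angle_t V t x); exact (fn_Phi_re s hs p _ x ht).
  - set (q := P x); assert (hq : 0 < q) by apply hP3.
    generalize (Derive (fn (fst V)) x) (fn (snd V) x) (cs x) (sn x); intros v1 v2 c0 s0.
    auto_derive.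
    + rewrite Rmult_0_l, Rplus_0_r; auto.
    + replace (0 * v2 * / 2) with 0 by field; rewrite cos_0, sin_0.
      replace (q + 0 * v1) with q by ring.
      field; apply Rgt_not_eq, sqrt_lt_R0, hq. }
assert (eB : forall V x, fn (DB [V] zero) x =
  Derive (fn (fst V)) x / (2 * sqrt (P x)) * sn x + sqrt (P x) * (fn (snd V) x / 2) * cs x).
{ intros V x.
  assert (h := smooth_data_directional _ _ _ _ V x (hr_half s hs) o hB i0).
  rewrite <- (is_derive_unique _ _ _ h); apply is_derive_unique.
  apply (is_derive_ext_loc (fun t => sqrt (P x + t * Derive (fn (fst V)) x) *
    (cs x * sin (t * fn (snd V) x / 2) + sn x * cos (t * fn (snd V) x / 2)))).
  - generalize (inc V); apply filter_imp; intros t ht.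
    symmetry; rewrite <- (slope_t V t x), <- (angle_t V t x); exact (fn_Phi_im s hs p _ x ht).
  - set (q := P x); assert (hq : 0 < q) by apply hP3.
    generalize (Derive (fn (fst V)) x) (fn (snd V) x) (cs x) (sn x); intros v1 v2 c0 s0.
    auto_derive.
    + rewrite Rmult_0_l, Rplus_0_r; auto.
    + replace (0 * v2 * / 2) with 0 by field; rewrite cos_0, sin_0.
      replace (q + 0 * v1) with q by ring.
      field; apply Rgt_not_eq, sqrt_lt_R0, hq. }
assert (eL : forall V x, fn (DF [V] zero) x = (fn (DA [V] zero) x, fn (DB [V] zero) x)).
{ intros V x; unfold DF; now rewrite fn_re_im. }
assert (ePhi : forall x, Phi p x = (sqrt (P x) * cs x, sqrt (P x) * sn x)).
{ intros x; unfold Phi; rewrite (fn_base s hs p hp).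
  unfold Cmult, RtoC; simpl; f_equal; unfold P, cs, sn; ring. }
assert (cL : forall V x, continuous (fn (DF [V] zero) : R -> CC) x)
  by (intros V; apply (proj2_sig (DF [V] zero))).
assert (cPhi : forall x, continuous (Phi p : R -> CC) x)
  by (apply (Phi_U_point s hs p hp)).
exists (fun V => DF [V] zero); split; [|split].
- exists F; split.
  + generalize (o zero i0); apply filter_imp; intros V hV.
    exact (eq_trans (fn_re_im _ _ _) (eq_sym (Phi_shift s hs p hp V hV))).
  + now apply (smooth_data_filterdiff (increasing_shift s hs p)).
(* Tangency to the sphere: the integrand is [V_1x / 2], whose integral over a period vanishes. *)
- intros V; unfold inner_L2; rewrite RInt_Re
    by (intros; apply continuous_Cmult; [apply cL | now apply continuous_Cconj]).
  rewrite (RInt_ext _ (fun x => scal (1 / 2) (Derive (fn (fst V)) x))).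
  + destruct (HR0_mem s (fst V)) as [hV hV0].
    rewrite (RInt_scal (V := R_CompleteNormedModule)).
    * replace (RInt (Derive (fn (fst V))) 0 1) with 0; [apply Rmult_0_r|].
      symmetry; apply is_RInt_unique.
      replace 0 with (minus (fn (fst V) 1) (fn (fst V) 0)) at 2.
      -- apply (is_RInt_derive (V := R_CompleteNormedModule)); intros x _.
         ++ now apply (Hs_is_derive s hs).
         ++ apply (Hs_continuous (s - 1)), (Hs_Derive s hs), hV.
      -- rewrite <- (Hs_periodic s _ hV 0), Rplus_0_l; apply minus_self.
    * apply continuous_ex_RInt, (Hs_continuous (s - 1)), (Hs_Derive s hs), hV.
  + intros x _; rewrite eL, ePhi; cbn [Cconj Cmult Re Im fst snd].
    rewrite eA, eB; change (@scal _ _ ?a ?b) with (a * b).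
    assert (hq := sqrt_lt_R0 _ (hP3 x)); set (q := sqrt (P x)) in *.
    set (v1 := Derive _ _); set (v2 := fn (snd V) x).
    transitivity (v1 / 2 * (cs x ^ 2 + sn x ^ 2)); [unfold Re; simpl; field; lra|].
    rewrite cs2; rfield.
- intros V W; unfold inner_L2, G_metric; rewrite RInt_Re
    by (intros; apply continuous_Cmult; [apply cL | apply continuous_Cconj, cL]).
  set (Q := fun x => Derive (fn (fst V)) x * Derive (fn (fst W)) x / Derive (fst p) x +
    fn (snd V) x * fn (snd W) x * Derive (fst p) x).
  assert (eQ : forall x, Re (Cmult (fn (DF [V] zero) x) (Cconj (fn (DF [W] zero) x))) =
    1 / 4 * Q x).
  { intros x; rewrite !eL, !eA, !eB; unfold Q; fold (P x).
    assert (hq := sqrt_lt_R0 _ (hP3 x)).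
    assert (hq2 : P x = sqrt (P x) ^ 2) by (rewrite pow2_sqrt; [reflexivity | left; apply hP3]).
    (* Replaces [P x] in the two terms of the metric only; the other occurrences are already under a
       square root. *)
    rewrite hq2 at 9 10; set (q := sqrt (P x)) in *.
    set (v1 := Derive (fn (fst V)) x); set (v2 := fn (snd V) x).
    set (w1 := Derive (fn (fst W)) x); set (w2 := fn (snd W) x).
    transitivity ((v1 * w1 / (4 * q ^ 2) + q ^ 2 * v2 * w2 / 4) * (cs x ^ 2 + sn x ^ 2));
      [unfold Re; simpl; field; lra|].
    rewrite cs2; field; lra. }
  rewrite (RInt_ext _ _ 0 1 (fun x _ => eQ x)).
  apply (RInt_scal (V := R_CompleteNormedModule) Q 0 1 (1 / 4)).
  apply continuous_ex_RInt; intros x.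
  apply (continuous_ext (fun x => 4 *
    Re (Cmult (fn (DF [V] zero) x) (Cconj (fn (DF [W] zero) x))))).
  { intros t; rewrite eQ; rfield. }
  apply continuous_Rmult; [apply continuous_const|].
  apply continuous_Re, continuous_Cmult; [apply cL | apply continuous_Cconj, cL].
Qed.

(** * Charts of the sphere *)

Lemma mean_minus (u v : R -> R) : (forall x, continuous u x) -> (forall x, continuous v x) ->
  mean (fun x => u x - v x) = mean u - mean v.
Proof.
intros hu hv; apply (RInt_minus (V := R_CompleteNormedModule)); now apply continuous_ex_RInt.
Qed.

Lemma continuous_pairC a b x : continuous a x -> continuous b x ->
  continuous (pairC a b : R -> CC) x.
Proof. apply continuous_C_pair. Qed.

Section Sphere.
Variables (a b : R -> R) (eps : R).
Hypothesis ca : forall x, continuous a x.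
Hypothesis cb : forall x, continuous b x.
Hypothesis heps : eps * eps = 1.

Lemma inner_L2_pole : inner_L2 (pairC a b) (fun _ => RtoC eps) = eps * mean a.
Proof.
unfold inner_L2; rewrite RInt_Re.
- rewrite <- mean_scal by trivial; apply RInt_ext; intros x _; unfold Re; simpl; rring.
- intros x; apply continuous_Cmult; [now apply continuous_pairC | apply continuous_Cconst].
Qed.

Lemma sqnorm_L2_pairC : sqnorm_L2 (pairC a b) = mean (fun x => a x * a x + b x * b x).
Proof.
apply RInt_ext; intros x _; rewrite Cmod2_alt; unfold pairC, Re, Im; simpl; rring.
Qed.

(** The pole is [eps = 1] or [eps = -1], and [eps * eps = 1] lets both be treated at once: the
    component of [f] along the pole is [eps * mean a], and its multiple of the pole is [mean a]. *)
Lemma stereographic_pairC : 1 - eps * mean a <> 0 -> stereographic (RtoC eps) (pairC a b) =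
  pairC (fun x => (a x - mean a) * / (1 - eps * mean a)) (fun x => b x * / (1 - eps * mean a)).
Proof.
intros hne; unfold stereographic; rewrite inner_L2_pole; extensionality x; unfold pairC.
set (d := 1 - eps * mean a) in *.
unfold Cdiv; rewrite <- RtoC_inv by trivial.
unfold Cminus, Cplus, Copp, Cmult, RtoC; simpl; f_equal.
- transitivity ((a x - (eps * eps) * mean a) * / d); [ring | rewrite heps; ring].
- ring.
Qed.

(** For unit vectors [|f - e|^2 = 2 (1 - <f, e>)], so the denominator of the projection is positive
    away from the pole. *)
Lemma pole_distance : (forall x, a (x + 1) = a x) -> (forall x, b (x + 1) = b x) ->
  sqnorm_L2 (pairC a b) = 1 -> pairC a b <> (fun _ => RtoC eps) -> 0 < 1 - eps * mean a.
Proof.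
intros pa pb h1 hne.
set (f := fun x => Cminus (pairC a b x) (RtoC eps)).
assert (cf : forall x, continuous (f : R -> CC) x).
{ intros x; apply continuous_Cminus; [now apply continuous_pairC | apply continuous_Cconst]. }
assert (e : sqnorm_L2 f = 2 * (1 - eps * mean a)).
{ rewrite sqnorm_L2_pairC in h1.
  transitivity (mean (fun x => (a x * a x + b x * b x) - 2 * eps * a x + 1)).
  - apply RInt_ext; intros x _; rewrite Cmod2_alt; unfold f, pairC, Re, Im; simpl.
    apply Rminus_diag_uniq; transitivity (eps * eps - 1); [rring | lra].
  - assert (c1 : forall x, continuous (fun x : R => a x * a x + b x * b x) x) by (intros; cont).
    assert (c2 : forall x, continuous (fun x : R => 2 * eps * a x) x) by (intros; cont).
    eapply eq_trans; [apply (mean_plus (fun x => (a x * a x + b x * b x) - 2 * eps * a x)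
      (fun _ => 1)); intros; [now apply continuous_Rminus | apply continuous_const]|].
    rewrite mean_const. rewrite (mean_minus (fun x : R => a x * a x + b x * b x) (fun x : R => 2 * eps * a x) c1 c2), h1.
    rewrite (mean_scal (2 * eps) a) by trivial; ring. }
destruct (Rlt_le_dec 0 (1 - eps * mean a)) as [h|h]; trivial; exfalso; apply hne.
assert (h0 := sqnorm_L2_ge0 f cf).
assert (z : f = fun _ => RtoC 0).
{ apply sqnorm_L2_eq0; trivial; [|lra].
  intros x; unfold f, pairC; now rewrite pa, pb. }
extensionality x; apply (f_equal (fun g => g x)) in z; unfold f in z.
transitivity (Cplus (Cminus (pairC a b x) (RtoC eps)) (RtoC eps)); [cring | rewrite z; cring].
Qed.

End Sphere.

Section Hyperplane.
Variable s : R.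
Hypothesis hs : 5 / 2 < s.
Notation r := (s - 1).

Lemma centered_mem (a : HR r) : ns_mem (sobolev_hyperplane r) (toC (fun x => fn a x - mean (fn a))).
Proof.
assert (ca := fn_continuous r a).
split.
- apply (Hs_minus r (fn a) (fun _ => mean (fn a))); [apply Hs_fn | apply Hs_const].
- rewrite RInt_Re.
  + change (mean (fun x => fn a x - mean (fn a)) = 0).
    rewrite (mean_minus (fn a) (fun _ => mean (fn a))), mean_const; [ring | trivial |].
    intros; cont.
  + intros x; apply (continuous_toC (fun x => fn a x - mean (fn a))), continuous_Rminus;
      [apply ca | apply continuous_const].
Qed.

Lemma imaginary_mem (b : HR r) : ns_mem (sobolev_hyperplane r) (fun x => Cmult Ci (toC (fn b) x)).
Proof.
split; [apply im_map_mem|].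
rewrite RInt_Re.
- apply (eq_trans (y := mean (fun _ => 0))); [|apply mean_const].
  apply RInt_ext; intros x _; unfold toC, Ci, RtoC, Re; simpl; rring.
- intros x; apply continuous_Cmult; [apply continuous_Cconst|].
  apply continuous_toC, fn_continuous.
Qed.

(** Subtracting the mean defines the map on all of [HR r], as a linear map into the hyperplane; on
    functions of mean [0] it is the inclusion. *)
Definition re_perp (a : HR r) : Hperp r := exist _ _ (centered_mem a).
Definition im_perp (b : HR r) : Hperp r := exist _ _ (imaginary_mem b).

Lemma is_linear_re_perp : is_linear re_perp.
Proof.
split.
- intros u v; apply ns_ext; extensionality x.
  change (RtoC ((fn u x + fn v x) - mean (fun x => fn u x + fn v x)) =
    Cplus (RtoC (fn u x - mean (fn u))) (RtoC (fn v x - mean (fn v)))).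
  rewrite (mean_plus (fn u) (fn v)) by (intros; apply fn_continuous).
  rewrite <- RtoC_plus; f_equal; ring.
- intros c u; apply ns_ext; extensionality x.
  transitivity (Cmult (RtoC c) (RtoC (fn u x - mean (fn u)))).
  + change (RtoC (c * fn u x - mean (fun x => c * fn u x)) =
      Cmult (RtoC c) (RtoC (fn u x - mean (fn u)))).
    rewrite (mean_scal c (fn u)) by (intros; apply fn_continuous).
    rewrite <- RtoC_mult; f_equal; ring.
  + symmetry; exact (scal_R_Cmult c (RtoC (fn u x - mean (fn u)))).
- destruct (linear_norm _ (is_linear_mean_map s hs)) as [M [hM h]].
  exists (1 + M); split; [lra|]; intros u.
  change (Hn r (fun x => fn u x - mean (fn u)) <= (1 + M) * norm u).
  eapply Rle_trans; [apply (Hs_minus r (fn u) (fn (mean_map s u))); apply Hs_fn|].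
  assert (h' := h u); rewrite norm_HR in h'; rewrite (norm_HR r u) in h' |- *; lra.
Qed.

Lemma is_linear_im_perp : is_linear im_perp.
Proof.
destruct (is_linear_im_map r) as [h1 h2 h3]; split.
- intros u v; apply ns_ext; exact (f_equal (@proj1_sig _ _) (h1 u v)).
- intros c u; apply ns_ext; exact (f_equal (@proj1_sig _ _) (h2 c u)).
- exact h3.
Qed.

Definition perp_pair (a b : HR r) : Hperp r := plus (re_perp a) (im_perp b).

Lemma fn_perp_pair a b : mean (fn a) = 0 -> fn (perp_pair a b) = pairC (fn a) (fn b).
Proof.
intros h; extensionality x.
change (Cplus (RtoC (fn a x - mean (fn a))) (Cmult Ci (RtoC (fn b x))) = (fn a x, fn b x)).
rewrite h; unfold Ci, RtoC, Cplus, Cmult; simpl; f_equal; ring.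
Qed.

Lemma smooth_perp_pair {E : NormedModule R_AbsRing} (W : E -> Prop) (f g : E -> HR r) :
  smooth W f -> smooth W g -> smooth W (fun x => perp_pair (f x) (g x)).
Proof.
intros hf hg; apply smooth_plus.
- apply (smooth_linear_comp W re_perp); [apply is_linear_re_perp | trivial].
- apply (smooth_linear_comp W im_perp); [apply is_linear_im_perp | trivial].
Qed.

Definition one_map : HR r := exist _ (fun _ => 1) (Hs_one r).

Lemma smooth_mean {E : NormedModule R_AbsRing} (W : E -> Prop) (f : E -> HR r) :
  smooth W f -> smooth W (fun x => mean_map s (f x)).
Proof. apply (smooth_linear_comp W (mean_map s)), is_linear_mean_map, hs. Qed.

Lemma smooth_hscal {E : NormedModule R_AbsRing} (W : E -> Prop) c (f : E -> HR r) :
  smooth W f -> smooth W (fun x => scal c (f x)).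
Proof. apply (smooth_linear_comp W (fun u : HR r => scal c u)), is_linear_hscal. Qed.

End Hyperplane.

(** * [Phi] read in the charts *)

Section ForwardChart.
Variable s : R.
Hypothesis hs : 5 / 2 < s.
Notation r := (s - 1).
Notation "u ** v" := (hmul r (hr_half s hs) u v) (at level 40, left associativity).

Lemma identity_G_point alpha : is_sobolev_circle r alpha -> G_point s (fun x => x, alpha).
Proof.
intros ha; split; [split; [|split] | exact ha].
- replace (fun x => fst (fun x : R => x, alpha) x - x) with (fun _ : R => 0)
    by (extensionality x; simpl; ring).
  apply (Hs_const s 0).
- reflexivity.
- intros x; simpl; rewrite Derive_id; lra.
Qed.

Variables (alpha : R -> circle4pi) (eps : R).
Hypothesis halpha : is_sobolev_circle r alpha.
Hypothesis heps : eps * eps = 1.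

Let p0 : G_ambient := (fun x => x, alpha).
Let hp0 : G_point s p0 := identity_G_point alpha halpha.

Let A (V : TG s) : HR r := Phi_re s hs p0 V.
Let B (V : TG s) : HR r := Phi_im s hs p0 V.

(** The denominator of the stereographic projection as a constant function, so that [hinv] can
    invert it. *)
Definition pole_gap (V : TG s) : HR r :=
  minus (one_map s) (scal eps (mean_map s (A V))).

Definition forward_chart (V : TG s) : Hperp r :=
  perp_pair s (minus (A V) (mean_map s (A V)) ** hinv r (pole_gap V))
    (B V ** hinv r (pole_gap V)).

Definition forward_domain (V : TG s) : Prop :=
  (((forall x, Rabs (fn (snd V) x) < 2 * PI) /\ increasing_shift s hs p0 V)) /\
  (forall x, 0 < fn (pole_gap V) x).

Lemma fn_pole_gap V x : fn (pole_gap V) x = 1 - eps * mean (fn (A V)).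
Proof. reflexivity. Qed.

Lemma fn_forward_chart V : 0 < 1 - eps * mean (fn (A V)) ->
  fn (forward_chart V) = stereographic (RtoC eps) (pairC (fn (A V)) (fn (B V))).
Proof.
intros hg; assert (hr := hr_three_halves s hs).
assert (cA := fn_continuous r (A V)).
assert (hi : forall x, fn (hinv r (pole_gap V)) x = / (1 - eps * mean (fn (A V)))).
{ intros x; rewrite fn_hinv by (trivial; intros; now rewrite fn_pole_gap); reflexivity. }
rewrite stereographic_pairC by (trivial; try lra; apply fn_continuous).
unfold forward_chart; rewrite fn_perp_pair.
- unfold pairC; extensionality x; rewrite !fn_hmul, hi; reflexivity.
- replace (fn (_ ** _)) with (fun x => / (1 - eps * mean (fn (A V))) *
    (fn (A V) x - mean (fn (A V)))) by (extensionality x; rewrite fn_hmul, hi, fn_minus;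
      change (fn (mean_map s (A V)) x) with (mean (fn (A V))); rring).
  rewrite (mean_scal _ (fun x => fn (A V) x - mean (fn (A V)))),
    (mean_minus (fn (A V)) (fun _ => mean (fn (A V)))), mean_const; trivial; try ring.
  + intros; cont.
  + intros x; apply continuous_Rminus; [apply cA | apply continuous_const].
Qed.

(** [smooth_map] prescribes the domain of the local expression. Here it is identified with explicit
    open conditions, the last of which says, by [pole_distance], that the image is not the pole of
    the projection. *)
Lemma forward_domain_spec V : forward_domain V <->
  exists p y, G_chart s alpha p V /\ U_chart r (RtoC eps) (Phi p) y.
Proof.
split.
- intros [[hb hi] hg].
  assert (e := Phi_shift s hs p0 hp0 V hi); assert (hgp := shift_G_point s hs p0 hp0 V hi).
  assert (hg0 := hg 0); rewrite fn_pole_gap in hg0.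
  exists (G_shift p0 V), (forward_chart V); split; [now split|].
  split; [now apply (Phi_U_point s hs)|]; rewrite e; split; [|now apply fn_forward_chart].
  intros h; assert (em : mean (fn (A V)) = eps).
  { rewrite <- (mean_const eps); f_equal; extensionality x.
    exact (f_equal (fun f => Re (f x)) h). }
  rewrite em, heps in hg0; lra.
- intros [p [y [[hp [hb ep]] [hU [hne _]]]]].
  assert (hi : increasing_shift s hs p0 V).
  { intros x; rewrite <- (is_derive_unique _ _ _ (Derive_shift s hs p0 hp0 V x)).
    change (G_shift p0 V) with (G_shift (fun x => x, alpha) V); rewrite <- ep; apply hp. }
  split; [now split|]; intros x; rewrite fn_pole_gap.
  assert (e := Phi_shift s hs p0 hp0 V hi).
  change (G_shift p0 V) with (G_shift (fun x => x, alpha) V) in e; rewrite <- ep in e.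
  rewrite e in hU, hne; destruct hU as [_ [hn _]].
  apply (pole_distance (fn (A V)) (fn (B V)) eps); trivial;
    try apply fn_continuous; apply (Hs_periodic r), Hs_fn.
Qed.

Lemma smooth_on_forward_chart : smooth_on forward_domain forward_chart.
Proof.
assert (hr := hr_three_halves s hs).
set (W1 := fun V : TG s =>
  (forall x, Rabs (fn (snd V) x) < 2 * PI) /\ increasing_shift s hs p0 V).
assert (o1 : open W1).
{ apply open_and; [|apply open_increasing_shift].
  assert (h := open_pointwise r hr (fun _ => True) (fun x => Rabs x < 2 * PI)
    (fun V : TG s => snd V) open_true (open_interval_Rabs _)
    (smooth_linear _ _ is_linear_snd)).
  revert h; apply open_ext; intros V; tauto. }
assert (sA : smooth W1 A) by (apply (smooth_subset _ (increasing_shift s hs p0));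
  [intros V h; apply h | apply smooth_Phi_re]).
assert (sB : smooth W1 B) by (apply (smooth_subset _ (increasing_shift s hs p0));
  [intros V h; apply h | apply smooth_Phi_im]).
assert (sg : smooth W1 pole_gap).
{ apply smooth_minus; [apply smooth_const | now apply smooth_hscal, smooth_mean]. }
assert (o2 : open forward_domain).
{ exact (open_pointwise r hr W1 (fun x => 0 < x) pole_gap o1 open_interval_pos sg). }
assert (h : smooth forward_domain forward_chart).
{ assert (sub : forall (f : TG s -> HR r), smooth W1 f -> smooth forward_domain f)
    by (intros f; apply smooth_subset; intros V hV; apply hV).
  assert (si : smooth forward_domain (fun V => hinv r (pole_gap V)))
    by (apply smooth_hinv; auto; intros V hV; apply hV).
  assert (sA' := sub A sA); assert (sB' := sub B sB).
  assert (s1 : smooth forward_domain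
      (fun V => minus (A V) (mean_map s (A V)) ** hinv r (pole_gap V))).
  { apply smooth_mult; [|exact si].
    exact (smooth_minus r _ _ _ sA' (smooth_mean s hs _ A sA')). }
  assert (s2 : smooth forward_domain (fun V => B V ** hinv r (pole_gap V))).
  { exact (smooth_mult _ r _ _ _ sB' si). }
  exact (smooth_perp_pair s hs forward_domain _ _ s1 s2). }
destruct h as [D hD]; exact (smooth_on_intro _ _ D o2 hD).
Qed.

End ForwardChart.

Lemma smooth_on_ext {E F : NormedModule R_AbsRing} (W W' : E -> Prop) (f : E -> F) :
  (forall x, W x <-> W' x) -> smooth_on W f -> smooth_on W' f.
Proof.
intros h [o [D hD]]; split; [now apply (open_ext W)|].
exists D; apply (smooth_data_restrict W W' f f); trivial; intros x; apply h.
Qed.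

Theorem Phi_smooth s : 5 / 2 < s -> smooth_map (G_manifold s) (U_manifold (s - 1)) Phi.
Proof.
intros hs c d [alpha [halpha ->]] [e [he ->]].
assert (h : exists eps, e = RtoC eps /\ eps * eps = 1).
{ destruct he as [-> | ->]; [exists 1 | exists (-1)]; split; trivial; ring. }
destruct h as [eps [-> heps]].
exists (forward_chart s hs alpha eps); split.
- intros p V y hc hd.
  assert (hdom : forward_domain s hs alpha eps V)
    by (apply forward_domain_spec; trivial; now exists p, y).
  destruct hdom as [[_ hi] hg].
  apply ns_ext; change (fn (forward_chart s hs alpha eps V) = fn y).
  rewrite fn_forward_chart by (trivial; exact (hg 0)).
  destruct hd as [_ [_ ->]], hc as [_ [_ ->]].
  now rewrite <- (Phi_shift s hs _ (identity_G_point s alpha halpha) V hi).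
- apply (smooth_on_ext (forward_domain s hs alpha eps)).
  + intros V; now apply forward_domain_spec.
  + now apply smooth_on_forward_chart.
Qed.

(** * The inverse map *)

Lemma constant_of_derive_0 (f : R -> R) : (forall x, is_derive f x 0) -> forall x, f x = f 0.
Proof.
intros h x.
destruct (Rtotal_order x 0) as [hx | [-> | hx]]; trivial.
- apply (eq_is_derive f x 0); trivial; intros t _; exact (h t).
- symmetry; apply (eq_is_derive f 0 x); trivial; intros t _; exact (h t).
Qed.

(** [acos] gives an angle for the upper half circle and its opposite one for the lower half. The
    choice is made point by point; regularity of the angle comes from a lift instead. *)
Lemma polar_form (z : C) : exists a, Cmult (RtoC (Cmod z)) (half_exp a) = z.
Proof.
destruct (Req_dec (Cmod z) 0) as [e|ne].
{ exists (angle 0); rewrite e, (Cmod_eq_0 z e); apply Cmult_0_l. }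
assert (n0 : 0 < Cmod z) by (generalize (Cmod_ge_0 z); lra).
assert (h2 := Cmod2_alt z); set (n := Cmod z) in *.
set (a := Re z / n); set (b := Im z / n).
assert (h1 : a ^ 2 + b ^ 2 = 1).
{ unfold a, b; apply (Rmult_eq_reg_r (n ^ 2)); [|apply pow_nonzero; lra].
  rewrite Rmult_1_l; apply (eq_trans (y := Re z ^ 2 + Im z ^ 2)); [field; lra | now symmetry]. }
assert (key : exists t, cos t = a /\ sin t = b).
{ assert (ha : -1 <= a <= 1) by (split; nra).
  destruct (Rle_dec 0 b) as [hb|hb].
  - exists (acos a); rewrite cos_acos, sin_acos by trivial; split; trivial.
    replace (1 - a²) with (b ^ 2) by (unfold Rsqr; lra); now apply sqrt_pow2.
  - exists (- acos a); rewrite cos_neg, sin_neg, cos_acos, sin_acos by trivial; split; trivial.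
    replace (1 - a²) with ((- b) ^ 2) by (unfold Rsqr; lra); rewrite sqrt_pow2 by lra; ring. }
destruct key as [t [hc hs]]; exists (angle (2 * t)).
rewrite half_exp_angle; replace (2 * t / 2) with t by field.
unfold cis; rewrite hc, hs; unfold a, b; destruct z as [p q].
unfold Cmult, RtoC; simpl; f_equal; field; lra.
Qed.

(* If [A ^ 2 + B ^ 2 = 1] and [dtheta = A B' - B A'], then [A' = - B dtheta] and [B' = A dtheta]. *)
Lemma unit_circle_lift r (A B : R -> R) : 3 / 2 < r -> Hs r A -> Hs r B ->
  (forall x, A x ^ 2 + B x ^ 2 = 1) ->
  exists (k : Z) (u : R -> R), Hs r u /\
    forall x, (A x, B x) = cis ((4 * PI * IZR k * x + u x) / 2).
Proof.
intros hr hA hB h1.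
destruct (Hs_differentiable r hr) as [K [_ hder]].
destruct (hder A hA) as [dA [hA' _]], (hder B hB) as [dB [hB' _]].
set (A' := Derive A) in *; set (B' := Derive B) in *.
assert (hA1 : Hs (r - 1) A) by (apply (Hs_le (r - 1) r); trivial; lra).
assert (hB1 : Hs (r - 1) B) by (apply (Hs_le (r - 1) r); trivial; lra).
set (w := fun x => A x * B' x - B x * A' x).
assert (hw : Hs (r - 1) w).
{ apply Hs_minus; apply Hs_mult_mem; trivial; lra. }
assert (hAA : forall x, A x * A' x + B x * B' x = 0).
{ intros x.
  assert (d : is_derive (fun x => A x * A x + B x * B x) x
    ((A' x * A x + A x * A' x) + (B' x * B x + B x * B' x))).
  { apply (is_derive_Rplus (fun x => A x * A x) (fun x => B x * B x));
      now apply is_derive_Rmult. }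
  apply is_derive_unique in d.
  rewrite (Derive_ext _ (fun _ => 1)), Derive_const in d;
    [lra | intros t; rewrite <- (h1 t); ring]. }
assert (eA : forall x, A' x = - B x * w x).
{ intros x; unfold w.
  transitivity (A' x * (A x ^ 2 + B x ^ 2) - A x * (A x * A' x + B x * B' x));
    [rewrite h1, hAA; ring | ring]. }
assert (eB : forall x, B' x = A x * w x).
{ intros x; unfold w.
  transitivity (B' x * (A x ^ 2 + B x ^ 2) - B x * (A x * A' x + B x * B' x));
    [rewrite h1, hAA; ring | ring]. }
destruct (Hs_mean_free_primitive r w hw) as [dv hv].
set (T := mean w) in *; set (v := fun x => RInt (fun t => w t - T) 0 x) in *.
assert (v0 : v 0 = 0) by exact (RInt_point (V := R_CompleteNormedModule) 0 _).
destruct (polar_form (A 0, B 0)) as [a0 ha0].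
assert (hm : Cmod (A 0, B 0) = 1).
{ unfold Cmod; simpl; transitivity (sqrt 1); [f_equal | apply sqrt_1].
  generalize (h1 0); simpl; lra. }
rewrite hm, Cmult_1_l in ha0; set (t0 := representative a0 / 2) in *.
injection ha0; intros s0 c0; fold t0 in s0, c0.
(* The primitive of [w] that starts from an argument [t0] of [(A 0, B 0)], split into a periodic
   part and a linear part. *)
set (th := fun x => t0 + v x + T * x).
assert (dth : forall x, is_derive th x (w x)).
{ intros x; apply (is_derive_eq _ _ (0 + (w x - T) + T)); [|rring].
  apply (is_derive_Rplus (fun x => t0 + v x) (fun x => T * x)).
  - apply (is_derive_Rplus (fun _ => t0) v); [apply (is_derive_const (V := R_NormedModule)) | apply dv].
  - auto_derive; trivial; rring. }
assert (dcos : forall x, is_derive (fun x => cos (th x)) x (- sin (th x) * w x)).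
{ intros x; apply (is_derive_Rcomp cos th); [apply is_derive_cos | apply dth]. }
assert (dsin : forall x, is_derive (fun x => sin (th x)) x (cos (th x) * w x)).
{ intros x; apply (is_derive_Rcomp sin th); [apply is_derive_sin | apply dth]. }
assert (th0 : th 0 = t0) by (unfold th; rewrite v0; ring).
(* The scalar product of [(A, B)] with [cis th], and below their cross product, have zero
   derivative; their values at [0] are [1] and [0], so the two unit vectors coincide everywhere. *)
assert (hP : forall x, A x * cos (th x) + B x * sin (th x) = 1).
{ intros x; transitivity (A 0 * cos (th 0) + B 0 * sin (th 0)).
  - apply (constant_of_derive_0 (fun x => A x * cos (th x) + B x * sin (th x))); intros y.
    apply (is_derive_eq _ _ ((A' y * cos (th y) + A y * (- sin (th y) * w y)) +
      (B' y * sin (th y) + B y * (cos (th y) * w y)))); [|rewrite eA, eB; rring].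
    apply (is_derive_Rplus (fun x => A x * cos (th x)) (fun x => B x * sin (th x)));
      [apply (is_derive_Rmult A (fun x => cos (th x)))
      | apply (is_derive_Rmult B (fun x => sin (th x)))]; auto.
  - rewrite th0, c0, s0, <- (h1 0); ring. }
assert (hQ : forall x, B x * cos (th x) - A x * sin (th x) = 0).
{ intros x; transitivity (B 0 * cos (th 0) - A 0 * sin (th 0)).
  - apply (constant_of_derive_0 (fun x => B x * cos (th x) - A x * sin (th x))); intros y.
    apply (is_derive_eq _ _ ((B' y * cos (th y) + B y * (- sin (th y) * w y)) -
      (A' y * sin (th y) + A y * (cos (th y) * w y)))); [|rewrite eA, eB; rring].
    apply (is_derive_Rminus (fun x => B x * cos (th x)) (fun x => A x * sin (th x)));
      [apply (is_derive_Rmult B (fun x => cos (th x)))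
      | apply (is_derive_Rmult A (fun x => sin (th x)))]; auto.
  - rewrite th0, c0, s0; ring. }
assert (hcis : forall x, (A x, B x) = cis (th x)).
{ intros x; assert (hsc := sin2_cos2 (th x)); unfold Rsqr in hsc.
  unfold cis; f_equal.
  - transitivity (A x * (sin (th x) * sin (th x) + cos (th x) * cos (th x))); [rewrite hsc; ring|].
    transitivity ((A x * cos (th x) + B x * sin (th x)) * cos (th x) -
      (B x * cos (th x) - A x * sin (th x)) * sin (th x)); [ring | rewrite hP, hQ; ring].
  - transitivity (B x * (sin (th x) * sin (th x) + cos (th x) * cos (th x))); [rewrite hsc; ring|].
    transitivity ((A x * cos (th x) + B x * sin (th x)) * sin (th x) +
      (B x * cos (th x) - A x * sin (th x)) * cos (th x)); [ring | rewrite hP, hQ; ring]. }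
(* [(A, B)] is periodic, so [th] grows by a multiple of [2 PI] over a period: the winding number
   [k], which fixes the slope [T]. *)
destruct (cis_inj (th (0 + 1)) (th 0)) as [k hk].
{ now rewrite <- !hcis, (Hs_periodic r A hA), (Hs_periodic r B hB). }
assert (hT : T = 2 * PI * IZR k).
{ unfold th in hk; rewrite (Hs_periodic r v hv) in hk; lra. }
exists k, (fun x => 2 * t0 + 2 * v x); split.
- apply Hs_plus; [apply Hs_const | now apply Hs_scal].
- intros x; rewrite hcis; f_equal; unfold th; rewrite hT; field.
Qed.

(** The inverse of [Phi]; only its values at nowhere vanishing functions are meaningful. *)
Definition Psi (f : R -> C) : G_ambient :=
  (fun x => RInt (fun t => Cmod (f t) ^ 2) 0 x,
   fun x => epsilon (inhabits (angle 0))
     (fun a => Cmult (RtoC (Cmod (f x))) (half_exp a) = f x)).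

Lemma Psi_angle f x : Cmult (RtoC (Cmod (f x))) (half_exp (snd (Psi f) x)) = f x.
Proof. exact (epsilon_spec (inhabits (angle 0)) _ (polar_form (f x))). Qed.

Lemma Psi_derive f x : (forall x, continuous (f : R -> CC) x) ->
  is_derive (fst (Psi f)) x (Cmod (f x) ^ 2).
Proof.
intros cf; apply (is_derive_primitive (fun t => Cmod (f t) ^ 2)); intros; cont.
Qed.

Lemma half_exp_eq f x a : 0 < Cmod (f x) ->
  Cmult (RtoC (Cmod (f x))) (half_exp a) = f x -> snd (Psi f) x = a.
Proof.
intros hx ha; apply half_exp_inj.
assert (nz : RtoC (Cmod (f x)) <> RtoC 0) by (intros h; apply RtoC_inj in h; lra).
transitivity (Cmult (Cinv (RtoC (Cmod (f x))))
  (Cmult (RtoC (Cmod (f x))) (half_exp (snd (Psi f) x)))).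
- rewrite Cmult_assoc, Cinv_l by trivial; symmetry; apply Cmult_1_l.
- rewrite Psi_angle.
  transitivity (Cmult (Cinv (RtoC (Cmod (f x)))) (Cmult (RtoC (Cmod (f x))) (half_exp a))).
  + now rewrite ha.
  + rewrite Cmult_assoc, Cinv_l by trivial; apply Cmult_1_l.
Qed.

Lemma Cmod_sq_Re_Im z : Cmod z ^ 2 = Re z * Re z + Im z * Im z.
Proof. rewrite Cmod2_alt; ring. Qed.

Section Inverse.
Variable s : R.
Hypothesis hs : 5 / 2 < s.
Notation r := (s - 1).
Notation "u ** v" := (hmul r (hr_half s hs) u v) (at level 40, left associativity).

(** [f / |f|] is in [H^r] by superposition and has a lift of the required form. As [half_exp] is
    injective, the angles chosen point by point in [Psi] are the classes of this lift. *)
Lemma Psi_circle f : is_sobolev r f -> (forall x, 0 < Cmod (f x)) ->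
  is_sobolev_circle r (snd (Psi f)).
Proof.
intros hf hpos; assert (hr := hr_three_halves s hs).
destruct (Hs_Re r f hf) as [ha _], (Hs_Im r f hf) as [hb _].
set (a := HR_of r (fun x => Re (f x))); set (b := HR_of r (fun x => Im (f x))).
assert (ea : forall x, fn a x = Re (f x)) by (intros; now apply fn_HR_of).
assert (eb : forall x, fn b x = Im (f x)) by (intros; now apply fn_HR_of).
set (m := plus (a ** a) (b ** b)).
assert (em : forall x, fn m x = Cmod (f x) ^ 2).
{ intros x; unfold m; rewrite fn_plus, !fn_hmul, ea, eb; now rewrite Cmod_sq_Re_Im. }
assert (pm : forall x, 0 < fn m x) by (intros; rewrite em; now apply pow_lt).
set (iv := hinv r (hsqrt r m)).
assert (eiv : forall x, fn iv x = / Cmod (f x)).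
{ assert (e : forall x, fn (hsqrt r m) x = Cmod (f x)).
  { intros x; rewrite fn_hsqrt, em by trivial; apply sqrt_pow2, Cmod_ge_0. }
  intros x; unfold iv; rewrite fn_hinv, e; trivial; intros; now rewrite e. }
assert (ep : forall x, fn (a ** iv) x = Re (f x) * / Cmod (f x)).
{ intros x; rewrite <- (ea x), <- (eiv x); reflexivity. }
assert (eq : forall x, fn (b ** iv) x = Im (f x) * / Cmod (f x)).
{ intros x; rewrite <- (eb x), <- (eiv x); reflexivity. }
assert (eu : forall x, (fn (a ** iv) x, fn (b ** iv) x) = half_exp (snd (Psi f) x)).
{ intros x; rewrite (ep x), (eq x).
  assert (h := Psi_angle f x); assert (hx := hpos x).
  destruct (half_exp (snd (Psi f) x)) as [p q]; rewrite <- h at 1 3.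
  unfold Cmult, RtoC; simpl; f_equal; field; lra. }
assert (e1 : forall x, fn (a ** iv) x ^ 2 + fn (b ** iv) x ^ 2 = 1).
{ intros x; rewrite (ep x), (eq x).
  transitivity ((Re (f x) * Re (f x) + Im (f x) * Im (f x)) * (/ Cmod (f x)) ^ 2); [ring|].
  rewrite <- Cmod_sq_Re_Im; field; generalize (hpos x); lra. }
destruct (unit_circle_lift r _ _ hr (Hs_fn r (a ** iv)) (Hs_fn r (b ** iv)) e1)
  as [k [u [hu hcis]]].
exists k, u; split; [exact hu|].
intros x; apply half_exp_inj; rewrite half_exp_angle, <- eu; apply hcis.
Qed.

(** The mean of [|f|^2] is [1], so the primitive of [|f|^2] minus its mean is [phi - id]. *)
Lemma primitive_map_sq (m : HR r) f : (forall x, fn m x = Cmod (f x) ^ 2) -> sqnorm_L2 f = 1 ->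
  forall x, fn (primitive_map s m) x = fst (Psi f) x - x.
Proof.
intros hm h1 x.
assert (em : fn m = fun x => Cmod (f x) ^ 2) by (extensionality y; apply hm).
change (RInt (fun t => fn m t - mean (fn m)) 0 x = RInt (fun t => Cmod (f t) ^ 2) 0 x - x).
rewrite em; change (mean (fun x => Cmod (f x) ^ 2)) with (sqnorm_L2 f); rewrite h1.
transitivity (RInt (fun t => Cmod (f t) ^ 2) 0 x - RInt (fun _ => 1) 0 x).
- apply (RInt_minus (V := R_CompleteNormedModule)); [|apply ex_RInt_const].
  rewrite <- em; apply continuous_ex_RInt, fn_continuous.
- f_equal; rewrite RInt_const; change ((x - 0) * 1 = x); ring.
Qed.

Lemma Psi_G_point f : U_point r f -> G_point s (Psi f).
Proof.
intros [hf [h1 hpos]].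
assert (cf : forall x, continuous (f : R -> CC) x) by apply hf.
destruct (Hs_Re r f hf) as [ha _], (Hs_Im r f hf) as [hb _].
split; [split; [|split]|].
- set (m := plus (HR_of r (fun x => Re (f x)) ** HR_of r (fun x => Re (f x)))
    (HR_of r (fun x => Im (f x)) ** HR_of r (fun x => Im (f x)))).
  replace (fun x => fst (Psi f) x - x) with (fn (primitive_map s m));
    [apply HR0_mem|].
  extensionality x; apply primitive_map_sq; trivial; intros y.
  unfold m; rewrite fn_plus, !fn_hmul, !fn_HR_of by trivial; now rewrite Cmod_sq_Re_Im.
- exact (RInt_point (V := R_CompleteNormedModule) 0 _).
- intros x; rewrite (is_derive_unique _ _ _ (Psi_derive f x cf)); now apply pow_lt.
- now apply Psi_circle.
Qed.

Lemma Phi_Psi f : U_point r f -> Phi (Psi f) = f.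
Proof.
intros [hf [h1 hpos]]; extensionality x; unfold Phi.
rewrite (is_derive_unique _ _ _ (Psi_derive f x (proj1 hf))).
rewrite sqrt_pow2 by apply Cmod_ge_0; apply Psi_angle.
Qed.

Lemma Psi_Phi p : G_point s p -> Psi (Phi p) = p.
Proof.
intros hp; destruct (G_point_derive s hs p hp) as [h1 [h2 [h3 _]]].
assert (hm : forall x, Cmod (Phi p x) = sqrt (Derive (fst p) x)).
{ intros x; unfold Phi; rewrite Cmod_mult, Cmod_half_exp, Cmod_R, Rabs_pos_eq by apply sqrt_pos.
  apply Rmult_1_r. }
rewrite (surjective_pairing p) at 2; rewrite (surjective_pairing (Psi (Phi p))); f_equal.
- extensionality x; simpl.
  transitivity (RInt (Derive (fst p)) 0 x).
  + apply RInt_ext; intros t _; rewrite hm; apply (pow2_sqrt (Derive (fst p) t)).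
    left; apply h3.
  + apply is_RInt_unique.
    replace (fst p x) with (minus (fst p x) (fst p 0)).
    * apply (is_RInt_derive (V := R_CompleteNormedModule)); intros t _; trivial.
      exact (Hs_continuous _ _ h1 t).
    * rewrite (proj1 (proj2 (proj1 hp))); apply Rminus_0_r.
- extensionality x; apply half_exp_eq.
  + rewrite hm; apply sqrt_lt_R0, h3.
  + now rewrite hm.
Qed.

End Inverse.

(** The half-angle formula [tan (theta / 2) = sin theta / (1 + cos theta)], for the argument of
    [w1 + i w2] of modulus [n]. The condition [0 < n + w1] says that the point is off the negative
    half-line. *)
Lemma cis_2_atan w1 w2 n : 0 < n -> 0 < n + w1 -> n ^ 2 = w1 ^ 2 + w2 ^ 2 ->
  cis (2 * atan (w2 / (n + w1))) = (w1 / n, w2 / n).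
Proof.
intros hn hd e; set (tau := w2 / (n + w1)).
destruct (atan_bound tau) as [b1 b2].
assert (hc : 0 < cos (atan tau)) by (apply cos_gt_0; lra).
assert (hs : sin (atan tau) = tau * cos (atan tau)).
{ assert (ht := tan_atan tau); unfold tan in ht; rewrite <- ht at 2; field; lra. }
assert (h : cos (atan tau) ^ 2 = (n + w1) / (2 * n)).
{ rewrite cos_atan_sq; unfold tau.
  replace (1 + (w2 / (n + w1)) ^ 2) with (((n + w1) ^ 2 + w2 ^ 2) / (n + w1) ^ 2) by (field; lra).
  replace ((n + w1) ^ 2 + w2 ^ 2) with (2 * n * (n + w1)) by nra.
  field; lra. }
unfold cis; f_equal.
- rewrite cos_2a_cos; replace (2 * cos (atan tau) * cos (atan tau)) with
    (2 * cos (atan tau) ^ 2) by ring.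
  rewrite h; field; lra.
- rewrite sin_2a, hs; replace (2 * (tau * cos (atan tau)) * cos (atan tau)) with
    (2 * tau * cos (atan tau) ^ 2) by ring.
  rewrite h; unfold tau; field; lra.
Qed.

Lemma atan_half_tangent t : Rabs t < PI -> 0 < 1 + cos t /\ atan (sin t / (1 + cos t)) = t / 2.
Proof.
intros ht; apply Rabs_def2 in ht.
assert (hc : 0 < cos (t / 2)) by (apply cos_gt_0; lra).
assert (e1 : 1 + cos t = 2 * (cos (t / 2) * cos (t / 2))).
{ replace t with (2 * (t / 2)) at 1 by field; rewrite cos_2a_cos; ring. }
assert (e2 : sin t = 2 * sin (t / 2) * cos (t / 2)).
{ replace t with (2 * (t / 2)) at 1 by field; apply sin_2a. }
split; [rewrite e1; nra|].
rewrite e1, e2; replace (2 * sin (t / 2) * cos (t / 2) / (2 * (cos (t / 2) * cos (t / 2))))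
  with (tan (t / 2)) by (unfold tan; field; lra).
apply atan_tan; lra.
Qed.

Lemma rotate_back (p q c d : R) : c ^ 2 + d ^ 2 = 1 ->
  (p, q) = Cmult (c, d) (p * c + q * d, q * c - p * d).
Proof.
intros e; unfold Cmult; simpl fst; simpl snd; apply f_equal2.
- transitivity (p * (c ^ 2 + d ^ 2)); [rewrite e; ring | ring].
- transitivity (q * (c ^ 2 + d ^ 2)); [rewrite e; ring | ring].
Qed.

(** * The inverse map read in the charts *)

Section BackwardChart.
Variable s : R.
Hypothesis hs : 5 / 2 < s.
Notation r := (s - 1).
Notation "u ** v" := (hmul r (hr_half s hs) u v) (at level 40, left associativity).

Definition re_part (h : Hperp r) : HR r :=
  exist _ (fun x => Re (fn h x)) (proj1 (Hs_Re r _ (proj1 (Hperp_mem s h)))).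

Definition im_part (h : Hperp r) : HR r :=
  exist _ (fun x => Im (fn h x)) (proj1 (Hs_Im r _ (proj1 (Hperp_mem s h)))).

Lemma is_linear_re_part : is_linear re_part.
Proof.
split.
- intros u v; apply HR_ext; intros x; reflexivity.
- intros c u; apply HR_ext; intros x; reflexivity.
- exists 1; split; [lra|]; intros u; rewrite Rmult_1_l.
  apply (Hs_Re r (fn u)), (Hperp_mem s u).
Qed.

Lemma is_linear_im_part : is_linear im_part.
Proof.
split.
- intros u v; apply HR_ext; intros x; reflexivity.
- intros c u; apply HR_ext; intros x; reflexivity.
- exists 1; split; [lra|]; intros u; rewrite Rmult_1_l.
  apply (Hs_Im r (fn u)), (Hperp_mem s u).
Qed.

Variables (alpha : R -> circle4pi) (eps : R).
Hypothesis halpha : is_sobolev_circle r alpha.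
Hypothesis heps : eps * eps = 1.

Definition sq_mean (h : Hperp r) : HR r :=
  mean_map s (plus (re_part h ** re_part h) (im_part h ** im_part h)).

Definition sphere_scale (h : Hperp r) : HR r := hinv r (plus (sq_mean h) (one_map s)).

(** With [sphere_im], the inverse stereographic projection [(2 h + eps (|h|^2 - 1)) / (|h|^2 + 1)],
    where [|h|] is the [L^2] norm. *)
Definition sphere_re (h : Hperp r) : HR r :=
  plus (scal eps (minus (sq_mean h) (one_map s))) (scal 2 (re_part h)) ** sphere_scale h.

Definition sphere_im (h : Hperp r) : HR r := scal 2 (im_part h) ** sphere_scale h.

Let ca : HR r := HR_of r (fun x => Re (half_exp (alpha x))).
Let sa : HR r := HR_of r (fun x => Im (half_exp (alpha x))).

(** With [rotated_im], the product of the sphere point and [exp (- i alpha / 2)]: its argument is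
    half of the angle relative to the centre [alpha] of the chart. *)
Definition rotated_re (h : Hperp r) : HR r := plus (sphere_re h ** ca) (sphere_im h ** sa).
Definition rotated_im (h : Hperp r) : HR r := minus (sphere_im h ** ca) (sphere_re h ** sa).

Definition modulus_sq (h : Hperp r) : HR r :=
  plus (rotated_re h ** rotated_re h) (rotated_im h ** rotated_im h).

(** [|w| + Re w], which is positive exactly off the negative half-line; this corresponds to the
    bound [|u| < 2 PI] of the chart. *)
Definition slit_gap (h : Hperp r) : HR r := plus (hsqrt r (modulus_sq h)) (rotated_re h).

Definition backward_slope (h : Hperp r) : HR0 s :=
  primitive_map s (plus (sphere_re h ** sphere_re h) (sphere_im h ** sphere_im h)).

(** The factor [4]: the angle is twice the argument, and the argument is twice an arctangent. *)
Definition backward_angle (h : Hperp r) : HR r :=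
  scal 4 (hatan r (rotated_im h ** hinv r (slit_gap h))).

Definition backward_chart (h : Hperp r) : TG s := (backward_slope h, backward_angle h).

(** The shape produced by two uses of [open_pointwise], the first on the whole space: [slit_gap] is
    smooth only where the modulus, under a square root, is positive. *)
Definition backward_domain (h : Hperp r) : Prop :=
  (True /\ forall x, 0 < fn (modulus_sq h) x) /\ forall x, 0 < fn (slit_gap h) x.

Definition sphere_point (h : Hperp r) : R -> C := pairC (fn (sphere_re h)) (fn (sphere_im h)).

Let Q (h : Hperp r) : R :=
  mean (fun x => Re (fn h x) * Re (fn h x) + Im (fn h x) * Im (fn h x)).

Lemma fn_sq_mean h x : fn (sq_mean h) x = Q h.
Proof. reflexivity. Qed.

Lemma sq_mean_ge0 h : 0 <= Q h.
Proof.
apply RInt_ge_0; [lra | | intros; nra].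
apply continuous_ex_RInt; intros x.
apply (fn_continuous r (plus (re_part h ** re_part h) (im_part h ** im_part h))).
Qed.

Lemma fn_sphere_scale h x : fn (sphere_scale h) x = / (Q h + 1).
Proof.
assert (q0 := sq_mean_ge0 h); assert (hr := hr_three_halves s hs).
unfold sphere_scale; rewrite fn_hinv; trivial; intros y; rewrite fn_plus, fn_sq_mean;
  change (fn (one_map s) y) with 1; lra.
Qed.

Lemma fn_sphere_re h x :
  fn (sphere_re h) x = (eps * (Q h - 1) + 2 * Re (fn h x)) / (Q h + 1).
Proof.
unfold sphere_re; rewrite fn_hmul, fn_sphere_scale, fn_plus, !fn_scal, fn_minus; reflexivity.
Qed.

Lemma fn_sphere_im h x : fn (sphere_im h) x = 2 * Im (fn h x) / (Q h + 1).
Proof. unfold sphere_im; rewrite fn_hmul, fn_sphere_scale, fn_scal; reflexivity. Qed.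

Lemma mean_re_part (h : Hperp r) : mean (fun x => Re (fn h x)) = 0.
Proof.
destruct (Hperp_mem s h) as [hh h0]; rewrite RInt_Re in h0 by apply hh; exact h0.
Qed.

Lemma continuous_re_part (h : Hperp r) x : continuous (fun x => Re (fn h x)) x.
Proof. apply (fn_continuous r (re_part h)). Qed.

Lemma continuous_im_part (h : Hperp r) x : continuous (fun x => Im (fn h x)) x.
Proof. apply (fn_continuous r (im_part h)). Qed.

Lemma mean_sphere_re h : mean (fn (sphere_re h)) = eps * (Q h - 1) / (Q h + 1).
Proof.
assert (q0 := sq_mean_ge0 h).
apply (eq_trans (y := mean (fun x => eps * (Q h - 1) / (Q h + 1) + 2 / (Q h + 1) * Re (fn h x)))).
- apply RInt_ext; intros x _; rewrite fn_sphere_re; rfield; lra.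
- rewrite (mean_plus (fun _ => eps * (Q h - 1) / (Q h + 1))
    (fun x => 2 / (Q h + 1) * Re (fn h x))), mean_const,
    (mean_scal _ (fun x => Re (fn h x))), mean_re_part.
  + ring.
  + intros; apply continuous_re_part.
  + intros; apply continuous_const.
  + intros; apply continuous_Rmult; [apply continuous_const | apply continuous_re_part].
Qed.

Lemma sphere_gap h : 1 - eps * mean (fn (sphere_re h)) = 2 / (Q h + 1).
Proof.
assert (q0 := sq_mean_ge0 h).
rewrite mean_sphere_re.
replace (eps * (eps * (Q h - 1) / (Q h + 1))) with ((eps * eps) * (Q h - 1) / (Q h + 1))
  by (field; lra).
rewrite heps; field; lra.
Qed.

Lemma sphere_point_sqnorm h : sqnorm_L2 (sphere_point h) = 1.
Proof.
assert (q0 := sq_mean_ge0 h); set (q := Q h) in *.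
unfold sphere_point; rewrite sqnorm_L2_pairC.
apply (eq_trans (y := mean (fun x => (q - 1) ^ 2 / (q + 1) ^ 2 +
  4 / (q + 1) ^ 2 * (eps * (q - 1) * Re (fn h x) +
    (Re (fn h x) * Re (fn h x) + Im (fn h x) * Im (fn h x)))))).
- apply RInt_ext; intros x _; rewrite fn_sphere_re, fn_sphere_im; fold q.
  apply Rminus_diag_uniq.
  transitivity ((eps * eps - 1) * ((q - 1) ^ 2 / (q + 1) ^ 2)); [rfield; lra|].
  rewrite heps; rring.
- assert (c1 := continuous_re_part h); assert (c2 := continuous_im_part h).
  assert (c3 : forall x, continuous (fun x : R =>
    Re (fn h x) * Re (fn h x) + Im (fn h x) * Im (fn h x)) x).
  { intros x; apply continuous_Rplus; apply continuous_Rmult; auto. }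
  assert (c4 : forall x, continuous (fun x : R => eps * (q - 1) * Re (fn h x)) x).
  { intros x; apply continuous_Rmult; [apply continuous_const | auto]. }
  assert (c5 : forall x, continuous (fun x : R => eps * (q - 1) * Re (fn h x) +
    (Re (fn h x) * Re (fn h x) + Im (fn h x) * Im (fn h x))) x).
  { intros x; apply continuous_Rplus; auto. }
  eapply eq_trans; [apply (mean_plus (fun _ => (q - 1) ^ 2 / (q + 1) ^ 2) (fun x => _)); intros;
    [apply continuous_const | apply continuous_Rmult; [apply continuous_const | apply c5]]|].
  rewrite mean_const, (mean_scal _ _ c5).
  rewrite (mean_plus _ _ c4 c3), (mean_scal _ (fun x => Re (fn h x)) c1), mean_re_part.
  change (mean (fun x => Re (fn h x) * Re (fn h x) + Im (fn h x) * Im (fn h x))) with q.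
  field; lra.
Qed.

Lemma sphere_point_U_chart h : (forall x, 0 < Cmod (sphere_point h x)) ->
  U_chart r (RtoC eps) (sphere_point h) h.
Proof.
intros hpos; assert (q0 := sq_mean_ge0 h).
assert (hg : 0 < 1 - eps * mean (fn (sphere_re h))).
{ rewrite sphere_gap; apply Rdiv_lt_0_compat; lra. }
split; [split; [|split]|split]; trivial.
- apply is_sobolev_pairC; apply Hs_fn.
- apply sphere_point_sqnorm.
- intros e; assert (em : mean (fn (sphere_re h)) = eps).
  { rewrite <- (mean_const eps); f_equal; extensionality x.
    exact (f_equal (fun f => Re (f x)) e). }
  rewrite em, heps in hg; lra.
- unfold sphere_point; rewrite stereographic_pairC
    by (trivial; try lra; apply fn_continuous).
  rewrite sphere_gap, mean_sphere_re; extensionality x; unfold pairC.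
  rewrite fn_sphere_re, fn_sphere_im, (surjective_pairing (fn h x)).
  change (fst (fn h x)) with (Re (fn h x)); change (snd (fn h x)) with (Im (fn h x)).
  apply f_equal2; unfold Re, Im; simpl; rfield; lra.
Qed.

(** The square norm of [h] determines the component of [f] along the pole, and then the formula of
    the projection can be solved for [f]. *)
Lemma U_chart_sphere_point f h : U_chart r (RtoC eps) f h -> f = sphere_point h.
Proof.
intros [[hf [h1 hpos]] [hne eh]].
assert (q0 := sq_mean_ge0 h).
destruct (Hs_Re r f hf) as [ha _], (Hs_Im r f hf) as [hb _].
set (a := fun x => Re (f x)) in *; set (b := fun x => Im (f x)) in *.
assert (ef : f = pairC a b) by (extensionality x; apply surjective_pairing).
assert (cta := Hs_continuous _ _ ha); assert (ctb := Hs_continuous _ _ hb).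
rewrite ef in h1, hne, eh.
assert (hg := pole_distance a b eps cta ctb heps (Hs_periodic _ _ ha) (Hs_periodic _ _ hb) h1 hne).
rewrite stereographic_pairC in eh by (trivial; lra).
rewrite sqnorm_L2_pairC in h1.
set (m := mean a) in *; set (d := 1 - eps * m) in *.
assert (er : forall x, Re (fn h x) = (a x - m) / d) by (intros x; now rewrite eh).
assert (ei : forall x, Im (fn h x) = b x / d) by (intros x; now rewrite eh).
assert (c3 : forall x, continuous (fun x : R => a x * a x + b x * b x) x)
  by (intros x; apply continuous_Rplus; apply continuous_Rmult; auto).
assert (c4 : forall x, continuous (fun x : R => 2 * m * a x) x)
  by (intros x; apply continuous_Rmult; [apply continuous_const | auto]).
(* The mean of [(a - m)^2 + b^2] is [1 - m^2], which factors as [d (1 + eps m)], and [h] has been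
   divided by [d]. *)
assert (eQ : Q h = (1 + eps * m) / d).
{ apply (eq_trans (y := mean (fun x => / d ^ 2 * ((a x * a x + b x * b x) - 2 * m * a x + m ^ 2)))).
  - apply RInt_ext; intros x _; rewrite er, ei; rfield; lra.
  - rewrite (mean_scal (/ d ^ 2) (fun x => (a x * a x + b x * b x) - 2 * m * a x + m ^ 2)),
      (mean_plus (fun x => (a x * a x + b x * b x) - 2 * m * a x) (fun _ => m ^ 2)),
      (mean_minus _ _ c3 c4), (mean_scal (2 * m) a), mean_const, h1; trivial.
    + fold m; replace (1 - 2 * m * m + m ^ 2) with (1 - (eps * eps) * m ^ 2)
        by (rewrite heps; ring).
      replace (1 - eps * eps * m ^ 2) with (d * (1 + eps * m)) by (unfold d; ring).
      field; lra.
    + intros x; now apply continuous_Rminus.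
    + intros; apply continuous_const.
    + intros x; apply continuous_Rplus; [now apply continuous_Rminus | apply continuous_const]. }
assert (e1 : Q h + 1 = 2 / d) by (rewrite eQ; unfold d; field; fold d; lra).
assert (e2 : eps * (Q h - 1) = 2 * m / d).
{ transitivity (2 * (eps * eps) * m / d); [rewrite eQ; unfold d; field; fold d; lra|].
  rewrite heps; field; lra. }
rewrite ef; extensionality x; unfold sphere_point, pairC.
rewrite fn_sphere_re, fn_sphere_im, e1, e2, er, ei.
apply f_equal2; field; lra.
Qed.

Lemma fn_ca_sa x : half_exp (alpha x) = (fn ca x, fn sa x).
Proof.
destruct (half_exp_components r alpha (hr_three_halves s hs) halpha) as [h1 h2].
unfold ca, sa; rewrite !fn_HR_of by trivial; apply surjective_pairing.
Qed.

Lemma ca_sa_sq x : fn ca x ^ 2 + fn sa x ^ 2 = 1.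
Proof.
assert (h := Cmod_half_exp (alpha x)); rewrite fn_ca_sa in h.
assert (h2 := Cmod2_alt (fn ca x, fn sa x)); rewrite h in h2; simpl in h2 |- *; lra.
Qed.

Lemma rotatedE h x :
  sphere_point h x = Cmult (half_exp (alpha x)) (fn (rotated_re h) x, fn (rotated_im h) x).
Proof.
assert (er : fn (rotated_re h) x = fn (sphere_re h) x * fn ca x + fn (sphere_im h) x * fn sa x)
  by (unfold rotated_re; rewrite fn_plus, !fn_hmul; reflexivity).
assert (ei : fn (rotated_im h) x = fn (sphere_im h) x * fn ca x - fn (sphere_re h) x * fn sa x)
  by (unfold rotated_im; rewrite fn_minus, !fn_hmul; reflexivity).
rewrite fn_ca_sa, er, ei; apply rotate_back, ca_sa_sq.
Qed.

Lemma fn_modulus_sq h x : fn (modulus_sq h) x = Cmod (sphere_point h x) ^ 2.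
Proof.
rewrite rotatedE, Cmod_mult, Cmod_half_exp, Rmult_1_l, Cmod2_alt.
unfold modulus_sq; rewrite fn_plus, !fn_hmul; unfold Re, Im; simpl; rring.
Qed.

Lemma modulus_sqE h x : fn (plus (sphere_re h ** sphere_re h) (sphere_im h ** sphere_im h)) x =
  Cmod (sphere_point h x) ^ 2.
Proof. rewrite Cmod_sq_Re_Im, fn_plus, !fn_hmul; reflexivity. Qed.

Lemma sphere_point_pos h : (forall x, 0 < fn (modulus_sq h) x) ->
  forall x, 0 < Cmod (sphere_point h x).
Proof.
intros hm x; specialize (hm x); rewrite fn_modulus_sq in hm.
destruct (Cmod_ge_0 (sphere_point h x)) as [|e]; trivial.
rewrite <- e in hm; simpl in hm; lra.
Qed.

Lemma fn_slit_gap h x : (forall x, 0 < fn (modulus_sq h) x) ->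
  fn (slit_gap h) x = Cmod (sphere_point h x) + fn (rotated_re h) x.
Proof.
intros hm; unfold slit_gap; rewrite fn_plus, fn_hsqrt by (trivial; apply hr_three_halves, hs).
rewrite fn_modulus_sq, sqrt_pow2 by apply Cmod_ge_0; reflexivity.
Qed.

Lemma fn_backward_angle h x : backward_domain h -> fn (backward_angle h) x =
  4 * atan (fn (rotated_im h) x / (Cmod (sphere_point h x) + fn (rotated_re h) x)).
Proof.
intros [[_ hm] hg]; unfold backward_angle; assert (hr := hr_three_halves s hs).
rewrite fn_scal, fn_hatan, fn_hmul, fn_hinv, fn_slit_gap by trivial; reflexivity.
Qed.

Lemma backward_domain_chart h : backward_domain h ->
  U_chart r (RtoC eps) (sphere_point h) h /\
  G_chart s alpha (Psi (sphere_point h)) (backward_chart h).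
Proof.
intros hdom; assert (hdom' := hdom); destruct hdom' as [[_ hm] hg].
assert (hpos := sphere_point_pos h hm).
assert (hU := sphere_point_U_chart h hpos).
split; trivial; split; [apply (Psi_G_point s hs), hU | split].
- intros x; change (fn (snd (backward_chart h)) x) with (fn (backward_angle h) x).
  rewrite fn_backward_angle by trivial.
  destruct (atan_bound (fn (rotated_im h) x / (Cmod (sphere_point h x) + fn (rotated_re h) x))).
  apply Rabs_def1; lra.
- rewrite (surjective_pairing (Psi (sphere_point h))); unfold G_shift; f_equal.
  + extensionality x; change (fn (fst (backward_chart h)) x) with (fn (backward_slope h) x).
    unfold backward_slope; rewrite (primitive_map_sq s _ (sphere_point h));
      [exact (eq_sym (Rplus_minus x _)) | apply modulus_sqE | apply hU].
  + extensionality x; simpl snd; apply half_exp_eq; trivial.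
    change (fn (snd (backward_chart h)) x) with (fn (backward_angle h) x).
    rewrite half_exp_shift, fn_backward_angle by trivial.
    assert (hx := hpos x); assert (hgx := hg x); rewrite fn_slit_gap in hgx by trivial.
    assert (e : Cmod (sphere_point h x) ^ 2 = fn (rotated_re h) x ^ 2 + fn (rotated_im h) x ^ 2).
    { rewrite <- fn_modulus_sq; unfold modulus_sq; rewrite fn_plus, !fn_hmul; rring. }
    set (n := Cmod (sphere_point h x)) in *.
    replace (4 * atan (fn (rotated_im h) x / (n + fn (rotated_re h) x)) / 2) with
      (2 * atan (fn (rotated_im h) x / (n + fn (rotated_re h) x))) by field.
    rewrite cis_2_atan by trivial; rewrite rotatedE.
    set (w1 := fn (rotated_re h) x); set (w2 := fn (rotated_im h) x).
    destruct (half_exp (alpha x)) as [c d].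
    unfold Cmult, RtoC; simpl; apply f_equal2; field; lra.
Qed.

(** In the chart, the rotated point is its modulus times [cis (u / 2)] with [|u / 2| < PI]. It
    therefore avoids the slit, and the half-tangent formula returns [u]. *)
Lemma G_chart_backward h V : (forall x, 0 < Cmod (sphere_point h x)) ->
  sqnorm_L2 (sphere_point h) = 1 -> G_chart s alpha (Psi (sphere_point h)) V ->
  backward_domain h /\ backward_chart h = V.
Proof.
intros hpos h1 [_ [hb e]].
assert (hw : forall x, (fn (rotated_re h) x, fn (rotated_im h) x) =
  Cmult (RtoC (Cmod (sphere_point h x))) (cis (fn (snd V) x / 2))).
{ intros x; assert (hx := Psi_angle (sphere_point h) x); rewrite e in hx.
  change (snd (G_shift (fun x => x, alpha) V) x) with
    (circle_shift (alpha x) (fn (snd V) x)) in hx.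
  rewrite half_exp_shift in hx; rewrite rotatedE in hx at 2.
  assert (nz : half_exp (alpha x) <> RtoC 0).
  { intros z; assert (h0 := Cmod_half_exp (alpha x)); rewrite z, Cmod_0 in h0; lra. }
  transitivity (Cmult (Cinv (half_exp (alpha x)))
    (Cmult (half_exp (alpha x)) (fn (rotated_re h) x, fn (rotated_im h) x))).
  - rewrite Cmult_assoc, Cinv_l by trivial; symmetry; apply Cmult_1_l.
  - rewrite <- hx.
    set (z := half_exp (alpha x)) in *; set (n := RtoC _); set (c := cis _).
    transitivity (Cmult (Cmult (Cinv z) z) (Cmult n c)); [cring|].
    rewrite Cinv_l by trivial; apply Cmult_1_l. }
assert (hw1 : forall x, fn (rotated_re h) x = Cmod (sphere_point h x) * cos (fn (snd V) x / 2)).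
{ intros x; assert (hx := f_equal Re (hw x)); simpl in hx.
  rewrite Rmult_0_l, Rminus_0_r in hx; exact hx. }
assert (hw2 : forall x, fn (rotated_im h) x = Cmod (sphere_point h x) * sin (fn (snd V) x / 2)).
{ intros x; assert (hx := f_equal Im (hw x)); simpl in hx.
  rewrite Rmult_0_l, Rplus_0_r in hx; exact hx. }
assert (hm : forall x, 0 < fn (modulus_sq h) x)
  by (intros x; rewrite fn_modulus_sq; now apply pow_lt).
assert (ht : forall x, Rabs (fn (snd V) x / 2) < PI).
{ intros x; assert (hx := hb x); apply Rabs_def2 in hx; apply Rabs_def1; lra. }
assert (hdom : backward_domain h).
{ split; [now split|]; intros x; rewrite fn_slit_gap, hw1 by trivial.
  replace (Cmod (sphere_point h x) + Cmod (sphere_point h x) * cos (fn (snd V) x / 2)) with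
    (Cmod (sphere_point h x) * (1 + cos (fn (snd V) x / 2))) by ring.
  apply Rmult_lt_0_compat; [apply hpos | apply atan_half_tangent, ht]. }
split; trivial.
apply injective_projections.
- apply ns_ext; extensionality x.
  change (fn (backward_slope h) x = fn (fst V) x).
  unfold backward_slope; rewrite (primitive_map_sq s _ (sphere_point h)); trivial;
    [|apply modulus_sqE].
  rewrite e; exact (Rplus_minus_l x _).
- apply HR_ext; intros x.
  change (fn (backward_angle h) x = fn (snd V) x).
  rewrite fn_backward_angle, hw1, hw2 by trivial.
  destruct (atan_half_tangent _ (ht x)) as [h2 h3].
  assert (hx := hpos x); set (n := Cmod (sphere_point h x)) in *.
  set (t := fn (snd V) x / 2) in *.
  replace (n * sin t / (n + n * cos t)) with (sin t / (1 + cos t)) by (field; split; nra).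
  rewrite h3; unfold t; rfield.
Qed.

Lemma backward_domain_spec h : backward_domain h <->
  exists f V, U_chart r (RtoC eps) f h /\ G_chart s alpha (Psi f) V.
Proof.
split.
- intros hdom; exists (sphere_point h), (backward_chart h); now apply backward_domain_chart.
- intros [f [V [hU hV]]]; assert (e := U_chart_sphere_point f h hU); subst f.
  apply (G_chart_backward h V); trivial; apply hU.
Qed.

Lemma smooth_on_backward_chart : smooth_on backward_domain backward_chart.
Proof.
assert (hr := hr_three_halves s hs).
assert (s1 : forall W, smooth W re_part) by (intros; apply smooth_linear, is_linear_re_part).
assert (s2 : forall W, smooth W im_part) by (intros; apply smooth_linear, is_linear_im_part).
set (T := fun _ : Hperp r => True).
assert (oT : open T) by exact open_true.
assert (sq : smooth T sq_mean).
{ apply smooth_mean; trivial; apply smooth_plus; apply smooth_mult; auto. }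
assert (sc : smooth T sphere_scale).
{ apply smooth_hinv; trivial.
  - intros h _ x; rewrite fn_plus, fn_sq_mean; change (fn (one_map s) x) with 1.
    generalize (sq_mean_ge0 h); lra.
  - apply smooth_plus; [exact sq | apply smooth_const]. }
assert (sr : smooth T sphere_re).
{ apply smooth_mult; trivial; apply smooth_plus; apply smooth_hscal; auto.
  apply smooth_minus; [exact sq | apply smooth_const]. }
assert (si : smooth T sphere_im) by (apply smooth_mult; trivial; apply smooth_hscal; auto).
assert (mul : forall f g : Hperp r -> HR r, smooth T f -> smooth T g ->
  smooth T (fun h => f h ** g h)) by (intros f g; exact (smooth_mult T r _ f g)).
assert (sca : smooth T (fun _ => ca)) by apply smooth_const.
assert (ssa : smooth T (fun _ => sa)) by apply smooth_const.
assert (wr : smooth T rotated_re)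
  by exact (smooth_plus T _ _ (mul _ _ sr sca) (mul _ _ si ssa)).
assert (wi : smooth T rotated_im)
  by exact (smooth_minus r T _ _ (mul _ _ si sca) (mul _ _ sr ssa)).
assert (sm : smooth T modulus_sq)
  by exact (smooth_plus T _ _ (mul _ _ wr wr) (mul _ _ wi wi)).
set (W1 := fun h : Hperp r => T h /\ forall x, 0 < fn (modulus_sq h) x).
assert (o1 : open W1) by exact (open_pointwise r hr T _ modulus_sq oT open_interval_pos sm).
assert (sg : smooth W1 slit_gap).
{ apply smooth_plus.
  - apply smooth_hsqrt; trivial; [intros h hh; apply hh|].
    now apply (smooth_subset W1 T).
  - now apply (smooth_subset W1 T). }
assert (o2 : open backward_domain)
  by exact (open_pointwise r hr W1 _ slit_gap o1 open_interval_pos sg).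
assert (sub : forall f : Hperp r -> HR r, smooth T f -> smooth backward_domain f)
  by (intros f; now apply smooth_subset).
assert (h1 : smooth backward_domain backward_slope).
{ apply (smooth_linear_comp backward_domain (primitive_map s)).
  - now apply is_linear_primitive_map.
  - apply smooth_plus; apply smooth_mult; auto. }
assert (h2 : smooth backward_domain backward_angle).
{ assert (sg' : smooth backward_domain slit_gap)
    by exact (smooth_subset _ W1 _ (fun h hh => proj1 hh) sg).
  assert (sv := smooth_hinv r hr backward_domain o2 slit_gap (fun h hh => proj2 hh) sg').
  assert (sq' := smooth_mult _ r (hr_half s hs) _ _ (sub _ wi) sv).
  exact (smooth_hscal s _ 4 _ (smooth_hatan r hr _ o2 _ sq')). }
(* Pairs are reduced to sums through the two linear inclusions into [TG s]. *)
assert (l1 : is_linear (fun v : HR0 s => (v, zero) : TG s)).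
{ apply (is_linear_prod (fun v : HR0 s => v) (fun _ => zero : HR r));
    [apply is_linear_id | apply is_linear_zero]. }
assert (l2 : is_linear (fun v : HR r => (zero, v) : TG s)).
{ apply (is_linear_prod (fun _ => zero : HR0 s) (fun v : HR r => v));
    [apply is_linear_zero | apply is_linear_id]. }
assert (h : smooth backward_domain backward_chart).
{ apply (smooth_ext _ (fun h => plus ((backward_slope h, zero) : TG s)
    ((zero, backward_angle h) : TG s))).
  - intros h _; unfold backward_chart; apply injective_projections;
      [exact (plus_zero_r (backward_slope h)) | exact (plus_zero_l (backward_angle h))].
  - apply smooth_plus.
    + exact (smooth_linear_comp _ _ _ l1 h1).
    + exact (smooth_linear_comp _ _ _ l2 h2). }
destruct h as [D hD]; exact (smooth_on_intro _ _ D o2 hD).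
Qed.

End BackwardChart.

Theorem Psi_smooth s : 5 / 2 < s -> smooth_map (U_manifold (s - 1)) (G_manifold s) Psi.
Proof.
intros hs d c [e [he ->]] [alpha [halpha ->]].
assert (h : exists eps, e = RtoC eps /\ eps * eps = 1).
{ destruct he as [-> | ->]; [exists 1 | exists (-1)]; split; trivial; ring. }
destruct h as [eps [-> heps]].
exists (backward_chart s hs alpha eps); split.
- intros f h V hd hc; assert (e := U_chart_sphere_point s hs eps heps f h hd); subst f.
  apply (G_chart_backward s hs alpha eps halpha h V); trivial; apply hd.
- apply (smooth_on_ext (backward_domain s hs alpha eps)).
  + intros h; now apply backward_domain_spec.
  + now apply smooth_on_backward_chart.
Qed.

Theorem theorem3p1 (s : R) (hs : 5 / 2 < s) :
  diffeomorphism (G_manifold s) (U_manifold (s - 1)) Phi /\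
  is_isometry s (s - 1) Phi.
Proof.
split; [split|].
- intros p hp; exact (Phi_U_point s hs p hp).
- exists Psi; split; [|split; [|split; [|split]]].
  + intros f hf; exact (Psi_G_point s hs f hf).
  + intros p hp; exact (Psi_Phi s hs p hp).
  + intros f hf; exact (Phi_Psi s f hf).
  + exact (Phi_smooth s hs).
  + exact (Psi_smooth s hs).
- exact (Phi_isometry s hs).
Qed.
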